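(* Every connected linear algebraic group $G$ over $k$ admits a generalized Cayley morphism; that is, there exists a dominant morphism of algebraic varieties $G\to\mathfrak{g}$ that is $G$-equivariant with respect to the conjugation action of $G$ on itself and the adjoint action of $G$ on its Lie algebra $\mathfrak{g}$.
   Context: $k$ is an algebraically closed field of characteristic $0$. For a connected linear algebraic group $G$ with Lie algebra $\mathfrak{g}$, a generalized Cayley morphism of $G$ is a dominant morphism $\varphi: G\to\mathfrak{g}$ with $\varphi(gXg^{-1})=\mathrm{Ad}_G g(\varphi(X))$ for all $g,X\in G$. *)

(* Defs.v *)
From HB Require Import structures.
From mathcomp Require Import all_boot all_order all_algebra.
From mathcomp.multinomials Require Import mpoly.

Set Implicit Arguments.
Unset Strict Implicit.
Unset Printing Implicit Defensive.

Import GRing.Theory.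
Local Open Scope ring_scope.

(* Polynomial functions on n x n matrices: the coordinate x_ij is the
   variable of index [mxvec_index i j]. *)
Definition mxeval (k : fieldType) (n : nat) (p : {mpoly k[n * n]})
    (A : 'M[k]_n) : k :=
  p.@[fun l => mxvec A 0 l].

Definition zariski_closed (k : fieldType) (n : nat)
    (Z : 'M[k]_n -> Prop) : Prop :=
  exists S : {mpoly k[n * n]} -> Prop,
    forall A, Z A <-> (forall p, S p -> mxeval p A = 0).

(* Linear algebraic groups are the Zariski-closed subgroups of GL_n(k), where
   GL_n(k) carries the topology induced from M_n(k); this coincides with its
   topology as the affine variety with coordinate ring k[x_ij, 1/det]. *)
Record linear_algebraic_group (k : fieldType) (n : nat)
    (G : 'M[k]_n -> Prop) : Prop := LinearAlgebraicGroup {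
  lag_closed : exists2 Z : 'M[k]_n -> Prop, zariski_closed Z &
    forall A, G A <-> A \in unitmx /\ Z A;
  lag_one : G 1%:M;
  lag_mul : forall A B, G A -> G B -> G (A *m B);
  lag_inv : forall A, G A -> G (invmx A)
}.

Definition zariski_connected (k : fieldType) (n : nat)
    (G : 'M[k]_n -> Prop) : Prop :=
  (exists A, G A) /\
  forall Z1 Z2 : 'M[k]_n -> Prop, zariski_closed Z1 -> zariski_closed Z2 ->
    (forall A, G A -> Z1 A \/ Z2 A) ->
    (forall A, G A -> ~ (Z1 A /\ Z2 A)) ->
    (forall A, G A -> ~ Z1 A) \/ (forall A, G A -> ~ Z2 A).

(* The differential of p at A in the direction X. *)
Definition mxdiff (k : fieldType) (n : nat) (p : {mpoly k[n * n]})
    (A X : 'M[k]_n) : k :=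
  \sum_(i < n) \sum_(j < n) mxeval (mderiv (mxvec_index i j) p) A * X i j.

(* The Lie algebra of G: its tangent space at the identity, cut out by the
   differentials of all elements of the vanishing ideal of G. *)
Definition lie_algebra (k : fieldType) (n : nat) (G : 'M[k]_n -> Prop)
    (X : 'M[k]_n) : Prop :=
  forall p : {mpoly k[n * n]},
    (forall A, G A -> mxeval p A = 0) -> mxdiff p 1%:M X = 0.

Definition mxconj (k : fieldType) (n : nat) (g X : 'M[k]_n) : 'M[k]_n :=
  g *m X *m invmx g.

(* The differential at the identity of X |-> g X g^-1: this map extends to a
   linear map of M_n(k), so its differential is given by the same formula. *)
Definition Ad (k : fieldType) (n : nat) (g X : 'M[k]_n) : 'M[k]_n :=
  g *m X *m invmx g.

(* Regular functions on a closed subset of GL_n(k) are the restrictions of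
   elements of k[x_ij, 1/det]. *)
Definition regular_on (k : fieldType) (n : nat) (G : 'M[k]_n -> Prop)
    (f : 'M[k]_n -> k) : Prop :=
  exists (p : {mpoly k[n * n]}) (N : nat),
    forall A, G A -> f A = mxeval p A / \det A ^+ N.

(* Only the values of phi on G are relevant below. *)
Definition morphism_to_lie (k : fieldType) (n : nat) (G : 'M[k]_n -> Prop)
    (phi : 'M[k]_n -> 'M[k]_n) : Prop :=
  (forall A, G A -> lie_algebra G (phi A)) /\
  (forall i j, regular_on G (fun A => phi A i j)).

(* The image of phi is Zariski dense in the Lie algebra. *)
Definition dominant_to_lie (k : fieldType) (n : nat) (G : 'M[k]_n -> Prop)
    (phi : 'M[k]_n -> 'M[k]_n) : Prop :=
  forall Z : 'M[k]_n -> Prop, zariski_closed Z ->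
    (forall A, G A -> Z (phi A)) -> forall X, lie_algebra G X -> Z X.

Record generalized_Cayley_morphism (k : fieldType) (n : nat)
    (G : 'M[k]_n -> Prop) (phi : 'M[k]_n -> 'M[k]_n) : Prop :=
  GeneralizedCayleyMorphism {
  gcm_morphism : morphism_to_lie G phi;
  gcm_dominant : dominant_to_lie G phi;
  gcm_equivariant : forall g X, G g -> G X ->
    phi (mxconj g X) = Ad g (phi X)
}.

(* Main.v *)
(** The morphism is [phi A = F_A (A)] where [F_A] is a polynomial whose coefficients are
    polynomials in those of the characteristic polynomial of [A], so equivariance is
    automatic. Let [T] be the generic torus of ordered spectra of elements of [G] (the zero
    set of a prime [Q] of [k[X_1..X_n]]), with Lie algebra [L] in [k^n], and let [M] be a
    projector onto [L]. On the generalized eigenspace of [x_i], the polynomial [F_A] is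
    [c * (mu_i + log (A / x_i))], where [mu = M (x - 1)] and [c] is a class function clearing
    the denominators; it is obtained by Hermite interpolation and symmetrization over the
    orderings of the spectrum.

    For [p] vanishing on [G], the sequence [p (A ^ j)] is zero and is an exponential
    polynomial in [j]; by independence of exponentials, differentiating it in any direction
    compatible with the multiplicative relations among the eigenvalues still gives zero, so
    [phi A] lies in the Lie algebra. As [G] is irreducible, it suffices to do this for [A]
    outside a proper closed subset.

    For dominance, [exp (tX)] is a formal curve on [G] for [X] in the Lie algebra, and
    [phi (exp (tX)) = c (t) (tX + O (t^2))]; hence the lowest homogeneous part on the Lie
    algebra of a polynomial vanishing on the image of [phi] vanishes at all [X] for which
    [c (t) <> 0], and these are dense. *)
Require Import Defs.
From mathcomp Require Import all_boot all_order all_algebra all_fingroup ring.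
From mathcomp.multinomials Require Import mpoly.
From Stdlib Require Import Classical ClassicalEpsilon.

Set Implicit Arguments.
Unset Strict Implicit.
Unset Printing Implicit Defensive.

Import Order.Theory GRing.Theory Num.Theory.
Local Open Scope ring_scope.

(** * Noetherianity of polynomial rings *)

(** The logarithm of the semisimple part of [A] is not algebraic. The vector [M (x - 1)] replaces
    it: it is polynomial in [x], lies in [L], and has the same first-order term along [exp (tX)]
    because [M] fixes [L]. The logarithm of the unipotent part is already a finite sum. Only
    symmetric polynomials in the spectrum give functions on [G], whereas [Q] is in general not
    stable under all permutations. What is built from [Q] is thus invariant only under its
    stabilizer; a multiplier [v] outside [Q], with its images under all permutations outside the
    stabilizer lying in [Q], then allows a symmetrization over all orderings. The factor [c]
    contains differences of eigenvalues and may vanish at the identity, so dominance cannot be read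
    off the differential of the morphism there. This is why formal curves of arbitrarily high order
    appear. *)

Lemma seq_choice (T U : eqType) (P : T -> U -> Prop) (s : seq T) :
  (forall x, x \in s -> exists y, P x y) ->
  exists t : seq U, (forall y, y \in t -> exists2 x, x \in s & P x y) /\
    forall x, x \in s -> exists2 y, y \in t & P x y.
Proof.
elim: s => [|a s IHs] sP; first by exists [::]; split.
have [|t [tP1 tP2]] := IHs; first by move=> x xs; apply: sP; rewrite inE xs orbT.
have [b Pab] := sP a (mem_head _ _).
exists (b :: t); split=> [y | x]; rewrite inE => /predU1P [->|].
- by exists a; rewrite ?mem_head.
- by case/tP1 => x xs Pxy; exists x; rewrite // inE xs orbT.
- by exists b; rewrite ?mem_head.
by case/tP2 => y yt Pxy; exists y; rewrite // inE yt orbT.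
Qed.

(** By induction on the length. The tails have a finite dominating set; each of its members is
    completed by some head, and [A] bounds these heads. A vector with head at least [A] is dominated
    by a completion, and the smaller heads are treated slice by slice. *)
Lemma dickson (n : nat) (S : seq nat -> Prop) :
  (forall v, S v -> size v = n) ->
  exists s : seq (seq nat), (forall v, v \in s -> S v) /\
    forall v, S v -> exists2 u, u \in s & all2 leq u v.
Proof.
elim: n S => [|n IHn] S Ssz.
  have [S0 | nS0] := classic (S [::]).
    exists [:: [::]]; split=> [v | v /Ssz /size0nil ->]; first by rewrite inE => /eqP ->.
    by exists [::].
  by exists [::]; split=> // v Sv; case: nS0; rewrite -(size0nil (Ssz _ Sv)).
have [|s [s1 s2]] := IHn (fun v => exists a, S (a :: v)).
  by move=> v [a /Ssz [->]].
have [t [t1 t2]] := seq_choice s1.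
have [A tA] : exists A, forall a, a \in t -> (a <= A)%N.
  exists (\max_(a <- t) a)%N => a /(@leq_bigmax_seq _ _ xpredT id) -> //.
have slices B : exists r : seq (seq nat), (forall v, v \in r -> S v) /\
    forall a v, (a < B)%N -> S (a :: v) -> exists2 u, u \in r & all2 leq u (a :: v).
  elim: B => [|B [r [r1 r2]]]; first by exists [::].
  have [|q [q1 q2]] := IHn (fun v => S (B :: v)); first by move=> v /Ssz [->].
  exists (r ++ map (cons B) q); split=> [v | a v].
    by rewrite mem_cat => /orP [/r1 // | /mapP [w /q1 Sw ->]].
  rewrite ltnS leq_eqVlt => /predU1P [-> /q2 [u uq le_uv] | ltaB /r2].
    by exists (B :: u); rewrite /= ?leqnn // mem_cat (map_f (cons B) uq) orbT.
  by case=> // u ur le_uv; exists u; rewrite // mem_cat ur.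
have [r [r1 r2]] := slices A.
have [q [q1 q2]] : exists q : seq (seq nat), (forall v, v \in q -> S v) /\
    forall v, v \in s -> exists2 a, (a <= A)%N & (a :: v) \in q.
  have [q [q1 q2]] := @seq_choice _ _ (fun v w => exists2 a, a \in t & w = a :: v /\ S w) s
    (fun v vs => let: ex_intro2 a ta Sa := t2 v vs in
       ex_intro _ (a :: v) (ex_intro2 _ _ a ta (conj erefl Sa))).
  exists q; split=> [w /q1 [v _ [a _ []]] // | v /q2 [w wq [a /tA leaA [wE _]]]].
  by exists a; rewrite -?wE.
exists (r ++ q); split=> [v | [|a v] Sv]; first by rewrite mem_cat => /orP [/r1 | /q1].
  by have := Ssz _ Sv.
have [leAa | ltaA] := leqP A a.
  have [w ws le_wv] := s2 _ (ex_intro _ a Sv).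
  have [b lebA bwq] := q2 _ ws; exists (b :: w); first by rewrite mem_cat bwq orbT.
  by rewrite /= (leq_trans lebA leAa).
by have [u ur le_u] := r2 _ _ ltaA Sv; exists u; rewrite // mem_cat ur.
Qed.

Definition is_ideal (R : comNzRingType) (I : R -> Prop) : Prop :=
  [/\ I 0, forall x y, I x -> I y -> I (x + y) & forall a x, I x -> I (a * x)].

(** Finite generation is phrased as minimality among ideals, so no coefficients have to be carried.
    Dickson's lemma applies to the leading exponents, and subtracting a monomial multiple of a
    generator lowers the leading monomial. *)
Lemma hilbert_basis (k : fieldType) (n : nat) (I : {mpoly k[n]} -> Prop) :
  is_ideal I ->
  exists s : seq {mpoly k[n]}, (forall f, f \in s -> I f) /\
    forall J, is_ideal J -> (forall f, f \in s -> J f) -> forall f, I f -> J f.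
Proof.
case=> I0 ID IM.
have [|s [s1 s2]] := @dickson n
  (fun v => exists f, [/\ I f, f != 0 & val (val (mlead f)) = v]).
  by move=> _ [f [_ _ <-]]; rewrite size_tuple.
have [t [t1 t2]] := seq_choice s1.
exists t; split=> [f /t1 [v _ []] // | J [J0 JD JM] Jt f].
elim/mleadrect: f => f IHf If.
have [-> // | nzf] := eqVneq f 0.
have [u /t2 [g gt [Ig nzg gu]] le_uf] := s2 _ (ex_intro _ f (And3 If nzf erefl)).
have le_gf : (mlead g <= mlead f)%MM.
  apply/mnm_lepP => i; rewrite !(mnm_nth 0%N) gu.
  have su : size u = n by rewrite -gu size_tuple.
  move: le_uf; rewrite all2E su size_tuple eqxx => /(all_nthP (0, 0)%N) /(_ i).
  rewrite size_zip su size_tuple minnn => /(_ (ltn_ord i)).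
  by rewrite nth_zip ?su ?size_tuple.
pose c := mleadc f / mleadc g.
pose x := c *: 'X_[mlead f - mlead g] : {mpoly k[n]}.
have Jh : J (x * g) by apply: JM; apply: Jt.
have Ih : I (f - x * g) by apply: ID => //; rewrite -mulNr; apply: IM.
rewrite -(subrK (x * g) f); apply: JD => //.
have [-> // | nzd] := eqVneq (f - x * g) 0; apply: IHf => //.
have nzc : c != 0 by rewrite mulf_neq0 ?invr_eq0 ?mleadc_eq0.
have nzx : x != 0 by rewrite -msize_poly_eq0 msizeZ // msizeX.
have lead_h : mlead (x * g) = mlead f by rewrite mleadM // mleadZ // mleadXm submK.
have lc_h : (x * g)@_(mlead f) = mleadc f.
  rewrite -{1}lead_h mleadM // mleadcM mleadcZE mleadXm mcoeffX eqxx mulr1.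
  by rewrite divfK ?mleadc_eq0.
rewrite lt_neqAle; apply/andP; split; last first.
  by rewrite (le_trans (mleadB_le _ _)) // lead_h leUx lexx.
apply: contraNneq nzd => lead_d; rewrite -mleadc_eq0 lead_d mcoeffB lc_h subrr.
by [].
Qed.

(** A strictly increasing chain would have a finitely generated union. Indexing the ideals by [T]
    lets the maximal one keep its origin: a function for an annihilator, a side condition for a
    candidate prime. *)
Lemma noetherian_max (k : fieldType) (n : nat) (T : Type)
    (I : T -> {mpoly k[n]} -> Prop) (t0 : T) :
  (forall t, is_ideal (I t)) ->
  exists t, forall t', (forall x, I t x -> I t' x) -> forall x, I t' x -> I t x.
Proof.
move=> idI; apply: NNPP => no_max.
have nextP t : {t' | (forall x, I t x -> I t' x) /\ exists2 x, I t' x & ~ I t x}.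
  apply: constructive_indefinite_description.
  apply: NNPP => no_next; apply: no_max; exists t => t' sub x It'x.
  by apply: NNPP => nIx; apply: no_next; exists t'; split=> //; exists x.
pose u i := iter i (fun t => sval (nextP t)) t0.
have mono i j : (i <= j)%N -> forall x, I (u i) x -> I (u j) x.
  elim: j => [|j IHj]; first by rewrite leqn0 => /eqP ->.
  rewrite leq_eqVlt => /predU1P [-> // | lt_ij x /(IHj lt_ij)].
  by rewrite [u j.+1]/=; case: (svalP (nextP (u j))) => sub _ /sub.
have idU : is_ideal (fun x => exists i, I (u i) x).
  split=> [|x y [i Ix] [j Iy] | a x [i Ix]]; first by exists 0%N; case: (idI t0).
    exists (maxn i j); case: (idI (u (maxn i j))) => _ ID _.
    by apply: ID; [apply: mono Ix; rewrite leq_maxl | apply: mono Iy; rewrite leq_maxr].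
  by exists i; case: (idI (u i)) => _ _; apply.
have [s [sU sP]] := hilbert_basis idU.
have [N sN] : exists N, forall f, f \in s -> I (u N) f.
  elim: s sU {sP} => [|f s IHs] sU; first by exists 0%N.
  have [|N NP] := IHs; first by move=> g gs; apply: sU; rewrite inE gs orbT.
  have [i If] := sU _ (mem_head _ _); exists (maxn i N) => g.
  rewrite inE => /predU1P [-> | /NP]; first by apply: mono If; rewrite leq_maxl.
  by apply: mono; rewrite leq_maxr.
have := sP _ (idI (u N)) sN.
case: (svalP (nextP (u N))) => _ [x Ix nIx] /(_ x) IN; apply: nIx; apply: IN.
by exists N.+1.
Qed.

(** * Polynomial functions of matrices *)

Lemma mpoly_rmorph_ext (k : comNzRingType) (m : nat) (S : comNzRingType)
    (f g : {rmorphism {mpoly k[m]} -> S}) :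
  (forall c, f c%:MP = g c%:MP) -> (forall i, f 'X_i = g 'X_i) -> f =1 g.
Proof.
move=> fgC fgX p; rewrite [p]mpolyE !rmorph_sum; apply: eq_bigr => mon _.
rewrite -mul_mpolyC !rmorphM /= fgC mpolyXE_id !rmorph_prod; congr (_ * _).
by apply: eq_bigr => i _; rewrite !rmorphXn /= fgX.
Qed.

Lemma rmorph_mmap (k S S' : comNzRingType) (m : nat) (h : {rmorphism k -> S})
    (v : 'I_m -> S) (g : {rmorphism S -> S'}) (p : {mpoly k[m]}) :
  g (mmap h v p) = mmap (g \o h) (g \o v) p.
Proof.
apply: (mpoly_rmorph_ext (f := g \o mmap h v) (g := mmap (g \o h) (g \o v))).
  by move=> c /=; rewrite !mmapC.
by move=> i /=; rewrite !mmapX !mmap1U.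
Qed.

Lemma eq_mmap (k S : comNzRingType) (m : nat) (h : k -> S) (v w : 'I_m -> S)
    (p : {mpoly k[m]}) : v =1 w -> mmap h v p = mmap h w p.
Proof. by move=> vw; apply: eq_bigr => mon _; rewrite (mmap1_eq _ vw). Qed.

Lemma mmap_mmap (k S : comNzRingType) (m r : nat) (h : {rmorphism k -> S})
    (v : 'I_r -> S) (w : 'I_m -> {mpoly k[r]}) (p : {mpoly k[m]}) :
  mmap h v (mmap (@mpolyC r k) w p) = mmap h (fun i => mmap h v (w i)) p.
Proof.
apply: (mpoly_rmorph_ext (f := mmap h v \o mmap (@mpolyC r k) w)
                         (g := mmap h (fun i => mmap h v (w i)))).
  by move=> c /=; rewrite !mmapC.
by move=> i /=; rewrite !mmapX !mmap1U.
Qed.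

Definition generic_mx (k : nzRingType) (n : nat) : 'M[{mpoly k[n * n]}]_n :=
  \matrix_(i, j) 'X_(mxvec_index i j).

Notation mxmap h A := (mmap h (fun l => mxvec A 0 l)).

Lemma map_generic_mx (k S : comNzRingType) (n : nat) (h : {rmorphism k -> S})
    (A : 'M[S]_n) :
  map_mx (mxmap h A) (generic_mx k n) = A.
Proof. by apply/matrixP => i j; rewrite !mxE mmapX mmap1U mxvecE. Qed.

Definition mxcomp (k : comNzRingType) (n : nat) (p : {mpoly k[n * n]})
    (B : 'M[{mpoly k[n * n]}]_n) : {mpoly k[n * n]} := mxmap (@mpolyC (n * n) k) B p.

Lemma mmap_mxcomp (k S : comNzRingType) (n : nat) (h : {rmorphism k -> S})
    (A : 'M[S]_n) (p : {mpoly k[n * n]}) (B : 'M[{mpoly k[n * n]}]_n) :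
  mxmap h A (mxcomp p B) = mxmap h (map_mx (mxmap h A) B) p.
Proof.
by rewrite /mxcomp mmap_mmap; apply: eq_mmap => l; rewrite -map_mxvec mxE.
Qed.

Lemma mxevalE (k : fieldType) (n : nat) (p : {mpoly k[n * n]}) (A : 'M[k]_n) :
  mxeval p A = mxmap (idfun : {rmorphism k -> k}) A p.
Proof. by []. Qed.

Lemma mxtrans_sig (k : fieldType) (n : nat) (B : 'M[k]_n) (p : {mpoly k[n * n]}) :
  {q : {mpoly k[n * n]} | forall (S : comNzRingType) (h : {rmorphism k -> S}) A,
    mxmap h A q = mxmap h (map_mx h B *m A) p}.
Proof.
exists (mxcomp p (map_mx (@mpolyC _ k) B *m generic_mx k n)) => S h A.
rewrite mmap_mxcomp map_mxM map_generic_mx -map_mx_comp.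
have -> // : map_mx (mxmap h A \o @mpolyC _ k) B = map_mx h B.
by apply/matrixP => i j; rewrite !mxE /= mmapC.
Qed.

Definition mxtrans (k : fieldType) (n : nat) (B : 'M[k]_n) (p : {mpoly k[n * n]}) :=
  sval (mxtrans_sig B p).

Lemma mmap_trans (k : fieldType) (S : comNzRingType) (n : nat) (h : {rmorphism k -> S})
    (B : 'M[k]_n) (A : 'M[S]_n) (p : {mpoly k[n * n]}) :
  mxmap h A (mxtrans B p) = mxmap h (map_mx h B *m A) p.
Proof. exact: (svalP (mxtrans_sig B p)). Qed.

Lemma mxeval_trans (k : fieldType) (n : nat) (B A : 'M[k]_n) (p : {mpoly k[n * n]}) :
  mxeval (mxtrans B p) A = mxeval p (B *m A).
Proof. by rewrite !mxevalE mmap_trans map_mx_id. Qed.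

Lemma mxevalM (k : fieldType) (n : nat) (p q : {mpoly k[n * n]}) (A : 'M[k]_n) :
  mxeval (p * q) A = mxeval p A * mxeval q A.
Proof. exact: mevalM. Qed.

Lemma mxevalD (k : fieldType) (n : nat) (p q : {mpoly k[n * n]}) (A : 'M[k]_n) :
  mxeval (p + q) A = mxeval p A + mxeval q A.
Proof. exact: mevalD. Qed.

(** * Connected groups are irreducible *)

Definition irreducible_set (k : fieldType) (n : nat) (G : 'M[k]_n -> Prop) : Prop :=
  forall f g : {mpoly k[n * n]}, (forall A, G A -> mxeval (f * g) A = 0) ->
    (forall A, G A -> mxeval f A = 0) \/ (forall A, G A -> mxeval g A = 0).

(** A maximal annihilator is an associated prime of the ideal of [G]; after a translation its zero
    set [Y] in [G] is a component containing 1. [Y] is a subgroup, and it is open as the union of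
    the translates by [Y] of the open set where [s1] does not vanish. Connectedness then gives
    [Y = G]. *)
Lemma connected_irreducible (k : fieldType) (n : nat) (G : 'M[k]_n -> Prop) :
  linear_algebraic_group G -> zariski_connected G -> irreducible_set G.
Proof.
move=> [[Z _ GZ] G1 GM GV] [_ connG].
have Gunit A : G A -> A \in unitmx by case/GZ.
pose vanish (P : 'M[k]_n -> Prop) f := forall A, P A -> mxeval f A = 0.
pose T := {s | ~ vanish G s}.
have t0 : T.
  exists 1 => /(_ 1%:M G1); rewrite mxevalE rmorph1 => /eqP; rewrite oner_eq0.
  by [].
have idT (t : T) : is_ideal (fun h => vanish G (h * sval t)).
  split=> [A GA | x y Ix Iy A GA | a x Ix A GA].
  - by rewrite mxevalM /mxeval meval0 mul0r.
  - by rewrite mulrDl mxevalD Ix // Iy // addr0.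
  - by have := Ix A GA; rewrite !mxevalM -mulrA => ->; rewrite mulr0.
have [[s nzs] maxs] := noetherian_max t0 idT.
(* The annihilator of [s] is maximal among annihilators, hence prime. *)
have prime_s a b : vanish G (a * b * s) -> vanish G (a * s) \/ vanish G (b * s).
  move=> abs; have [|nbs] := classic (vanish G (b * s)); [by right | left].
  apply: (maxs (exist _ (b * s) nbs)) => [x /= xs A GA | /=]; last by rewrite mulrA.
  by rewrite mulrCA mxevalM xs // mulr0.
have [A0 GA0 sA0] : exists2 A0, G A0 & mxeval s A0 != 0.
  apply: NNPP => noA; apply: (nzs) => A GA; apply/eqP; apply: contra_notT noA => sA.
  by exists A.
pose s1 := mxtrans A0 s.
have s1_1 : mxeval s1 1%:M != 0 by rewrite mxeval_trans mulmx1.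
have prime_s1 a b : vanish G (a * b * s1) -> vanish G (a * s1) \/ vanish G (b * s1).
  move=> abs; pose B0 := invmx A0; have uA0 := Gunit _ GA0.
  have tr (f : {mpoly k[n * n]}) A : G A ->
      mxeval (mxtrans B0 f * s) (A0 *m A) = mxeval (f * s1) A.
    by move=> GA; rewrite !mxevalM !mxeval_trans mulmxA mulVmx // mul1mx.
  have tr' A : G A -> exists2 C, G C & A = A0 *m C.
    by move=> GA; exists (B0 *m A); [apply/GM => //; apply: GV | rewrite mulmxA mulmxV // mul1mx].
  have [|vt|vt] := prime_s (mxtrans B0 a) (mxtrans B0 b).
  - move=> A /tr' [C GC ->]; have := abs C GC.
    by rewrite !mxevalM !mxeval_trans mulmxA mulVmx // mul1mx.
  - by left=> A GA; rewrite -tr //; apply: vt; apply: GM.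
  - by right=> A GA; rewrite -tr //; apply: vt; apply: GM.
pose P1 f := vanish G (f * s1).
pose Y A := G A /\ forall h, P1 h -> mxeval h A = 0.
have F1 A : G A -> mxeval s1 A != 0 -> Y A.
  move=> GA sA; split=> // h /(_ A GA) /eqP.
  by rewrite mxevalM mulf_eq0 (negPf sA) orbF => /eqP.
have F2 h : vanish Y h -> P1 h.
  move=> vh A GA; rewrite mxevalM.
  have [-> | nz] := eqVneq (mxeval s1 A) 0; first by rewrite mulr0.
  by rewrite (vh A) ?mul0r //; apply: F1.
have Y1 : Y 1%:M by apply: F1.
have F3 a y : Y a -> Y y -> Y (invmx a *m y).
  move=> [Ga Ya] [Gy Yy]; split=> [|h P1h]; first by apply: GM => //; apply: GV.
  (* The translate by [a] of [h * s1] vanishes on [Y], so one of its factors is in [P1]; it is not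
     that of [s1], whose value at [a] is the value of [s1] at 1. *)
  have [|P1t|P1t] := prime_s1 (mxtrans (invmx a) h) (mxtrans (invmx a) s1).
  - apply: F2 => x [Gx _].
    have /= := P1h (invmx a *m x) (GM _ _ (GV _ Ga) Gx).
    by rewrite !mxevalM !mxeval_trans.
  - by have := Yy _ P1t; rewrite mxeval_trans.
  - by have := Ya _ P1t; rewrite mxeval_trans mulVmx ?Gunit // => /eqP; rewrite (negPf s1_1).
have YV a : Y a -> Y (invmx a) by move=> Ya; rewrite -[invmx a]mulmx1; apply: F3.
pose Z1 A := forall h, P1 h -> mxeval h A = 0.
pose Z2 A := forall B, Y B -> mxeval s1 (invmx B *m A) = 0.
have clZ1 : zariski_closed Z1 by exists P1.
have clZ2 : zariski_closed Z2.
  exists (fun p => exists2 B, Y B & p = mxtrans (invmx B) s1) => A; split.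
    by move=> Z2A p [B YB ->]; rewrite mxeval_trans; apply: Z2A.
  by move=> Z2A B YB; rewrite -mxeval_trans; apply: Z2A; exists B.
have cover A : G A -> Z1 A \/ Z2 A.
  move=> GA; have [|nZ2] := classic (Z2 A); [by right | left].
  have [B YB nz] : exists2 B, Y B & mxeval s1 (invmx B *m A) != 0.
    apply: NNPP => noB; apply: nZ2 => B YB; apply/eqP.
    by apply: contra_notT noB => nz; exists B.
  have GB : G B by case: YB.
  have YBA : Y (invmx B *m A) by apply: F1 => //; apply: GM => //; apply: GV.
  have := F3 _ _ (YV _ YB) YBA; rewrite invmxK mulmxA mulmxV ?Gunit // mul1mx.
  by case.
have GY A : G A -> Y A.
  move=> GA; have [B GB [Z1B Z2B]|noZ1|noZ2] := connG Z1 Z2 clZ1 clZ2 cover.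
  - have := Z2B B (conj GB Z1B); rewrite mulVmx ?Gunit // => /eqP.
    by rewrite (negPf s1_1).
  - by have [] := noZ1 1%:M G1; case: Y1.
  - by have [|/(noZ2 A GA)] := cover A GA.
move=> f g fg.
have [|P1f|P1g] := prime_s1 f g.
- by move=> A GA; rewrite mxevalM fg ?mul0r.
- by left=> A /GY [_]; apply.
- by right=> A /GY [_]; apply.
Qed.

(** * Spectra and symmetric functions *)

(** An ordered spectrum, over any commutative ring because it is also needed for exponentials with
    entries in [{poly k}]. *)
Definition eigenvalues (S : comNzRingType) (n : nat) (A : 'M[S]_n) (x : 'I_n -> S) :=
  char_poly A = \prod_(i < n) ('X - (x i)%:P).

Lemma eigenvalues_exist (k : closedFieldType) (n : nat) (A : 'M[k]_n) :
  exists x, eigenvalues A x.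
Proof.
have [s sE] := closed_field_poly_normal (char_poly A).
rewrite (monicP (char_poly_monic A)) scale1r in sE.
have ss : size s = n.
  by have := size_char_poly A; rewrite sE size_prod_XsubC => -[].
exists (fun i => s`_i); rewrite /eigenvalues sE (big_nth 0) ss big_mkord.
by [].
Qed.

Lemma eigenvalues_perm (S : comNzRingType) (n : nat) (A : 'M[S]_n) x (s : 'S_n) :
  eigenvalues A x -> eigenvalues A (x \o s).
Proof. by rewrite /eigenvalues => ->; rewrite (reindex_perm s). Qed.

(** The elementary symmetric functions are, up to sign, coefficients of the characteristic
    polynomial of the generic matrix. The same [p] serves all domains [S], so that it can be
    evaluated both on [G] and on formal curves. *)
Lemma sym_mxpoly (k : comNzRingType) (n : nat) (u : {mpoly k[n]}) :
  u \is symmetric ->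
  exists p : {mpoly k[n * n]}, forall (S : idomainType) (h : {rmorphism k -> S})
    (A : 'M[S]_n) x, eigenvalues A x -> mxmap h A p = mmap h x u.
Proof.
move=> /sym_fundamental [t [<- _]].
pose w (i : 'I_n) : {mpoly k[n * n]} := (- 1) ^+ i.+1 * (char_poly (generic_mx k n))`_(n - i.+1).
exists (mmap (@mpolyC _ k) w t) => S h A x Ax.
rewrite mmap_mmap /comp_mpoly mmap_mmap; apply: eq_mmap => i /=.
rewrite /w tnth_mktuple rmorphM rmorphXn rmorphN1 /=.
rewrite -coef_map /= map_char_poly map_generic_mx.
pose X := [tuple x i | i < n].
have -> : char_poly A = \prod_(c <- X) ('X - c%:P).
  by rewrite Ax big_tuple; apply: eq_bigr => j _; rewrite tnth_mktuple.
have lt_i : (i.+1 < n.+1)%N by rewrite ltnS.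
rewrite (mroots_coeff X (Ordinal lt_i)) /= mulrA -expr2 -exprM mulnC exprM sqrrN.
rewrite !expr1n mul1r /mesym !rmorph_sum; apply: eq_bigr => J _.
rewrite !rmorph_prod; apply: eq_bigr => j _.
by rewrite /= mevalXU mmapX mmap1U tnth_mktuple.
Qed.

Lemma triangularization (k : closedFieldType) (n : nat) (A : 'M[k]_n) :
  exists P T, [/\ P \in unitmx, is_trig_mx T & P *m A = T *m P].
Proof.
elim: n A => [|n IHn] A.
  by exists 1%:M, A; rewrite unitmx1 mul1mx mulmx1; split=> //; apply/is_trig_mxP => -[].
have [|a] := @closed_rootP k (char_poly A) _; first by rewrite size_char_poly.
rewrite -eigenvalue_root_char => /eigenvalueP [v vA nzv].
pose P := row_ebase v; have uP : P \in unitmx := row_ebase_unit v.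
have [c nzc vE] : exists2 c, c != 0 & v = c *: row 0 P.
  exists (col_ebase v 0 0).
    have := col_ebase_unit v; rewrite unitmxE det_mx11 unitfE; exact.
  have rv : \rank v = 1%N by rewrite rank_rV nzv.
  rewrite -{1}(mulmx_ebase v) rv [col_ebase v]mx11_scalar mul_scalar_mx -scalemxAl.
  congr (_ *: _); first by rewrite mxE.
  have -> : pid_mx 1 = delta_mx 0 0 :> 'M[k]_(1, n.+1).
    by apply/matrixP => i j; rewrite !mxE !ord1 /= andbT eq_sym -val_eqE.
  by rewrite -rowE.
have PA0 : row 0 (P *m A *m invmx P) = a *: delta_mx 0 0.
  have : row 0 P *m A = a *: row 0 P.
    apply: (scalerI nzc); rewrite scalemxAl -vE vA vE !scalerA mulrC.
    by [].
  rewrite row_mul row_mul => ->; rewrite -scalemxAl -row_mul mulmxV // rowE mulmx1.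
  by [].
have [B BE] : exists B : 'M_(1 + n), B = P *m A *m invmx P by exists (P *m A *m invmx P).
rewrite -BE in PA0.
have Bur : ursubmx B = 0.
  apply/rowP => j; have /rowP /(_ (rshift 1 j)) := PA0.
  by rewrite !mxE /= mulr0 => <-; congr (B _ _); apply/val_inj.
have [P' [T' [uP' trT' P'B]]] := IHn (drsubmx B).
pose P1 : 'M_(1 + n) := block_mx 1%:M 0 0 P'.
pose T : 'M_(1 + n) := block_mx (ulsubmx B) 0 (P' *m dlsubmx B) T'.
have uP1 : P1 \in unitmx by rewrite unitmxE /P1 (@det_ublock _ 1 n) det1 mul1r -unitmxE.
have trT : is_trig_mx T.
  have := @is_trig_block_mx k 1 n 1 n (ulsubmx B) 0 (P' *m dlsubmx B) T' erefl.
  by rewrite eqxx trT' mx11_is_trig => ->.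
have P1B : P1 *m B = T *m P1.
  rewrite -{1}(submxK B) Bur !mulmx_block !mul1mx !mul0mx !mulmx0 !addr0 !add0r.
  by rewrite P'B !mulmx1.
exists (P1 *m P), T; split.
- by rewrite unitmx_mul uP andbT.
- exact: trT.
have PAB : P *m A = B *m P by rewrite BE mulmxKV.
by rewrite -mulmxA PAB !mulmxA; congr (_ *m _).
Qed.

Lemma char_poly_similar (S : comUnitRingType) (n : nat) (P A T : 'M[S]_n) :
  P \in unitmx -> P *m A = T *m P -> char_poly A = char_poly T.
Proof.
move=> uP PAT; rewrite /char_poly.
pose PP := map_mx (@polyC S) P.
have E : PP *m char_poly_mx A = char_poly_mx T *m PP.
  rewrite /char_poly_mx mulmxBr mulmxBl -!map_mxM PAT; congr (_ - _).
  by rewrite mul_mx_scalar mul_scalar_mx.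
have PPV : \det PP * \det (map_mx (@polyC S) (invmx P)) = 1.
  by rewrite -det_mulmx -map_mxM mulmxV // map_mx1 det1.
have := congr1 determinant E; rewrite !det_mulmx => E'.
by rewrite -[LHS]mulr1 -PPV mulrA [_ * \det PP]mulrC E' -mulrA PPV mulr1.
Qed.

Lemma trig_mulmx (S : comNzRingType) (n : nat) (A B : 'M[S]_n) :
  is_trig_mx A -> is_trig_mx B ->
  is_trig_mx (A *m B) /\ forall i, (A *m B) i i = A i i * B i i.
Proof.
move=> /is_trig_mxP tA /is_trig_mxP tB; split=> [|i].
  apply/is_trig_mxP => i j ltij; rewrite mxE big1 // => l _.
  have [ltil | leli] := ltnP i l; first by rewrite tA ?mul0r.
  by rewrite tB ?mulr0 // (leq_ltn_trans leli).
rewrite mxE (bigD1 i) //= big1 ?addr0 // => l neli.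
have [ltil | leli] := ltnP i l; first by rewrite tA ?mul0r.
by rewrite tB ?mulr0 // ltn_neqAle leli andbT.
Qed.

Lemma trig_horner (S : comNzRingType) (n : nat) (T : 'M[S]_n.+1) (h : {poly S}) :
  is_trig_mx T ->
  is_trig_mx (horner_mx T h) /\ forall i, horner_mx T h i i = h.[T i i].
Proof.
move=> trT; elim/poly_ind: h => [|p c [trp dp]].
  by rewrite rmorph0 mx0_is_trig; split=> // i; rewrite mxE horner0.
rewrite rmorphD rmorphM /= horner_mx_X horner_mx_C.
have [/is_trig_mxP tr dg] := trig_mulmx trp trT.
split=> [|i]; last by rewrite mxE dg dp mxE eqxx hornerMXaddC.
apply/is_trig_mxP => i j ltij; rewrite mxE tr // add0r mxE -val_eqE.
by rewrite (ltn_eqF ltij).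
Qed.

Lemma horner_mx_similar (S : comNzRingType) (n : nat) (P A T : 'M[S]_n.+1) (h : {poly S}) :
  P *m A = T *m P -> P *m horner_mx A h = horner_mx T h *m P.
Proof.
move=> PAT; elim/poly_ind: h => [|p c IHp]; first by rewrite !rmorph0 mulmx0 mul0mx.
rewrite !rmorphD !rmorphM /= !horner_mx_X !horner_mx_C mulmxDr mulmxDl.
rewrite mul_mx_scalar mul_scalar_mx; congr (_ + _).
by rewrite -[RHS]mulmxA -PAT [RHS]mulmxA -IHp -[RHS]mulmxA.
Qed.

(** Triangularization is done over [k], where [X] lives, and then mapped to [S], which need not be a
    field. The diagonal and the given spectrum of [X] agree up to order. *)
Lemma eigenvalues_horner (k : closedFieldType) (S : comUnitRingType)
    (h : {rmorphism k -> S}) (n : nat) (X : 'M[k]_n.+1) x (f : {poly S}) :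
  eigenvalues X x ->
  eigenvalues (horner_mx (map_mx h X) f) (fun i => f.[h (x i)]).
Proof.
have [P [T [uP trT PXT]]] := triangularization X.
rewrite /eigenvalues (char_poly_similar uP PXT) (char_poly_trig trT) => eqT.
have PXT' : map_mx h P *m map_mx h X = map_mx h T *m map_mx h P by rewrite -!map_mxM PXT.
have uPh : map_mx h P \in unitmx by rewrite unitmxE det_map_mx rmorph_unit // -unitmxE.
rewrite (char_poly_similar uPh (horner_mx_similar f PXT')).
have [|tr dg] := @trig_horner _ _ (map_mx h T) f.
  by apply/is_trig_mxP => i j ltij; rewrite mxE (is_trig_mxP trT) // rmorph0.
rewrite char_poly_trig //.
pose F c : {poly S} := 'X - (f.[h c])%:P.
rewrite (eq_bigr (fun i => F (T i i))); last by move=> i _; rewrite dg mxE.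
rewrite -(big_map (fun i => T i i) xpredT F) -(big_map x xpredT F).
apply: perm_big; apply: prod_XsubC_eq.
by rewrite !big_map.
Qed.

(** * The prime of the generic spectrum *)

Definition is_subspace (k : fieldType) (V : lmodType k) (P : V -> Prop) : Prop :=
  P 0 /\ forall c x y, P x -> P y -> P (c *: x + y).

Lemma natr_inj_char0 (R : idomainType) : [pchar R] =i pred0 ->
  forall i j : nat, (i%:R == j%:R :> R) = (i == j).
Proof.
move=> char i j; have char0 := (pcharf0P _).1 char; wlog lij : i j / (i <= j)%N => [hw|].
  by case/orP: (leq_total i j) => /hw //; rewrite eq_sym => ->; rewrite eq_sym.
by rewrite eq_sym -subr_eq0 -natrB // char0 subn_eq0 eqn_leq lij.
Qed.

(** A vector space over an infinite field is not a finite union of proper subspaces. If [a] lies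
    outside [L i0], two points [j a + v] of a line lie in the same member, which then contains both
    [a] and [v]; it is not [L i0], which may be discarded. The lemma serves to exchange quantifiers:
    one ordering of a spectrum, or one vector, that works for all conditions at once. *)
Lemma subspace_avoidance (k : fieldType) (V : lmodType k) (T : Type)
    (I : V -> Prop) (K : T -> V -> Prop) (s : seq T) :
  [pchar k] =i pred0 -> is_subspace I -> (forall t, is_subspace (K t)) ->
  (forall v, I v -> exists i : 'I_(size s), K (tnth (in_tuple s) i) v) ->
  exists i : 'I_(size s), forall v, I v -> K (tnth (in_tuple s) i) v.
Proof.
move=> char0 [I0 IL] subK; set L := fun i => K (tnth (in_tuple s) i).
have subL i : is_subspace (L i) by apply: subK.
suff main (D : {set 'I_(size s)}) :
    (forall v, I v -> exists2 i, i \in D & L i v) ->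
    exists i, forall v, I v -> L i v.
  by move=> cov; apply: (main setT) => v /cov [i Li]; exists i.
elim: {D}#|D| {-2}D (leqnn #|D|) => [|m IHm] D.
  by rewrite leqn0 cards_eq0 => /eqP -> /(_ 0 I0) [i]; rewrite inE.
move=> leDm cov.
have [i0 i0D _] := cov 0 I0.
have [sub|nsub] := classic (forall v, I v -> L i0 v); first by exists i0.
have [a Ia nLa] : exists2 a, I a & ~ L i0 a.
  by apply: NNPP => no; apply: nsub => v Iv; apply: NNPP => nL; apply: no; exists v.
apply: (IHm (D :\ i0)) => [|v Iv].
  by move: leDm; rewrite (cardsD1 i0) i0D.
have line (j : 'I_(size s).+1) : exists i, i \in D /\ L i ((j : nat)%:R *: a + v).
  by have [|i iD Li] := cov ((j : nat)%:R *: a + v); [apply: IL | exists i].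
pose f (j : 'I_(size s).+1) := sval (constructive_indefinite_description _ (line j)).
have fP j : f j \in D /\ L (f j) ((j : nat)%:R *: a + v).
  exact: (svalP (constructive_indefinite_description _ (line j))).
have /injectivePn [j1 [j2 ne12 eqf]] : ~~ injectiveb f.
  apply/negP => /injectiveP /leq_card; rewrite !card_ord ltnn.
  by [].
have [L0 LL] := subL (f j1).
have [fD L1] := fP j1; have [_] := fP j2; rewrite -eqf => L2.
pose d : k := j1%:R - j2%:R.
have nzd : d != 0.
  by rewrite subr_eq0 natr_inj_char0.
have La : L (f j1) a.
  have -> : a = d^-1 *: (-1 *: (j2%:R *: a + v) + (j1%:R *: a + v)) + 0.
    rewrite addr0 scaleN1r opprD addrACA addNr addr0 addrC -scalerBl scalerA.
    by rewrite mulVf // scale1r.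
  by apply: (LL) => //; apply: LL.
have Lv : L (f j1) v.
  have -> : v = - j1%:R *: a + (j1%:R *: a + v) by rewrite addrA -scalerDl addNr scale0r add0r.
  exact: LL.
exists (f j1) => //; rewrite !inE fD andbT.
by apply: contra_notN nLa => /eqP <-.
Qed.

Lemma mmap_msym (k S : comNzRingType) (n : nat) (h : {rmorphism k -> S})
    (x : 'I_n -> S) (s : 'S_n) (u : {mpoly k[n]}) :
  mmap h x (msym s u) = mmap h (x \o s) u.
Proof. by rewrite /msym mmap_mmap; apply: eq_mmap => i; rewrite mmapX mmap1U. Qed.

Lemma msym_prod_symmetric (k : comNzRingType) (n : nat) (u : {mpoly k[n]}) :
  \prod_(s : 'S_n) msym s u \is symmetric.
Proof.
apply/issymP => t; rewrite rmorph_prod /= [RHS](reindex_inj (mulIg t)).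
by apply: eq_bigr => s _; rewrite msymMm.
Qed.

Lemma msym_sum_symmetric (k : comNzRingType) (n : nat) (u : {mpoly k[n]}) :
  \sum_(s : 'S_n) msym s u \is symmetric.
Proof.
apply/issymP => t; rewrite rmorph_sum /= [RHS](reindex_inj (mulIg t)).
by apply: eq_bigr => s _; rewrite msymMm.
Qed.

Definition spectral_vanish (k : fieldType) (n : nat) (G : 'M[k]_n -> Prop)
    (u : {mpoly k[n]}) : Prop :=
  forall A x, G A -> eigenvalues A x -> u.@[x] = 0.

(* A prime of the ring of functions on ordered spectra lying over the prime of the
   symmetric functions that vanish on [G]; it cuts out the closure of the diagonal
   group of a maximal torus. *)
Record spectral_prime (k : fieldType) (n : nat) (G : 'M[k]_n -> Prop)
    (Q : {mpoly k[n]} -> Prop) : Prop := SpectralPrime {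
  sp_ideal : is_ideal Q;
  sp_prime : forall a b, Q (a * b) -> Q a \/ Q b;
  sp_sym : forall s, s \is symmetric -> Q s -> spectral_vanish G s;
  sp_sep : forall u, ~ Q u -> exists s q r,
    [/\ s \is symmetric, ~ spectral_vanish G s, Q q & s = q + r * u]
}.

Lemma sym_mxpoly_eval (k : fieldType) (n : nat) (u : {mpoly k[n]}) :
  u \is symmetric ->
  exists p : {mpoly k[n * n]}, forall (A : 'M[k]_n) x, eigenvalues A x -> mxeval p A = u.@[x].
Proof. by move=> /sym_mxpoly [p pE]; exists p => A x Ax; rewrite mxevalE (pE _ idfun _ x). Qed.

Lemma spectral_vanishM (k : closedFieldType) (n : nat) (G : 'M[k]_n -> Prop) s t :
  irreducible_set G -> s \is symmetric -> t \is symmetric ->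
  spectral_vanish G (s * t) -> spectral_vanish G s \/ spectral_vanish G t.
Proof.
move=> irrG /sym_mxpoly_eval [p pE] /sym_mxpoly_eval [q qE] st.
have [|p0|q0] := irrG p q.
- move=> A GA; have [x Ax] := eigenvalues_exist A.
  by rewrite mxevalM (pE _ _ Ax) (qE _ _ Ax) -mevalM (st A).
- by left=> A x GA Ax; rewrite -(pE _ _ Ax) p0.
- by right=> A x GA Ax; rewrite -(qE _ _ Ax) q0.
Qed.

(** [Q] is maximal among the ideals whose symmetric members vanish on the spectra of [G], and
    [sp_sep] expresses this maximality. Primality follows, since by irreducibility a product of two
    symmetric functions that do not vanish on [G] does not vanish either. *)
Lemma spectral_prime_exists (k : closedFieldType) (n : nat) (G : 'M[k]_n -> Prop) :
  irreducible_set G -> exists Q, spectral_prime G Q.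
Proof.
move=> irrG.
pose T := {Q : {mpoly k[n]} -> Prop |
  is_ideal Q /\ forall s, s \is symmetric -> Q s -> spectral_vanish G s}.
have idz : is_ideal (fun f : {mpoly k[n]} => f = 0).
  by split=> [|x y -> ->|a x ->]; rewrite ?addr0 ?mulr0.
have zT : forall s : {mpoly k[n]}, s \is symmetric -> s = 0 -> spectral_vanish G s.
  by move=> s _ -> A x _ _; rewrite meval0.
have [[Q [idQ symQ]] /= maxQ] := noetherian_max (exist _ _ (conj idz zT) : T)
  (fun t : T => proj1 (svalP t)).
have [Q0 QD QM] := idQ.
have sepQ u : ~ Q u -> exists s q r,
    [/\ s \is symmetric, ~ spectral_vanish G s, Q q & s = q + r * u].
  move=> nQu; apply: NNPP => no; apply: (nQu).
  pose Q' f := exists q r, Q q /\ f = q + r * u.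
  have idQ' : is_ideal Q'.
    split=> [|x y [q [r [Qq ->]]] [q' [r' [Qq' ->]]]|a x [q [r [Qq ->]]]].
    - by exists 0, 0; rewrite mul0r addr0.
    - by exists (q + q'), (r + r'); rewrite mulrDl addrACA; split=> //; apply: QD.
    - by exists (a * q), (a * r); rewrite mulrDr mulrA; split=> //; apply: QM.
  have symQ' s : s \is symmetric -> Q' s -> spectral_vanish G s.
    move=> sym_s [q [r [Qq sE]]]; apply: NNPP => nv; apply: no.
    by exists s, q, r.
  apply: (maxQ (exist _ Q' (conj idQ' symQ'))) => /= [x Qx|].
    by exists x, 0; rewrite mul0r addr0.
  by exists 0, 1; rewrite mul1r add0r.
exists Q; split=> // a b Qab; have [|nQa] := classic (Q a); [by left | right].
apply: NNPP => nQb.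
have [s [q [r [sym_s nvs Qq sE]]]] := sepQ _ nQa.
have [t [q' [r' [sym_t nvt Qq' tE]]]] := sepQ _ nQb.
have Qst : Q (s * t).
  rewrite sE mulrDl; apply: (QD); first by rewrite mulrC; apply: (QM).
  rewrite tE mulrDr; apply: (QD); first exact: (QM).
  by rewrite mulrACA; apply: (QM).
by case: (spectral_vanishM irrG sym_s sym_t (symQ _ (rpredM sym_s sym_t) Qst)).
Qed.

Section SpectralPrime.
Variables (k : closedFieldType) (n : nat) (G : 'M[k]_n -> Prop).
Variable Q : {mpoly k[n]} -> Prop.
Hypotheses (char0 : [pchar k] =i pred0) (spQ : spectral_prime G Q).

Lemma spectral_prime_ordering (K : 'S_n -> {mpoly k[n]} -> Prop) :
  (forall s, is_subspace (K s)) -> (forall q, Q q -> exists s, K s q) ->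
  exists s, forall q, Q q -> K s q.
Proof.
move=> subK cov; have [Q0 QD QM] := sp_ideal spQ.
have subQ : is_subspace (Q : {mpoly k[n]} -> Prop).
  by split=> // c x y Qx Qy; apply: QD => //; rewrite -mul_mpolyC; apply: QM.
have [|i iP] := @subspace_avoidance k _ _ Q K (enum 'S_n) char0 subQ subK.
  move=> q /cov [s Ks]; have si : (index s (enum 'S_n) < size (enum 'S_n))%N.
    by rewrite index_mem mem_enum.
  by exists (Ordinal si); rewrite (tnth_nth s) /= nth_index ?mem_enum.
by exists (tnth (in_tuple (enum 'S_n)) i).
Qed.

Lemma spectral_prime_norm q : Q q -> Q (\prod_(s : 'S_n) msym s q).
Proof.
case: (sp_ideal spQ) => _ _ QM Qq.
by rewrite (bigD1 1%g) //= msym1m mulrC; apply: QM.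
Qed.

(** The product of all conjugates of [q] is symmetric and in [Q], so it vanishes at the spectrum,
    and [q] vanishes at some reordering of it. Avoidance makes the reordering independent of [q]. *)
Lemma spectral_point A : G A -> exists2 x, eigenvalues A x & forall q, Q q -> q.@[x] = 0.
Proof.
move=> GA; have [x Ax] := eigenvalues_exist A.
have [|q Qq|s sP] := @spectral_prime_ordering (fun s q => q.@[x \o s] = 0).
- by move=> s; split=> [|c p q p0 q0]; rewrite ?meval0 // mevalD mevalZ p0 q0 mulr0 addr0.
- have := sp_sym spQ (msym_prod_symmetric q) (spectral_prime_norm Qq) GA Ax.
  rewrite rmorph_prod => /eqP /prodf_eq0 [s _ /eqP].
  by rewrite /= /meval mmap_msym; exists s.
- by exists (x \o s) => //; apply: eigenvalues_perm.
Qed.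

End SpectralPrime.

(** * Formal exponentials *)

Lemma mpoly_alg_ind (k : comNzRingType) (m : nat) (P : {mpoly k[m]} -> Prop) :
  (forall c, P c%:MP) -> (forall i, P 'X_i) ->
  (forall p q, P p -> P q -> P (p + q)) -> (forall p q, P p -> P q -> P (p * q)) ->
  forall p, P p.
Proof.
move=> PC PX PD PM p; rewrite [p]mpolyE.
apply: (big_ind P) => [|q r Pq Pr|mon _]; [by rewrite -mpolyC0 | exact: PD |].
rewrite -mul_mpolyC mpolyXE_id; apply: (PM) => //.
apply: (big_ind P) => [|q r Pq Pr|i _]; [by rewrite -mpolyC1 | exact: PM |].
by elim: (mon i) => [|e IHe]; rewrite ?expr0 -?mpolyC1 // exprS; apply: PM.
Qed.

Lemma horner_mmap (k : comNzRingType) (m : nat) (v : 'I_m -> {poly k}) (p : {mpoly k[m]}) a :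
  (mmap (@polyC k) v p).[a] = p.@[fun l => (v l).[a]].
Proof.
have := rmorph_mmap (@polyC k) v (horner_eval a) p; rewrite /= /horner_eval => ->.
rewrite /meval /mmap; apply: eq_bigr => mon _.
by rewrite /= /horner_eval hornerC.
Qed.

Lemma deriv_mmap (k : comNzRingType) (m : nat) (v : 'I_m -> {poly k}) (p : {mpoly k[m]}) :
  (mmap (@polyC k) v p)^`() =
  \sum_(l < m) mmap (@polyC k) v (mderiv l p) * (v l)^`().
Proof.
elim/mpoly_alg_ind: p => [c|i|p q IHp IHq|p q IHp IHq].
- by rewrite mmapC derivC big1 // => l _; rewrite mderivC mmap0 mul0r.
- rewrite mmapX mmap1U (bigD1 i) //= big1 => [|l neli].
    have -> : mderiv i 'X_i = 1 :> {mpoly k[m]}.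
      rewrite mderivX mnmE eqxx scale1r -[RHS]mpolyX0; congr 'X_[_].
      by apply/mnmP => j; rewrite mnmBE subnn mnm0E.
    by rewrite rmorph1 mul1r addr0.
  by rewrite mderivX mnmE eq_sym (negPf neli) scale0r mmap0 mul0r.
- rewrite mmapD derivD IHp IHq -big_split; apply: eq_bigr => l _ /=.
  by rewrite mderivD mmapD mulrDl.
- rewrite rmorphM derivM IHp IHq mulr_suml mulr_sumr -big_split; apply: eq_bigr => l _ /=.
  by rewrite mderivM mmapD !rmorphM /= mulrDl mulrAC !mulrA.
Qed.

Lemma big_mxvec (R : nmodType) (n : nat) (F : 'I_(n * n) -> R) :
  \sum_l F l = \sum_(i < n) \sum_(j < n) F (mxvec_index i j).
Proof.
rewrite pair_bigA /= (reindex _ (curry_mxvec_bij n n)) /=.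
by apply: eq_bigr => -[i j] _.
Qed.

Lemma mxdiff_curve (k : fieldType) (n : nat) (p : {mpoly k[n * n]}) (B : 'M[{poly k}]_n) :
  (mxmap (@polyC k) B p)^`().[0] =
  mxdiff p (map_mx (horner_eval 0) B) (map_mx (fun b => b^`().[0]) B).
Proof.
rewrite deriv_mmap horner_sum big_mxvec; apply: eq_bigr => i _; apply: eq_bigr => j _.
rewrite hornerM horner_mmap mxvecE mxE /mxeval; congr (_ * _).
by apply: meval_eq => l; rewrite -map_mxvec mxE.
Qed.

Lemma mxdiff_trans (k : fieldType) (n : nat) (p : {mpoly k[n * n]}) (A X : 'M[k]_n) :
  mxdiff (mxtrans A p) 1%:M X = mxdiff p A (A *m X).
Proof.
pose B : 'M[{poly k}]_n := map_mx (@polyC k) 1%:M + 'X *: map_mx (@polyC k) X.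
have B0 : map_mx (horner_eval 0) B = 1%:M.
  apply/matrixP => i j; rewrite !mxE /horner_eval hornerD hornerM hornerX mul0r addr0.
  by rewrite hornerC.
have B1 : map_mx (fun b => b^`().[0]) B = X.
  apply/matrixP => i j; rewrite !mxE derivD derivM !derivC derivX hornerD mulr0 addr0.
  by rewrite mul1r !hornerC add0r.
rewrite -{1}B0 -{1}B1 -mxdiff_curve mmap_trans mxdiff_curve; congr (mxdiff p _ _).
  rewrite map_mxM B0 mulmx1 -map_mx_comp.
  by apply/matrixP => i j; rewrite !mxE /= /horner_eval hornerC.
rewrite -[in RHS]B1; apply/matrixP => i j; rewrite !mxE raddf_sum horner_sum /=.
apply: eq_bigr => l _; rewrite !mxE derivM derivC mul0r add0r hornerM hornerC.
by [].
Qed.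

Lemma Xn_dvdP (k : fieldType) (N : nat) (p : {poly k}) :
  reflect (forall i, (i < N)%N -> p`_i = 0) ('X^N %| p).
Proof.
apply: (iffP idP) => [/dvdpP [q ->] i ltiN | p0]; first by rewrite coefMXn ltiN.
rewrite -(poly_take_drop N p); apply: dvdp_add; last exact: dvdp_mulIr.
rewrite (_ : take_poly N p = 0) ?dvdp0 //.
by apply/polyP => i; rewrite coef_take_poly coef0; case: ltnP => // /p0.
Qed.

Lemma dvdp_congr (k : fieldType) (d a b : {poly k}) : d %| b -> d %| a - b -> d %| a.
Proof. by move=> db dab; rewrite -(subrK b a) dvdp_addl. Qed.

Lemma dvdp_sum (k : fieldType) (I : finType) (d : {poly k}) (F : I -> {poly k}) :
  (forall i, d %| F i) -> d %| \sum_i F i.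
Proof. by move=> dF; apply: (big_ind (fun x => d %| x)) => // x y; apply: dvdp_add. Qed.

Lemma mmap_congr (k : fieldType) (m : nat) (d : {poly k}) (v w : 'I_m -> {poly k})
    (p : {mpoly k[m]}) :
  (forall l, d %| v l - w l) -> d %| mmap (@polyC k) v p - mmap (@polyC k) w p.
Proof.
move=> vw; elim/mpoly_alg_ind: p => [c|i|p q IHp IHq|p q IHp IHq].
- by rewrite !mmapC subrr dvdp0.
- by rewrite !mmapX !mmap1U vw.
- by rewrite !mmapD opprD addrACA; apply: dvdp_add.
- set p1 := mmap _ v p in IHp *; set p2 := mmap _ w p in IHp *.
  set q1 := mmap _ v q in IHq *; set q2 := mmap _ w q in IHq *.
  rewrite !rmorphM /= -/p1 -/p2 -/q1 -/q2.
  have -> : p1 * q1 - p2 * q2 = (p1 - p2) * q1 + p2 * (q1 - q2).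
    by rewrite mulrBl mulrBr addrA subrK.
  by apply: dvdp_add; [apply: dvdp_mulr | apply: dvdp_mull].
Qed.

(** [exp (t x)] truncated below [t ^ N]: the outer variable is [x], the inner one is [t]. Power
    series in [t] are handled as polynomials modulo ['X^N] for arbitrary [N]. *)
Definition expP (k : fieldType) (N : nat) : {poly {poly k}} :=
  \poly_(i < N) (i`!%:R^-1 *: 'X^i).

Definition mxexp (k : fieldType) (n N : nat) (X : 'M[k]_n.+1) : 'M[{poly k}]_n.+1 :=
  horner_mx (map_mx (@polyC k) X) (expP k N).

Definition vexp (k : fieldType) (n N : nat) (x : 'I_n -> k) (i : 'I_n) : {poly k} :=
  (expP k N).[(x i)%:P].

Lemma eigenvalues_mxexp (k : closedFieldType) (n N : nat) (X : 'M[k]_n.+1) x :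
  eigenvalues X x -> eigenvalues (mxexp N X) (vexp N x).
Proof. exact: eigenvalues_horner. Qed.

Lemma coef_expP (k : fieldType) (N i : nat) :
  (expP k N)`_i = if (i < N)%N then i`!%:R^-1 *: 'X^i else 0.
Proof. exact: coef_poly. Qed.

Lemma expPS (k : fieldType) (N : nat) :
  expP k N.+1 = expP k N + (N`!%:R^-1 *: 'X^N)%:P * 'X^N.
Proof.
apply/polyP => i; rewrite coefD coefCM coefXn !coef_expP ltnS.
by case: ltngtP => [lt|lt|->]; rewrite ?mulr0 ?addr0 ?mulr1 ?add0r.
Qed.

Lemma mxexp_entry (k : fieldType) (n N : nat) (X : 'M[k]_n.+1) i j m :
  (mxexp N X i j)`_m = if (m < N)%N then m`!%:R^-1 * (X ^+ m) i j else 0.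
Proof.
elim: N => [|N IHN].
  rewrite /mxexp (_ : expP k 0 = 0) ?rmorph0 ?mxE ?coef0 //.
  by apply/polyP => l; rewrite coef_expP coef0.
rewrite /mxexp expPS rmorphD rmorphM /= horner_mx_C rmorphXn /= horner_mx_X -/(mxexp N X).
rewrite -mulmxE mul_scalar_mx -rmorphXn /= mxE coefD IHN !mxE -scalerAl coefZ coefXnM ltnS coefC.
by case: ltngtP => [lt|lt|->]; rewrite ?mulr0 ?addr0 ?subnn ?add0r // subn_eq0 leqNgt lt ?mulr0.
Qed.

(** The left-invariant vector field of [X]: the derivative of [p] at [A] in the direction [A X]. *)
Definition mxlder (k : comNzRingType) (n : nat) (X : 'M[k]_n) (p : {mpoly k[n * n]}) :
    {mpoly k[n * n]} :=
  \sum_i \sum_j mderiv (mxvec_index i j) p * (generic_mx k n *m map_mx (@mpolyC _ k) X) i j.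

Lemma mmap_lder (k S : comNzRingType) (n : nat) (h : {rmorphism k -> S}) (A : 'M[S]_n)
    (X : 'M[k]_n) (p : {mpoly k[n * n]}) :
  mxmap h A (mxlder X p) =
  \sum_i \sum_j mxmap h A (mderiv (mxvec_index i j) p) * (A *m map_mx h X) i j.
Proof.
rewrite /mxlder rmorph_sum; apply: eq_bigr => i _; rewrite rmorph_sum.
apply: eq_bigr => j _; rewrite rmorphM /=; congr (_ * _).
rewrite !mxE rmorph_sum; apply: eq_bigr => l _.
by rewrite rmorphM /= !mxE mmapX mmap1U mxvecE mmapC.
Qed.

Definition vanishes_on (k : fieldType) (n : nat) (G : 'M[k]_n -> Prop)
    (p : {mpoly k[n * n]}) : Prop := forall A, G A -> mxeval p A = 0.

Lemma lie_algebra_lder (k : fieldType) (n : nat) (G : 'M[k]_n -> Prop) X p :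
  linear_algebraic_group G -> lie_algebra G X -> vanishes_on G p -> vanishes_on G (mxlder X p).
Proof.
move=> [_ _ GM _] gX Gp A GA.
have -> : mxeval (mxlder X p) A = mxdiff p A (A *m X).
  by rewrite mxevalE mmap_lder map_mx_id.
by rewrite -mxdiff_trans gX // => B GB; rewrite mxeval_trans Gp //; apply: GM.
Qed.

Lemma fact_neq0 (k : fieldType) : [pchar k] =i pred0 -> forall i, i`!%:R != 0 :> k.
Proof. by move=> char0 i; rewrite ((pcharf0P _).1 char0) -lt0n fact_gt0. Qed.

Lemma deriv_mxexp (k : fieldType) (n N : nat) (X : 'M[k]_n.+1) i j :
  [pchar k] =i pred0 ->
  (mxexp N.+1 X i j)^`() = (mxexp N X *m map_mx (@polyC k) X) i j.
Proof.
move=> char0; apply/polyP => m; rewrite coef_deriv mxexp_entry ltnS mxE coef_sum.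
rewrite (eq_bigr (fun l => (mxexp N X i l)`_m * X l j)); last first.
  by move=> l _; rewrite mxE coefMC.
under eq_bigr do rewrite mxexp_entry.
case: ltnP => _; last by rewrite mul0rn big1 // => l _; rewrite mul0r.
have -> : m.+1`!%:R^-1 * (X ^+ m.+1) i j *+ m.+1 = m`!%:R^-1 * (X ^+ m.+1) i j.
  rewrite -mulr_natl mulrA; congr (_ * _); rewrite factS natrM invfM mulrA mulfV ?mul1r //.
  by rewrite ((pcharf0P _).1 char0).
by rewrite exprSr -mulmxE mxE mulr_sumr; apply: eq_bigr => l _; rewrite mulrA.
Qed.

Lemma Xn_dvd_integrate (k : fieldType) (N : nat) (p : {poly k}) :
  [pchar k] =i pred0 -> p`_0 = 0 -> 'X^N %| p^`() -> 'X^(N.+1) %| p.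
Proof.
move=> char0 p0 /Xn_dvdP dp; apply/Xn_dvdP => -[|i] // lti.
have /eqP := dp i lti; rewrite coef_deriv -mulr_natr mulf_eq0 ((pcharf0P _).1 char0) orbF.
by move/eqP.
Qed.

Lemma mxexp0 (k : fieldType) (n N : nat) (X : 'M[k]_n.+1) :
  map_mx (horner_eval 0) (mxexp N.+1 X) = 1%:M.
Proof.
apply/matrixP => i j; rewrite !mxE /horner_eval horner_coef0 mxexp_entry /= fact0 invr1.
by rewrite mul1r expr0 mxE.
Qed.

Lemma mxexp_congr (k : fieldType) (n N M : nat) (X : 'M[k]_n.+1) i j :
  (N <= M)%N -> 'X^N %| mxexp M X i j - mxexp N X i j.
Proof.
move=> leNM; apply/Xn_dvdP => m ltm; rewrite coefB !mxexp_entry ltm.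
by rewrite (leq_trans ltm leNM) subrr.
Qed.

(* The Taylor coefficients of [p (exp (tX))] are iterated left-invariant derivatives
   of [p] at the identity. *)
Lemma vanish_mxexp (k : fieldType) (n : nat) (G : 'M[k]_n.+1 -> Prop) X p N :
  [pchar k] =i pred0 -> linear_algebraic_group G -> lie_algebra G X ->
  vanishes_on G p -> 'X^N %| mxmap (@polyC k) (mxexp N X) p.
Proof.
move=> char0 algG gX; elim: N p => [|N IHN] p Gp; first by rewrite expr0 dvd1p.
apply: Xn_dvd_integrate => //.
  have Gp1 := Gp _ (lag_one algG); rewrite -(mxexp0 N X) in Gp1.
  rewrite -horner_coef0 horner_mmap; apply: etrans Gp1.
  by apply: meval_eq => l; rewrite -map_mxvec mxE.
rewrite deriv_mmap big_mxvec.
have := IHN _ (lie_algebra_lder algG gX Gp); rewrite mmap_lder => IH.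
apply: dvdp_congr IH _; rewrite -sumrB; apply: dvdp_sum => i.
rewrite -sumrB; apply: dvdp_sum => j.
rewrite mxvecE deriv_mxexp // -mulrBl; apply: dvdp_mulr; apply: mmap_congr => l.
by case/mxvec_indexP: l => a b; rewrite !mxvecE mxexp_congr.
Qed.

Lemma coef_vexp (k : fieldType) (n N : nat) (x : 'I_n -> k) i m :
  (vexp N x i)`_m = if (m < N)%N then m`!%:R^-1 * x i ^+ m else 0.
Proof.
rewrite /vexp /expP horner_poly coef_sum.
under eq_bigr do rewrite -rmorphXn /= coefMC coefZ coefXn.
case: ltnP => [ltm | lem].
  rewrite (bigD1 (Ordinal ltm)) //= eqxx mulr1 big1 ?addr0 // => j nej.
  by rewrite -val_eqE /= eq_sym in nej; rewrite (negPf nej) mulr0 mul0r.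
rewrite big1 // => j _; rewrite (_ : (m == j) = false) ?mulr0 ?mul0r //.
by apply: gtn_eqF; apply: leq_trans lem.
Qed.

Lemma vexp_congr (k : fieldType) (n N M : nat) (x : 'I_n -> k) i :
  (N <= M)%N -> 'X^N %| vexp M x i - vexp N x i.
Proof.
move=> leNM; apply/Xn_dvdP => m ltm; rewrite coefB !coef_vexp ltm.
by rewrite (leq_trans ltm leNM) subrr.
Qed.

Lemma Xn_ndvdM (k : fieldType) (a b : nat) (f g : {poly k}) :
  ~~ ('X^a %| f) -> ~~ ('X^b %| g) -> ~~ ('X^(a + b) %| f * g).
Proof.
elim: a f => [|a IHa] f; first by rewrite expr0 dvd1p.
have [f0 | nf0] := eqVneq f`_0 0; last first.
  move=> _; apply: contra; rewrite Gauss_dvdpr.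
    by apply: dvdp_trans; rewrite dvdp_exp2l // leq_addl.
  by rewrite coprimep_expl // coprimep_sym -[X in coprimep _ X]subr0 -polyC0 coprimep_XsubC
    /root horner_coef0.
have [q ->] : exists q, f = q * 'X.
  have /factor_theorem [q ->] : root f 0 by rewrite /root horner_coef0 f0.
  by exists q; rewrite subr0.
rewrite addSn !exprSr mulrAC !dvdp_mul2r ?polyX_eq0 //; exact: IHa.
Qed.

(** Valuations add up. The successor accounts for the empty product, since ['X^0] divides 1. *)
Lemma Xn_ndvd_prod (k : fieldType) (I : finType) (a : I -> nat) (f : I -> {poly k}) :
  (forall i, ~~ ('X^(a i) %| f i)) -> ~~ ('X^((\sum_i a i).+1) %| \prod_i f i).
Proof.
move=> nf; rewrite -addn1 addnC.
elim: (index_enum I) => [|i s IHs].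
  rewrite !big_nil addn0 expr1; apply/negP => /(dvdp_leq (oner_neq0 _)).
  by rewrite size_polyX size_poly1.
by rewrite !big_cons addnCA; apply: Xn_ndvdM.
Qed.

Section SpectralPrimeExp.
Variables (k : closedFieldType) (n : nat) (G : 'M[k]_n.+1 -> Prop).
Variable Q : {mpoly k[n.+1]} -> Prop.
Hypotheses (char0 : [pchar k] =i pred0) (algG : linear_algebraic_group G).
Hypothesis spQ : spectral_prime G Q.

Lemma spectral_vanish_exp s X x N :
  s \is symmetric -> spectral_vanish G s -> lie_algebra G X -> eigenvalues X x ->
  'X^N %| mmap (@polyC k) (vexp N x) s.
Proof.
move=> sym_s vs gX Xx; have [p pE] := sym_mxpoly sym_s.
rewrite -(pE _ _ _ _ (eigenvalues_mxexp N Xx)).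
apply: (vanish_mxexp _ char0 algG gX) => A GA.
have [y Ay] := eigenvalues_exist A.
by rewrite mxevalE (pE _ _ _ _ Ay); apply: vs Ay.
Qed.

(** The analogue of [spectral_point] at [exp (tX)], with one ordering for all [q] and all [N]. If
    every ordering failed for some [q], the finite orders [a s] would bound the order of the product
    of conjugates of [q], which vanishes to every order. *)
Lemma spectral_formal_point X : lie_algebra G X ->
  exists2 x, eigenvalues X x &
    forall q, Q q -> forall N, 'X^N %| mmap (@polyC k) (vexp N x) q.
Proof.
move=> gX; have [x Xx] := eigenvalues_exist X.
pose K (s : 'S_n.+1) q := forall N, 'X^N %| mmap (@polyC k) (vexp N (x \o s)) q.
have [|q Qq|s sP] := @spectral_prime_ordering _ _ _ _ char0 spQ K.
- move=> s; split=> [|c p q Kp Kq] N; first by rewrite mmap0 dvdp0.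
  by rewrite mmapD mmapZ dvdp_add ?dvdp_mull.
- apply: NNPP => noK.
  have notK (s : 'S_n.+1) : {a | ~~ ('X^a %| mmap (@polyC k) (vexp a (x \o s)) q)}.
    apply: constructive_indefinite_description; apply: NNPP => no; apply: noK.
    by exists s => N; apply: contraT => nd; case: no; exists N.
  pose a s := sval (notK s); pose M := (\sum_(s : 'S_n.+1) a s).+1.
  have := @spectral_vanish_exp _ X x M (msym_prod_symmetric q)
    (sp_sym spQ (msym_prod_symmetric q) (spectral_prime_norm spQ Qq)) gX Xx.
  rewrite rmorph_prod; apply/negP; apply: Xn_ndvd_prod => s /=.
  have le_asM : (a s <= M)%N by rewrite /M (bigD1 s) //= -addnS leq_addr.
  apply: contra (svalP (notK s)); rewrite -/(a s) mmap_msym => dM.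
  apply: dvdp_congr dM _; apply: mmap_congr => i.
  by rewrite -opprB dvdpNr; apply: vexp_congr.
- by exists (x \o s) => //; apply: eigenvalues_perm.
Qed.

End SpectralPrimeExp.

(** * Multiplicative relations among eigenvalues *)

Lemma finite_span (F : fieldType) (n : nat) (P : 'rV[F]_n -> Prop) :
  exists m (V : 'M[F]_(m, n)), (forall i, P (row i V)) /\ forall u, P u -> (u <= V)%MS.
Proof.
apply: NNPP => no.
have big_rank r : exists m (V : 'M[F]_(m, n)), (forall i, P (row i V)) /\ (r <= \rank V)%N.
  elim: r => [|r [m [V [PV rV]]]]; first by exists 0%N, 0; split=> // -[].
  have [u Pu nuV] : exists2 u, P u & ~~ (u <= V)%MS.
    apply: NNPP => no_u; apply: no; exists m, V; split=> // u Pu.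
    by apply: contraT => nuV; case: no_u; exists u.
  exists (1 + m)%N, (col_mx u V); split=> [i|].
    by rewrite -[i]splitK; case: (split i) => j /=; rewrite ?rowKu ?rowKd ?row_id.
  apply: leq_ltn_trans rV _; rewrite ltnNge; apply: contra nuV => le_r.
  have sub : (V <= col_mx u V)%MS by rewrite -addsmxE addsmxSr.
  rewrite (geq_leqif (mxrank_leqif_sup sub)) in le_r.
  by apply: submx_trans le_r; rewrite -addsmxE addsmxSl.
have [m [V [_]]] := big_rank n.+1.
by rewrite ltnNge rank_leq_col.
Qed.

Lemma common_denominator (m : nat) (f : 'I_m -> rat) :
  exists2 N : nat, (0 < N)%N & exists z : 'I_m -> int, forall i, N%:R * f i = (z i)%:~R.
Proof.
exists (\prod_i `|denq (f i)|)%N.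
  by apply: prodn_gt0 => i; rewrite absz_gt0 denq_neq0.
exists (fun i => numq (f i) * (\prod_(j < m | j != i) `|denq (f j)|)%N%:Z) => i.
rewrite (bigD1 i) //= natrM rmorphM /= mulrC mulrA; congr (_ * _).
rewrite -{1}[f i]divq_num_den pmulrn absz_denq divfK // intr_eq0 denq_neq0.
by [].
Qed.

Definition mdot (R : pzSemiRingType) (n : nat) (a : 'X_{1..n}) (x : 'I_n -> R) : R :=
  \sum_i (a i)%:R * x i.

Lemma mdotU (R : pzSemiRingType) (n : nat) (l : 'I_n) (x : 'I_n -> R) : mdot U_(l) x = x l.
Proof.
rewrite /mdot (bigD1 l) //= mnmE eqxx mul1r big1 ?addr0 // => l' nel.
by rewrite mnmE eq_sym (negPf nel) mul0r.
Qed.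

Lemma eigenvalues1 (k : fieldType) (n : nat) (x : 'I_n -> k) :
  eigenvalues (1%:M : 'M[k]_n) x -> forall i, x i = 1.
Proof.
rewrite /eigenvalues char_poly_trig ?scalar_mx_is_trig // => E i.
have : root (\prod_(i < n) ('X - (x i)%:P)) (x i).
  by apply/eqP; rewrite horner_prod (bigD1 i) //= hornerXsubC subrr mul0r.
rewrite -E rootE horner_prod => /prodf_eq0 [j _].
by rewrite hornerXsubC mxE eqxx subr_eq0 => /eqP.
Qed.

Section Relations.
Variables (k : closedFieldType) (n : nat) (G : 'M[k]_n -> Prop).
Variable Q : {mpoly k[n]} -> Prop.
Hypotheses (char0 : [pchar k] =i pred0) (G1 : G 1%:M).
Hypothesis spQ : spectral_prime G Q.

(* [Q] contains [X^a - X^b] exactly when the character [a - b] is trivial on the torus. *)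
Definition mrel (a b : 'X_{1..n}) : Prop := Q ('X_[a] - 'X_[b]).

Let Q0 : Q 0. Proof. by case: (sp_ideal spQ). Qed.
Let QD x y : Q x -> Q y -> Q (x + y). Proof. by case: (sp_ideal spQ) => _ QD _; apply: QD. Qed.
Let QM a x : Q x -> Q (a * x). Proof. by case: (sp_ideal spQ) => _ _; apply. Qed.
Let QN x : Q x -> Q (- x). Proof. by rewrite -mulN1r; apply: QM. Qed.

Lemma spectral_prime_at1 q : Q q -> q.@[fun=> 1] = 0.
Proof.
have [x /eigenvalues1 x1 qx] := spectral_point char0 spQ G1.
by move=> /qx <-; apply: meval_eq => i; rewrite x1.
Qed.

Lemma mrel_refl a : mrel a a. Proof. by rewrite /mrel subrr. Qed.

Lemma mrel_sym a b : mrel a b -> mrel b a.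
Proof. by rewrite /mrel => ab; rewrite -opprB; apply: QN. Qed.

Lemma mrel_add a b c d : mrel a b -> mrel c d -> mrel (a + c)%MM (b + d)%MM.
Proof.
rewrite /mrel => ab cd; rewrite !mpolyXD.
have -> : 'X_[a] * 'X_[c] - 'X_[b] * 'X_[d] =
    'X_[c] * ('X_[a] - 'X_[b]) + 'X_[b] * ('X_[c] - 'X_[d]) :> {mpoly k[n]}.
  by rewrite !mulrBr [_ * 'X_[a]]mulrC [_ * 'X_[b]]mulrC addrA subrK.
by apply: QD; apply: QM.
Qed.

Lemma mrel_cancel a b c : mrel (a + c)%MM (b + c)%MM -> mrel a b.
Proof.
rewrite /mrel !mpolyXD -mulrBl => /(sp_prime spQ) [//|/spectral_prime_at1/eqP].
by rewrite mevalX big1 ?oner_eq0 // => i _; rewrite expr1n.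
Qed.

(** This is the connectedness of the torus: its character group has no torsion. The cofactor of
    [X^a - X^b] in [X^(Na) - X^(Nb)] takes the value [N] at the identity and so is not in [Q]. *)
Lemma mrel_torsion a b N : (0 < N)%N -> mrel (a *+ N)%MM (b *+ N)%MM -> mrel a b.
Proof.
case: N => // N _; rewrite /mrel -!mpolyXn subrXX => /(sp_prime spQ) [//|/spectral_prime_at1/eqP].
rewrite rmorph_sum /= (eq_bigr (fun=> 1)); last first.
  move=> i _; rewrite rmorphM !rmorphXn /= !mevalX !big1 ?expr1n ?mulr1 // => j _.
    by rewrite expr1n.
  by rewrite expr1n.
by rewrite sumr_const card_ord ((pcharf0P _).1 char0).
Qed.

Let vec (a b : 'X_{1..n}) : 'rV[rat]_n := \row_i ((a i)%:R - (b i)%:R).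

(** [w] is a one-parameter subgroup of the torus on which the characters [a] and [b] differ. If
    [a - b] is a rational combination of relations, clearing denominators and removing torsion makes
    it a relation; otherwise the cokernel of the span of relations supplies a linear form, a
    multiple of which is integral. *)
Lemma mrel_separation a b : ~ mrel a b ->
  exists w : 'I_n -> int, (forall c d, mrel c d -> mdot c w = mdot d w) /\ mdot a w != mdot b w.
Proof.
move=> nab.
have [m [V [PV spanV]]] := @finite_span rat n (fun u => exists c d, mrel c d /\ u = vec c d).
have [/submxP [C vC] | nsub] := boolP (vec a b <= V)%MS.
  have [N N0 [z zE]] := common_denominator (C 0).
  (* Exponents are natural numbers, so a negative coefficient [z i] is absorbed by exchanging the
     two sides of the relation. *)
  have rows i : exists cd, mrel cd.1 cd.2 /\
      forall j, (z i)%:~R * V i j = (`|z i|%N)%:R * ((cd.1 j)%:R - (cd.2 j)%:R).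
    have [c [d [cd /rowP Vi]]] := PV i.
    have [z0 | z0] := lerP 0 (z i).
      exists (c, d); split=> //= j; have := Vi j; rewrite !mxE => ->.
      by rewrite -[in LHS](gez0_abs z0) -pmulrn.
    exists (d, c); split=> [|j /=]; first exact: mrel_sym.
    have := Vi j; rewrite !mxE => ->.
    rewrite -[in LHS](opprK (z i)) -(ltz0_abs z0) rmorphN /= -pmulrn mulNr -mulrN opprB.
    by [].
  pose r i := sval (constructive_indefinite_description _ (rows i)).
  have rP i : mrel (r i).1 (r i).2 /\
      forall j, (z i)%:~R * V i j = (`|z i|%N)%:R * (((r i).1 j)%:R - ((r i).2 j)%:R).
    exact: (svalP (constructive_indefinite_description _ (rows i))).
  pose S (f : 'I_m -> 'X_{1..n}) := (\big[+%MM/0%MM]_i (f i *+ `|z i|))%MM.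
  have eqS : (a *+ N + S (fun i => (r i).2) = b *+ N + S (fun i => (r i).1))%MM.
    apply/mnmP => j; apply/eqP; rewrite !mnmDE !mnm_sumE !mulmnE -(eqr_nat rat) !natrD !natr_sum.
    have /rowP /(_ j) := vC; rewrite !mxE => /(congr1 (fun u => u * N%:R)).
    rewrite mulr_suml (eq_bigr (fun i => (z i)%:~R * V i j)) => [vCj|i _]; last first.
      by rewrite mulrAC [C _ _ * _]mulrC zE.
    rewrite (eq_bigr _ (fun i _ => (rP i).2 j)) in vCj.
    rewrite -subr_eq0 opprD addrACA !natrM -mulrBl vCj -sumrB -big_split /= big1 // => i _.
    rewrite !mulmnE !natrM; ring.
  have relS : mrel (S (fun i => (r i).1)) (S (fun i => (r i).2)).
    rewrite /S; elim/big_ind2: _ => [|x1 x2 y1 y2|i _]; first exact: mrel_refl.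
      exact: mrel_add.
    elim: `|z i|%N => [|l IHl]; first by rewrite !mulm0n; apply: mrel_refl.
    by rewrite !mulmS; apply: mrel_add => //; case: (rP i).
  case: nab; apply: (mrel_torsion N0); apply: (@mrel_cancel _ _ (S (fun i => (r i).2))).
  by rewrite eqS; apply: mrel_add => //; apply: mrel_refl.
have [j nzj] : exists j, (vec a b *m cokermx V) 0 j != 0.
  apply/existsP; rewrite -[[exists _, _]]negbK negb_exists; apply: contra nsub => /forallP z.
  by rewrite submxE; apply/eqP/rowP => j; have := z j; rewrite negbK mxE => /eqP; rewrite !mxE.
pose w i := cokermx V i j.
have [N N0 [z zE]] := common_denominator w.
have dotE c d : (mdot c z - mdot d z)%:~R = N%:R * (vec c d *m cokermx V) 0 j :> rat.
  rewrite /mdot -sumrB rmorph_sum mxE mulr_sumr; apply: eq_bigr => i _ /=.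
  by rewrite rmorphB !rmorphM /= !rmorph_nat -zE [vec c d _ _]mxE -/(w i); ring.
exists z; split=> [c d cd|].
  have /spanV : exists c' d', mrel c' d' /\ vec c d = vec c' d' by exists c, d.
  rewrite submxE => /eqP c0; apply/eqP; rewrite -subr_eq0 -(intr_eq0 rat) dotE c0 mxE mulr0.
  by [].
rewrite -subr_eq0 -(intr_eq0 rat) dotE mulf_neq0 // pnatr_eq0 -lt0n.
by [].
Qed.

(* The Lie algebra of the torus, as a space of spectra. *)
Definition mrel_dual (x : 'rV[k]_n) : Prop :=
  forall a b, mrel a b -> mdot a (x 0) = mdot b (x 0).

Lemma mdot_rV0 a : mdot a ((0 : 'rV[k]_n) 0) = 0.
Proof. by rewrite /mdot big1 // => i _; rewrite mxE mulr0. Qed.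

Lemma mdot_rVL a c (x y : 'rV[k]_n) :
  mdot a ((c *: x + y) 0) = c * mdot a (x 0) + mdot a (y 0).
Proof.
by rewrite /mdot mulr_sumr -big_split; apply: eq_bigr => i _; rewrite !mxE mulrDr mulrCA.
Qed.

Lemma mrel_dual_subspace : is_subspace mrel_dual.
Proof.
split=> [a b _|c x y dx dy a b ab]; first by rewrite !mdot_rV0.
by rewrite !mdot_rVL (dx _ _ ab) (dy _ _ ab).
Qed.

Lemma mrel_dual_separates (S : seq 'X_{1..n}) :
  exists2 x, mrel_dual x &
    forall a b, a \in S -> b \in S -> mdot a (x 0) = mdot b (x 0) -> mrel a b.
Proof.
apply: NNPP => no.
(* For a related pair the equality holds on the whole dual; the extra condition shrinks [K p] to
   zero, so that a covering by these subspaces still gives a contradiction. *)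
pose K (p : 'X_{1..n} * 'X_{1..n}) (x : 'rV[k]_n) :=
  (mrel p.1 p.2 -> x = 0) /\ mdot p.1 (x 0) = mdot p.2 (x 0).
have sep a b : ~ mrel a b -> exists2 x, mrel_dual x & mdot a (x 0) <> mdot b (x 0).
  move=> /mrel_separation [w [w1 w2]].
  have wE c : mdot c ((\row_i (w i)%:~R : 'rV[k]_n) 0) = (mdot c w)%:~R.
    by rewrite /mdot rmorph_sum; apply: eq_bigr => i _; rewrite mxE rmorphM /= rmorph_nat.
  exists (\row_i (w i)%:~R) => [c d cd|]; first by rewrite !wE (w1 _ _ cd).
  rewrite !wE => /eqP; rewrite -subr_eq0 -rmorphB /= => /eqP z.
  have : mdot a w - mdot b w != 0 by rewrite subr_eq0.
  case: (mdot a w - mdot b w) z => m; rewrite ?NegzE ?mulrNz => /eqP; rewrite ?oppr_eq0 -pmulrn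
    ((pcharf0P _).1 char0) => /eqP.
    by move=> ->.
  by [].
have bad x : mrel_dual x -> exists p : 'X_{1..n} * 'X_{1..n},
    [/\ p \in [seq (a, b) | a <- S, b <- S], ~ mrel p.1 p.2 & mdot p.1 (x 0) = mdot p.2 (x 0)].
  move=> dx; apply: NNPP => nop; apply: no; exists x => // a b aS bS ab.
  apply: NNPP => nab; apply: nop; exists (a, b); split=> //.
  by apply/allpairsP; exists (a, b).
have [| |x dx|i iP] := @subspace_avoidance k _ _ mrel_dual K [seq (a, b) | a <- S, b <- S] char0.
- exact: mrel_dual_subspace.
- move=> p; split=> [|c x y [x0 x1] [y0 y1]]; first by split=> //; rewrite !mdot_rV0.
  split=> [pp|]; first by rewrite x0 // y0 // scaler0 addr0.
  by rewrite !mdot_rVL x1 y1.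
- have [p [pS np eqp]] := bad x dx.
  have ltp : (index p [seq (a, b) | a <- S, b <- S] < size [seq (a, b) | a <- S, b <- S])%N.
    by rewrite index_mem.
  exists (Ordinal ltp); rewrite (tnth_nth p) /= nth_index //; split=> //.
set p := tnth _ i in iP.
have [rp | /sep [x /iP [_ eqx]]] := classic (mrel p.1 p.2); last by [].
have [q [_ /sep [x /iP [x0 _]]]] := bad 0 (proj1 mrel_dual_subspace).
by rewrite x0 // !mdot_rV0.
Qed.

End Relations.

(** * Characters along truncated exponentials *)

Lemma dvdp_congrM (k : fieldType) (d p q p' q' : {poly k}) :
  d %| p - p' -> d %| q - q' -> d %| p * q - p' * q'.
Proof.
move=> dp dq; have -> : p * q - p' * q' = (p - p') * q + p' * (q - q') by ring.
by apply: dvdp_add; [apply: dvdp_mulr | apply: dvdp_mull].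
Qed.

Lemma dvdp_congr_trans (k : fieldType) (d p q r : {poly k}) :
  d %| p - q -> d %| q - r -> d %| p - r.
Proof. by move=> pq qr; rewrite -(subrK q p) -addrA dvdp_add. Qed.

Section Exponential.
Variables (k : fieldType) (N : nat).
Hypothesis char0 : [pchar k] =i pred0.
Let e (c : k) : {poly k} := (expP k N).[c%:P].

Lemma coef_expP_eval c m : (e c)`_m = if (m < N)%N then m`!%:R^-1 * c ^+ m else 0.
Proof. exact: (@coef_vexp k 1 N (fun=> c) ord0). Qed.

Lemma expP_eval_add c d : 'X^N %| e c * e d - e (c + d).
Proof.
apply/Xn_dvdP => m ltm; apply/eqP; rewrite coefB subr_eq0 coefM coef_expP_eval ltm; apply/eqP.
rewrite addrC exprDn mulr_sumr; apply: eq_bigr => i _; rewrite !coef_expP_eval.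
have lei : (i <= m)%N by rewrite -ltnS.
rewrite (leq_ltn_trans lei ltm) (leq_ltn_trans (leq_subr i m) ltm).
rewrite -(bin_fact lei) !natrM -mulr_natr.
have f1 := fact_neq0 char0 i; have f2 := fact_neq0 char0 (m - i).
have f3 : ('C(m, i))%:R != 0 :> k by rewrite ((pcharf0P _).1 char0) -lt0n bin_gt0.
by field; rewrite f1 f2 f3.
Qed.

Lemma expP_eval0 : 'X^N %| 1 - e 0.
Proof.
apply/Xn_dvdP => m ltm; rewrite coefB coef_expP_eval ltm coef1 expr0n.
by case: m ltm => [|m] _; rewrite ?mulr0 ?subrr // fact0 invr1 mulr1 subrr.
Qed.

Lemma expP_eval_exp c m : 'X^N %| e c ^+ m - e (m%:R * c).
Proof.
elim: m => [|m IHm]; first by rewrite mul0r expr0 expP_eval0.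
rewrite exprS; apply: dvdp_congr_trans (_ : _ %| e c * e (m%:R * c) - _).
  by apply: dvdp_congrM; rewrite ?subrr ?dvdp0.
by rewrite -natr1 mulrDl mul1r [_ * c + c]addrC; apply: expP_eval_add.
Qed.

Lemma mmap_vexp_monomial n (x : 'I_n -> k) a :
  'X^N %| mmap (@polyC k) (vexp N x) 'X_[a] - e (mdot a x).
Proof.
rewrite mmapX /mmap1 /mdot; elim: (index_enum _) => [|i s IHs].
  by rewrite !big_nil expP_eval0.
rewrite !big_cons; apply: dvdp_congr_trans (expP_eval_add _ _).
by apply: dvdp_congrM => //; apply: expP_eval_exp.
Qed.

Lemma coef_mmap_vexp n (x : 'I_n -> k) s m : (m < N)%N ->
  (mmap (@polyC k) (vexp N x) s)`_m = m`!%:R^-1 * \sum_(a <- msupp s) s@_a * mdot a x ^+ m.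
Proof.
move=> ltm; rewrite {1}[s]mpolyE rmorph_sum coef_sum mulr_sumr; apply: eq_bigr => a _.
rewrite /= mmapZ coefCM mulrCA; congr (_ * _).
have /Xn_dvdP /(_ m ltm) := mmap_vexp_monomial x a.
by rewrite coefB => /eqP; rewrite subr_eq0 => /eqP ->; rewrite coef_expP_eval ltm.
Qed.

End Exponential.

(** A Vandermonde argument: the moments are paired with a polynomial that vanishes at all values of
    [c] other than [b]. *)
Lemma power_sums_vanish (k : fieldType) (T : eqType) (S : seq T) (c : T -> k) (f : T -> k) :
  (forall m, \sum_(a <- S) f a * c a ^+ m = 0) ->
  forall b, \sum_(a <- S | c a == b) f a = 0.
Proof.
move=> z b.
have zp (p : {poly k}) : \sum_(a <- S) f a * p.[c a] = 0.
  under eq_bigr do rewrite horner_coef mulr_sumr.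
  rewrite exchange_big big1 // => i _; under eq_bigr do rewrite mulrCA.
  by rewrite -mulr_sumr z mulr0.
pose p : {poly k} := \prod_(d <- [seq d <- undup (map c S) | d != b]) ('X - d%:P).
have pb : p.[b] != 0.
  rewrite horner_prod prodf_seq_neq0; apply/allP => d; rewrite mem_filter => /andP [nd _] /=.
  by rewrite hornerXsubC subr_eq0 eq_sym.
apply: (mulIf pb); rewrite mul0r -[RHS](zp p) mulr_suml big_mkcond /=.
rewrite !big_seq; apply: eq_bigr => a aS; case: eqP => [<- //| /eqP nab].
apply/esym/eqP; rewrite mulf_eq0 horner_prod; apply/orP; right.
rewrite prodf_seq_eq0; apply/hasP; exists (c a); last by rewrite /= hornerXsubC subrr.
by rewrite mem_filter nab mem_undup map_f.
Qed.

(** If all coefficients vanish, so do all moments, hence the sum of the coefficients of [s] over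
    each set of monomials with the same value of [mdot]. By separation these monomials are congruent
    modulo [Q], whence [s] is in [Q]. *)
Lemma spectral_exp_nonzero (k : closedFieldType) (n : nat) (G : 'M[k]_n -> Prop) Q s
    (x : 'rV[k]_n) :
  [pchar k] =i pred0 -> spectral_prime G Q -> ~ Q s ->
  (forall a b, a \in msupp s -> b \in msupp s -> mdot a (x 0) = mdot b (x 0) -> mrel Q a b) ->
  exists N, ~~ ('X^N %| mmap (@polyC k) (vexp N (x 0)) s).
Proof.
move=> char0 spQ nQs sep; apply: NNPP => no; apply: nQs.
have [Q0 QD QM] := sp_ideal spQ.
have z m : \sum_(a <- msupp s) s@_a * mdot a (x 0) ^+ m = 0.
  have : 'X^(m.+1) %| mmap (@polyC k) (vexp m.+1 (x 0)) s.
    by apply: contraT => nd; case: no; exists m.+1.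
  move=> /Xn_dvdP /(_ m (ltnSn m)) /eqP; rewrite coef_mmap_vexp // mulf_eq0 invr_eq0.
  by rewrite (negPf (fact_neq0 char0 m)) => /eqP.
pose c a := mdot a (x 0).
have -> : s = \sum_(d <- undup (map c (msupp s)))
    \sum_(a <- msupp s | c a == d) s@_a *: 'X_[a].
  under [RHS]eq_bigr do rewrite big_mkcond.
  rewrite exchange_big {1}[s]mpolyE; apply: eq_big_seq => a aS /=.
  rewrite (bigD1_seq (c a)) ?undup_uniq ?mem_undup ?map_f //= eqxx.
  by rewrite big1 ?addr0 // => d nd; rewrite eq_sym (negPf nd).
rewrite big_seq; apply: (big_ind Q) => // d; rewrite mem_undup => /mapP [b bS ->].
have -> : \sum_(a <- msupp s | c a == c b) s@_a *: 'X_[a] =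
    \sum_(a <- msupp s | c a == c b) (s@_a)%:MP * ('X_[a] - 'X_[b]).
  under [RHS]eq_bigr do rewrite mulrBr !mul_mpolyC.
  by rewrite sumrB -scaler_suml (power_sums_vanish z) scale0r subr0.
rewrite big_seq_cond; apply: (big_ind Q) => // a /andP [aS /eqP cab].
by apply: QM; apply: sep.
Qed.

(** * The stabilizer of the prime *)

Definition propb (P : Prop) : bool := if excluded_middle_informative P then true else false.

Lemma propbP (P : Prop) : reflect P (propb P).
Proof. by rewrite /propb; case: excluded_middle_informative => ?; constructor. Qed.

Section IdealCongruence.
Variables (R : comNzRingType) (J : R -> Prop).
Hypothesis idJ : is_ideal J.

Lemma is_ideal0 : J 0. Proof. by case: idJ. Qed.
Lemma is_idealD x y : J x -> J y -> J (x + y). Proof. by case: idJ => _ JD _; apply: JD. Qed.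
Lemma is_idealMl a x : J x -> J (a * x). Proof. by case: idJ => _ _; apply. Qed.
Lemma is_idealMr a x : J x -> J (x * a). Proof. by rewrite mulrC; apply: is_idealMl. Qed.
Lemma is_idealN x : J x -> J (- x). Proof. by rewrite -mulN1r; apply: is_idealMl. Qed.
Lemma is_idealB x y : J x -> J y -> J (x - y).
Proof. by move=> Jx Jy; apply: is_idealD => //; apply: is_idealN. Qed.
Lemma is_ideal_sum (I : Type) (r : seq I) (P : pred I) F :
  (forall i, P i -> J (F i)) -> J (\sum_(i <- r | P i) F i).
Proof. by move=> JF; apply: (big_ind J); [apply: is_ideal0 | apply: is_idealD | apply: JF]. Qed.
Lemma congrJ_mul a b c d : J (a - b) -> J (c - d) -> J (a * c - b * d).
Proof.
move=> ab cd; have -> : a * c - b * d = (a - b) * c + b * (c - d) by ring.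
by apply: is_idealD; [apply: is_idealMr | apply: is_idealMl].
Qed.
Lemma congrJ_exp a b m : J (a - b) -> J (a ^+ m - b ^+ m).
Proof. by move=> ab; rewrite subrXX; apply: is_idealMr. Qed.
Lemma congrJ_trans a b c : J (a - b) -> J (b - c) -> J (a - c).
Proof. by move=> ab bc; rewrite -(subrK b a) -addrA; apply: is_idealD. Qed.
End IdealCongruence.

Section Stabilizer.
Variables (k : closedFieldType) (n : nat) (G : 'M[k]_n -> Prop).
Variable Q : {mpoly k[n]} -> Prop.
Hypotheses (char0 : [pchar k] =i pred0) (G1 : G 1%:M).
Hypothesis spQ : spectral_prime G Q.
Let idQ := sp_ideal spQ.

Definition stab (s : 'S_n) : bool := propb (forall u, Q u -> Q (msym s u)).

(** An inclusion between conjugates of [Q] is an equality: if [u] is not in [Q] but its image is,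
    applying [s] to [t = q + r * u] puts in [Q] a symmetric function that does not vanish on [G]. *)
Lemma stab_iff s u : stab s -> Q (msym s u) <-> Q u.
Proof.
move=> /propbP ss; split=> [Qsu|]; last exact: ss.
apply: NNPP => nQu; have [t [q [r [sym_t nvt Qq tE]]]] := sp_sep spQ nQu.
apply: nvt; apply: (sp_sym spQ sym_t).
have /issymP /(_ s) <- := sym_t; rewrite tE rmorphD rmorphM /=.
by apply: (is_idealD idQ); [apply: ss | apply: (is_idealMl idQ)].
Qed.

Lemma stab1 : stab 1%g.
Proof. by apply/propbP => u; rewrite msym1m. Qed.

Lemma stabM s t : stab s -> stab t -> stab (s * t)%g.
Proof.
move=> ss st; apply/propbP => u Qu; rewrite msymMm.
by apply/(stab_iff _ st)/(stab_iff _ ss).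
Qed.

Lemma stabV s : stab s -> stab s^-1%g.
Proof.
by move=> ss; apply/propbP => u Qu; apply/(stab_iff _ ss); rewrite -msymMm mulVg msym1m.
Qed.

Lemma stab_sum (V : nmodType) (F : 'S_n -> V) s : stab s ->
  \sum_(t | stab t) F (s * t)%g = \sum_(t | stab t) F t.
Proof.
move=> ss; rewrite [RHS](reindex_inj (mulgI s)); apply: eq_bigl => t.
apply/idP/idP => [st | sts]; first exact: stabM.
by rewrite -[t](mulKg s); apply: stabM => //; apply: stabV.
Qed.

Lemma spectral_prime_proper : ~ Q 1.
Proof.
move=> /(spectral_prime_at1 char0 G1 spQ) /eqP; rewrite rmorph1.
by rewrite oner_eq0.
Qed.

Lemma spectral_prime_prod (I : finType) (P : pred I) (F : I -> {mpoly k[n]}) :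
  (forall i, P i -> ~ Q (F i)) -> ~ Q (\prod_(i | P i) F i).
Proof.
move=> nF; apply: (big_ind (fun x => ~ Q x)) => //; first exact: spectral_prime_proper.
by move=> x y nx ny /(sp_prime spQ) [].
Qed.

Lemma spectral_prime_exp u m : ~ Q u -> ~ Q (u ^+ m).
Proof.
move=> nu; elim: m => [|m IHm]; first by rewrite expr0; apply: spectral_prime_proper.
by rewrite exprS => /(sp_prime spQ) [].
Qed.

(* For two distinct conjugates of [Q], neither contains the other. *)
Lemma stab_isolator : exists v,
  [/\ ~ Q v, forall s, stab s -> msym s v = v & forall s, ~~ stab s -> Q (msym s v)].
Proof.
have sepP s : {u | ~ Q u /\ (~~ stab s -> Q (msym s u))}.
  apply: constructive_indefinite_description.
  have [ss|ns] := boolP (stab s); first by exists 1; split=> //; apply: spectral_prime_proper.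
  apply: NNPP => no; case/negP: ns; rewrite -[s]invgK; apply: stabV; apply/propbP => u Qu.
  apply: NNPP => nQ; apply: no; exists (msym s^-1%g u); split=> // _.
  by rewrite -msymMm mulVg msym1m.
pose w := \prod_s sval (sepP s).
have nw : ~ Q w by apply: spectral_prime_prod => s _; case: (svalP (sepP s)).
have Qw s : ~~ stab s -> Q (msym s w).
  move=> ns; rewrite rmorph_prod (bigD1 s) //=; apply: (is_idealMr idQ).
  by case: (svalP (sepP s)) => _; apply.
exists (\prod_(s | stab s) msym s w); split=> [|s ss|s ns].
- by apply: spectral_prime_prod => s ss /(stab_iff _ ss).
- rewrite rmorph_prod /= [RHS](reindex_inj (mulIg s)).
  rewrite [RHS](eq_bigl stab) => [|t]; last first.
    apply/idP/idP => [sts|st]; last exact: stabM.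
    by rewrite -[t](mulgK s); apply: stabM => //; apply: stabV.
  by apply: eq_bigr => t _; rewrite msymMm.
- rewrite rmorph_prod (bigD1 1%g) ?stab1 //= msym1m; apply: (is_idealMr idQ).
  exact: Qw.
Qed.

(** Through the factor [v], permutations outside the stabilizer contribute only elements of [Q]. A
    polynomial invariant under [stab] thus becomes symmetric, at the cost of a factor that can be
    chosen outside [Q]. *)
Lemma stab_symmetrize v u :
  (forall s, stab s -> msym s v = v) -> (forall s, ~~ stab s -> Q (msym s v)) ->
  (forall s, stab s -> msym s u = u) ->
  Q (\sum_s msym s (v * u) - #|[pred s | stab s]|%:R * (v * u)).
Proof.
move=> sv nv su; rewrite (bigID stab) /= addrAC; apply: (is_idealD idQ).
  rewrite (eq_bigr (fun=> v * u)) => [|s ss]; last by rewrite msymM sv ?su.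
  by rewrite sumr_const mulr_natl subrr; apply: (is_ideal0 idQ).
apply: (is_ideal_sum idQ) => s ns; rewrite msymM; apply: (is_idealMr idQ).
exact: nv.
Qed.

Lemma msymXU (R : nzRingType) s i : msym s ('X_i : {mpoly R[n]}) = 'X_(s i).
Proof.
rewrite msymX; congr 'X_[_]; apply/mnmP => j; rewrite !mnmE.
by rewrite -(inj_eq (@perm_inj _ s)) permKV.
Qed.

Lemma mrel_perm s a b : stab s -> mrel Q a b ->
  mrel Q [multinom a (s^-1%g i) | i < n] [multinom b (s^-1%g i) | i < n].
Proof. by rewrite /mrel => /propbP ss /ss; rewrite msymB !msymX. Qed.

(** With the relations spanned by the rows of [V], the matrix [M0] maps columns into the kernel of
    [V] and fixes that kernel. Averaging over the stabilizer, which permutes the relations, keeps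
    both properties and adds the invariance. *)
Lemma dual_projector : exists M : 'M[k]_n,
  [/\ forall a b, mrel Q a b -> forall j, mdot a (M^~ j) = mdot b (M^~ j),
      forall x, mrel_dual Q x -> forall i, \sum_j M i j * x 0 j = x 0 i &
      forall s i j, stab s -> M (s i) (s j) = M i j].
Proof.
pose vec (a b : 'X_{1..n}) : 'rV[k]_n := \row_i ((a i)%:R - (b i)%:R).
have [m [V [PV spanV]]] := @finite_span k n (fun u => exists a b, mrel Q a b /\ u = vec a b).
pose M0 := 1%:M - pinvmx V *m V.
have VM0 : V *m M0 = 0 by rewrite mulmxBr mulmx1 mulmxA mulmxKpV ?subrr.
have dotM a b (N : 'M[k]_n) j : (vec a b *m N) 0 j = mdot a (N^~ j) - mdot b (N^~ j).
  by rewrite mxE -sumrB; apply: eq_bigr => i _; rewrite mxE mulrBl.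
have M0a a b j : mrel Q a b -> mdot a (M0^~ j) = mdot b (M0^~ j).
  move=> ab; apply/eqP; rewrite -subr_eq0 -dotM.
  have /submxP [C ->] : (vec a b <= V)%MS by apply: spanV; exists a, b.
  by rewrite -mulmxA VM0 mulmx0 mxE.
have M0x x i : mrel_dual Q x -> \sum_j M0 i j * x 0 j = x 0 i.
  move=> dx; have Vx : V *m x^T = 0.
    apply/matrixP => a j; rewrite !mxE; have [c [d [cd /rowP Va]]] := PV a.
    have := dx _ _ cd; rewrite /mdot => /eqP; rewrite -subr_eq0 -sumrB => /eqP xcd.
    apply: etrans xcd; apply: eq_bigr => l _; have := Va l; rewrite !mxE ord1 => ->; ring.
  have : M0 *m x^T = x^T by rewrite mulmxBl mul1mx -mulmxA Vx mulmx0 subr0.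
  move/matrixP/(_ i 0); rewrite [RHS]mxE => <-; rewrite mxE.
  by apply: eq_bigr => j _; rewrite [x^T _ _]mxE.
pose c : k := #|[pred s | stab s]|%:R.
have nzc : c != 0.
  by rewrite ((pcharf0P _).1 char0) -lt0n; apply/card_gt0P; exists 1%g; rewrite inE stab1.
exists (\matrix_(i, j) (c^-1 * \sum_(s | stab s) M0 (s i) (s j))); split.
- move=> a b ab j.
  have E d : mdot d ((\matrix_(i, l) (c^-1 * \sum_(s | stab s) M0 (s i) (s l)))^~ j) =
      c^-1 * \sum_(s | stab s) mdot [multinom d (s^-1%g i) | i < n] (M0^~ (s j)).
    have E1 (s : 'S_n) : mdot [multinom d (s^-1%g i) | i < n] (M0^~ (s j)) =
        \sum_i (d i)%:R * M0 (s i) (s j).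
      rewrite /mdot (reindex_perm s); apply: eq_bigr => i _ /=.
      by rewrite mnmE permK.
    rewrite (eq_bigr _ (fun s _ => E1 s)) exchange_big mulr_sumr; apply: eq_bigr => i _.
    by rewrite mxE mulrCA mulr_sumr.
  rewrite !E; congr (_ * _); apply: eq_bigr => s ss; apply: M0a.
  exact: mrel_perm.
- move=> x dx i; under eq_bigr do rewrite mxE -mulrA mulr_suml.
  rewrite -mulr_sumr exchange_big /=.
  rewrite (eq_bigr (fun=> x 0 i)) => [|s ss]; last first.
    pose y := \row_j x 0 (s^-1%g j).
    have dy : mrel_dual Q y.
      move=> a b ab; have dotE d : mdot d (y 0) = mdot [multinom d (s i) | i < n] (x 0).
        rewrite /mdot (reindex_perm s); apply: eq_bigr => l _ /=.
        by rewrite mxE permK mnmE.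
      rewrite !dotE; have := dx _ _ (mrel_perm (stabV ss) ab).
      by rewrite invgK.
    have := M0x y (s i) dy; rewrite [RHS]mxE permK => <-.
    by rewrite [RHS](reindex_perm s); apply: eq_bigr => l _; rewrite /= [y _ _]mxE permK.
  by rewrite sumr_const -mulr_natl mulrA mulVf ?mul1r.
- move=> s i j ss; rewrite !mxE; congr (_ * _).
  rewrite -[RHS](stab_sum (fun t => M0 (t i) (t j)) ss).
  by apply: eq_bigr => t _; rewrite !permM.
Qed.

End Stabilizer.

(** * Interpolation of the logarithm *)

Section LocalLog.
Variables (k : fieldType) (n : nat).
Local Notation R := {mpoly k[n]}.

Definition spec_det : R := \prod_j 'X_j.
Definition spec_codet (i : 'I_n) : R := \prod_(j | j != i) 'X_j.
Definition spec_weight (M : 'M[k]_n) (i : 'I_n) : R := \sum_j (M i j)%:MP * ('X_j - 1).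

(* [spec_det ^ n * log (x / X_i)] modulo [(x - X_i) ^ (n + 1)], denominators being cleared
   through [x / X_i - 1 = spec_codet i * (x - X_i) / spec_det]. *)
Definition spec_log (i : 'I_n) : {poly R} :=
  \sum_(l < n) (((- 1) ^+ l / l.+1%:R)%:MP * spec_det ^+ (n - l.+1) * spec_codet i ^+ l.+1)
    *: ('X - ('X_i)%:P) ^+ l.+1.

Definition spec_target (M : 'M[k]_n) (i : 'I_n) : {poly R} :=
  (spec_det ^+ n * spec_weight M i)%:P + spec_log i.

Lemma spec_detE i : spec_det = 'X_i * spec_codet i.
Proof. by rewrite /spec_det (bigD1 i). Qed.

Local Notation pmsym s := (map_poly (msym s)).

Lemma msymC s c : msym s c%:MP = c%:MP :> R.
Proof. by rewrite /msym mmapC. Qed.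

Lemma msym_spec_det s : msym s spec_det = spec_det.
Proof.
rewrite rmorph_prod /= [RHS](reindex_perm s); apply: eq_bigr => j _.
by rewrite msymXU.
Qed.

Lemma msym_spec_codet s i : msym s (spec_codet i) = spec_codet (s i).
Proof.
rewrite rmorph_prod /= [RHS](reindex_perm s) /=; apply: eq_big => [j|j _].
  by rewrite (inj_eq perm_inj).
by rewrite msymXU.
Qed.

Lemma msym_spec_log s i : pmsym s (spec_log i) = spec_log (s i).
Proof.
rewrite rmorph_sum; apply: eq_bigr => l _ /=.
rewrite map_polyZ /= !msymM msymC !rmorphXn /= msym_spec_det msym_spec_codet rmorphB /=.
by rewrite map_polyX map_polyC /= msymXU.
Qed.

Lemma msym_spec_target (s : 'S_n) (M : 'M[k]_n) i : (forall j, M (s i) (s j) = M i j) ->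
  pmsym s (spec_target M i) = spec_target M (s i).
Proof.
move=> Ms; rewrite rmorphD /= msym_spec_log map_polyC /= rmorphM rmorphXn /= msym_spec_det.
congr ((_ * _)%:P + _); rewrite rmorph_sum [RHS](reindex_perm s); apply: eq_bigr => j _ /=.
by rewrite Ms msymM msymB msym1 msymC msymXU.
Qed.

End LocalLog.

Section Interpolation.
Variables (k : closedFieldType) (n : nat) (G : 'M[k]_n -> Prop).
Variable Q : {mpoly k[n]} -> Prop.
Hypotheses (char0 : [pchar k] =i pred0) (G1 : G 1%:M).
Hypothesis spQ : spectral_prime G Q.
Let idQ := sp_ideal spQ.
Local Notation R := {mpoly k[n]}.

Definition sim (i j : 'I_n) : bool := propb (Q ('X_i - 'X_j)).

Lemma simP i j : reflect (Q ('X_i - 'X_j)) (sim i j).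
Proof. exact: propbP. Qed.

Lemma sim_refl i : sim i i.
Proof. by apply/simP; rewrite subrr; apply: (is_ideal0 idQ). Qed.

Lemma sim_sym i j : sim i j = sim j i.
Proof. by apply/simP/simP => ij; rewrite -opprB; apply: (is_idealN idQ). Qed.

Lemma sim_trans i j l : sim i j -> sim j l -> sim i l.
Proof. by move=> /simP ij /simP jl; apply/simP/(congrJ_trans idQ ij jl). Qed.

Lemma sim_stab s i j : stab Q s -> sim (s i) (s j) = sim i j.
Proof.
move=> ss; rewrite /sim -!msymXU -msymB.
by apply/propbP/propbP => /(stab_iff spQ _ ss).
Qed.

(** Membership in the ideal generated by [Q] and [('X - X_i) ^ n]. At a zero [x] of [Q] it becomes
    the Hermite condition of order [n] at the eigenvalue [x i]. *)
Definition near (i : 'I_n) (p : {poly R}) : Prop :=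
  exists r, forall m, Q (p - ('X - ('X_i)%:P) ^+ n * r)`_m.

Lemma near_ideal i : is_ideal (near i).
Proof.
split=> [|p q [r rP] [t tP]|a p [r rP]].
- by exists 0 => m; rewrite mulr0 subr0 coef0; apply: (is_ideal0 idQ).
- exists (r + t) => m; rewrite mulrDr opprD addrACA coefD.
  exact: (is_idealD idQ).
- exists (a * r) => m; rewrite mulrCA -mulrBr coefM; apply: (is_ideal_sum idQ) => j _.
  exact: (is_idealMl idQ).
Qed.

Lemma nearC i c : Q c -> near i c%:P.
Proof.
by move=> Qc; exists 0 => m; rewrite mulr0 subr0 coefC; case: eqP => // _; apply: (is_ideal0 idQ).
Qed.

Lemma near_self i : near i (('X - ('X_i)%:P) ^+ n).
Proof. by exists 1 => m; rewrite mulr1 subrr coef0; apply: (is_ideal0 idQ). Qed.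

Lemma near_sub i j : sim j i -> near i (('X - ('X_j)%:P) - ('X - ('X_i)%:P)).
Proof.
move=> /simP ji.
have -> : ('X - ('X_j)%:P) - ('X - ('X_i)%:P) = - ('X_j - 'X_i)%:P :> {poly R}.
  by rewrite polyCB; ring.
by apply: (is_idealN (near_ideal i)); apply: nearC.
Qed.

Definition far_det (i : 'I_n) : R := \prod_(j | ~~ sim i j) ('X_i - 'X_j) ^+ n.
Definition far_poly (i : 'I_n) : {poly R} := \prod_(j | ~~ sim i j) ('X - ('X_j)%:P) ^+ n.
(* [P = far_poly i] takes the value [d = far_det i] at [X_i], so [(d - P) ^ n] vanishes to
   order [n] at [X_i], while [d ^ n - (d - P) ^ n] is a multiple of [P]. *)
Definition hat_idem (i : 'I_n) : {poly R} :=
  (far_det i ^+ n)%:P - ((far_det i)%:P - far_poly i) ^+ n.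
Definition all_det : R := \prod_i far_det i ^+ n.
Definition rest_det (i : 'I_n) : R := \prod_(j | j != i) far_det j ^+ n.
Definition sim_card (i : 'I_n) : nat := #|[pred j | sim i j]|.

(** The factors [rest_det i] give all terms the common scale [all_det]. Modulo the ideal at [i],
    exactly the indices similar to [i] contribute, all equally; hence the division by [sim_card]. *)
Definition local_interp (M : 'M[k]_n) : {poly R} :=
  \sum_i ((sim_card i)%:R^-1%:MP * rest_det i) *: (hat_idem i * spec_target M i).

Lemma all_detE i : all_det = far_det i ^+ n * rest_det i.
Proof. by rewrite /all_det (bigD1 i). Qed.

Lemma all_det_notin : ~ Q all_det.
Proof.
apply: (spectral_prime_prod char0 G1 spQ) => i _; apply: (spectral_prime_exp char0 G1 spQ).
apply: (spectral_prime_prod char0 G1 spQ) => j /simP nij.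
exact: (spectral_prime_exp char0 G1 spQ).
Qed.

Lemma hat_idem_far i j : ~~ sim j i -> near i (hat_idem j).
Proof.
move=> nji; rewrite /hat_idem rmorphXn subrXX. apply: (is_idealMr (near_ideal i)).
rewrite opprB addrC subrK /far_poly (bigD1 i) //=.
by apply: (is_idealMr (near_ideal i)); apply: near_self.
Qed.

Lemma hat_idem_near i j : sim j i -> near i (hat_idem j - (far_det j ^+ n)%:P).
Proof.
move=> ji; rewrite /hat_idem addrAC subrr add0r; apply: (is_idealN (near_ideal i)).
have [r ->] : exists r, (far_det j)%:P - far_poly j = r * ('X - ('X_j)%:P).
  apply/factor_theorem; rewrite /root hornerD hornerN hornerC /far_poly horner_prod subr_eq0.
  by apply/eqP/eq_bigr => l _; rewrite horner_exp hornerXsubC.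
rewrite exprMn; apply: (is_idealMl (near_ideal i)).
rewrite -[X in near i X](subrK (('X - ('X_i)%:P) ^+ n)).
apply: (is_idealD (near_ideal i)); last exact: near_self.
by apply: (congrJ_exp (near_ideal i)); apply: near_sub.
Qed.

Lemma mpolyX_notin i : ~ Q 'X_i.
Proof.
move=> /(spectral_prime_at1 char0 G1 spQ) /eqP; rewrite mevalXU.
by rewrite oner_eq0.
Qed.

Lemma spec_codet_near i j : sim j i -> Q (spec_codet k j - spec_codet k i).
Proof.
move=> /simP ji; have : Q ('X_j * (spec_codet k j - spec_codet k i)).
  rewrite mulrBr -spec_detE (spec_detE k i) -mulrBl; apply: (is_idealMr idQ).
  by rewrite -opprB; apply: (is_idealN idQ).
by case/(sp_prime spQ) => // /mpolyX_notin.
Qed.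

Lemma spec_target_near (M : 'M[k]_n) i j :
  (forall a b, mrel Q a b -> forall l, mdot a (M^~ l) = mdot b (M^~ l)) ->
  sim j i -> near i (spec_target M j - spec_target M i).
Proof.
move=> relM ji.
have Mji l : M j l = M i l.
  by rewrite -(mdotU j (M^~ l)) -(mdotU i (M^~ l)); apply: relM; apply/simP.
have -> : spec_target M j - spec_target M i = spec_log k j - spec_log k i.
  rewrite /spec_target /spec_weight; under eq_bigr do rewrite Mji.
  by rewrite opprD addrACA subrr add0r.
rewrite /spec_log -sumrB; apply: (is_ideal_sum (near_ideal i)) => l _.
rewrite -!mul_polyC; apply: (congrJ_mul (near_ideal i)); last first.
  by apply: (congrJ_exp (near_ideal i)); apply: near_sub.
rewrite -polyCB; apply: nearC; rewrite -mulrBr; apply: (is_idealMl idQ).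
by apply: (congrJ_exp idQ); apply: spec_codet_near.
Qed.

Lemma sim_card_eq i j : sim i j -> sim_card i = sim_card j.
Proof.
move=> ij; apply: eq_card => l; rewrite !inE; apply/idP/idP; last exact: sim_trans.
by apply: sim_trans; rewrite sim_sym.
Qed.

Lemma local_interp_near (M : 'M[k]_n) i :
  (forall a b, mrel Q a b -> forall l, mdot a (M^~ l) = mdot b (M^~ l)) ->
  near i (local_interp M - all_det *: spec_target M i).
Proof.
move=> relM; have idN := near_ideal i.
have termP j : near i (((sim_card j)%:R^-1%:MP * rest_det j) *: (hat_idem j * spec_target M j)
    - (if sim j i then ((sim_card i)%:R^-1%:MP * all_det) *: spec_target M i else 0)).
  rewrite -!mul_polyC; case: ifP => [ji|/negbT nji]; last first.
    rewrite subr0; apply: (is_idealMl idN); apply: (is_idealMr idN); exact: hat_idem_far.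
  rewrite (sim_card_eq ji); set e := (_%:R^-1)%:MP.
  have -> : (e * all_det)%:P * spec_target M i =
      (e * rest_det j)%:P * ((far_det j ^+ n)%:P * spec_target M i).
    by rewrite (all_detE j) [RHS]mulrA -[in RHS]polyCM; congr (_%:P * _); ring.
  rewrite -mulrBr; apply: (is_idealMl idN); apply: (congrJ_mul idN); first exact: hat_idem_near.
  exact: spec_target_near.
have -> : all_det *: spec_target M i =
    \sum_j (if sim j i then ((sim_card i)%:R^-1%:MP * all_det) *: spec_target M i else 0).
  rewrite -big_mkcond sumr_const /= -scaler_nat scalerA mulrA; congr (_ *: _).
  rewrite -mpolyC_nat -mpolyCM (eq_card (B := [pred j | sim i j])); last first.
    by move=> j; rewrite !inE sim_sym.
  rewrite mulfV ?mpolyC1 ?mul1r // ((pcharf0P _).1 char0) -lt0n.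
  by apply/card_gt0P; exists i; rewrite inE sim_refl.
by rewrite /local_interp -sumrB; apply: (is_ideal_sum idN).
Qed.

Local Notation pmsym s := (map_poly (msym s)).

Lemma msym_far_det s i : stab Q s -> msym s (far_det i) = far_det (s i).
Proof.
move=> ss; rewrite rmorph_prod /= [RHS](reindex_perm s) /=; apply: eq_big => [j|j _].
  by rewrite sim_stab.
by rewrite rmorphXn /= msymB !msymXU.
Qed.

Lemma msym_far_poly s i : stab Q s -> pmsym s (far_poly i) = far_poly (s i).
Proof.
move=> ss; rewrite rmorph_prod /= [RHS](reindex_perm s) /=; apply: eq_big => [j|j _].
  by rewrite sim_stab.
by rewrite rmorphXn /= rmorphB /= map_polyX map_polyC /= msymXU.
Qed.

Lemma msym_hat_idem s i : stab Q s -> pmsym s (hat_idem i) = hat_idem (s i).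
Proof.
move=> ss; rewrite /hat_idem rmorphB /= map_polyC /= [X in _ - X]rmorphXn rmorphB /=.
by rewrite map_polyC /= (msym_far_poly _ ss) rmorphXn /= (msym_far_det _ ss).
Qed.

Lemma msym_all_det s : stab Q s -> msym s all_det = all_det.
Proof.
move=> ss; rewrite rmorph_prod /= [RHS](reindex_perm s) /=; apply: eq_bigr => i _.
by rewrite rmorphXn /= msym_far_det.
Qed.

Lemma msym_rest_det s i : stab Q s -> msym s (rest_det i) = rest_det (s i).
Proof.
move=> ss; rewrite rmorph_prod /= [RHS](reindex_perm s) /=; apply: eq_big => [j|j _].
  by rewrite (inj_eq perm_inj).
by rewrite rmorphXn /= msym_far_det.
Qed.

Lemma sim_card_stab s i : stab Q s -> sim_card (s i) = sim_card i.
Proof.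
move=> ss; rewrite /sim_card -!sum1_card (reindex_perm s) /=.
by apply: eq_bigl => j; rewrite !inE sim_stab.
Qed.

Lemma msym_local_interp (s : 'S_n) (M : 'M[k]_n) :
  stab Q s -> (forall i j, M (s i) (s j) = M i j) ->
  pmsym s (local_interp M) = local_interp M.
Proof.
move=> ss Ms; rewrite rmorph_sum [RHS](reindex_perm s); apply: eq_bigr => i _ /=.
rewrite map_polyZ /= msymM msymC rmorphM /= msym_rest_det // msym_spec_target // sim_card_stab //.
by rewrite msym_hat_idem.
Qed.

(** Invariance under [stab] is promoted to full symmetry by the multiplier [v]. Modulo [Q], both [F]
    and [c] acquire the same factor [h v], so the congruences of [local_interp] persist, and [c]
    stays outside [Q] because [h], [v] and [all_det] do. *)
Lemma spectral_interpolation : exists (F : {poly R}) (c : R) (M : 'M[k]_n),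
  [/\ forall m, F`_m \is symmetric, c \is symmetric /\ ~ Q c,
      forall a b, mrel Q a b -> forall l, mdot a (M^~ l) = mdot b (M^~ l),
      forall x, mrel_dual Q x -> forall i, \sum_j M i j * x 0 j = x 0 i &
      forall i, near i (F - c *: spec_target M i)].
Proof.
have [M [relM dualM stabM]] := dual_projector char0 spQ.
have [v [nv sv nsv]] := stab_isolator char0 G1 spQ.
pose f := local_interp M; pose h := #|[pred s | stab Q s]|.
have fs s : stab Q s -> pmsym s f = f.
  by move=> ss; apply: msym_local_interp => // i j; apply: stabM.
pose F := \sum_s pmsym s (v *: f); pose c := \sum_s msym s (v * all_det).
have Fm m : F`_m = \sum_s msym s (v * f`_m).
  by rewrite coef_sum; apply: eq_bigr => s _; rewrite coef_map coefZ.
have QF m : Q (F`_m - h%:R * (v * f`_m)).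
  rewrite Fm; apply: (stab_symmetrize spQ) => // s ss.
  by rewrite -coef_map /= fs.
have Qc : Q (c - h%:R * (v * all_det)).
  by apply: (stab_symmetrize spQ) => // s ss; apply: msym_all_det.
have nh : ~ Q h%:R.
  move=> /(spectral_prime_at1 char0 G1 spQ) /eqP; rewrite rmorph_nat ((pcharf0P _).1 char0).
  apply/negP; rewrite -lt0n; apply/card_gt0P; exists 1%g; rewrite inE.
  exact: stab1.
exists F, c, M; split=> // [m| |i].
- by rewrite Fm; apply: msym_sum_symmetric.
- split; first exact: msym_sum_symmetric.
  move=> Qc'; have : Q (h%:R * (v * all_det)).
    by rewrite -[h%:R * _](subKr c); apply: (is_idealB idQ).
  by case/(sp_prime spQ) => // /(sp_prime spQ) [//|/all_det_notin].
- have idN := near_ideal i.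
  have NF : near i (F - (h%:R * v)%:P * f).
    exists 0 => m; rewrite mulr0 subr0 coefB coefCM -mulrA.
    exact: QF.
  apply: (congrJ_trans idN NF).
  apply: (congrJ_trans idN (b := (h%:R * v)%:P * (all_det *: spec_target M i))).
    by rewrite -mulrBr; apply: (is_idealMl idN); apply: local_interp_near.
  rewrite -!mul_polyC mulrA -polyCM -mulrBl; apply: (is_idealMr idN); rewrite -polyCB.
  by apply: nearC; rewrite -opprB -mulrA; apply: (is_idealN idQ).
Qed.

End Interpolation.

(** * Exponential polynomials *)

Lemma sum_fibers (V : nmodType) (T : Type) (U : eqType) (S : seq T) (w : T -> U) (F : T -> V) :
  \sum_(a <- S) F a = \sum_(b <- undup (map w S)) \sum_(a <- S | w a == b) F a.
Proof.
under [RHS]eq_bigr do rewrite big_mkcond.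
rewrite exchange_big /=.
suff H (S' : seq U) : {subset map w S <= S'} -> uniq S' ->
    \sum_(a <- S) F a = \sum_(a <- S) \sum_(b <- S') (if w a == b then F a else 0).
  by apply: H; [move=> b; rewrite mem_undup | apply: undup_uniq].
move=> sub uS'; elim: S sub => [|a S IHS] sub; first by rewrite !big_nil.
rewrite !big_cons IHS; last by move=> b bS; apply: sub; rewrite inE bS orbT.
congr (_ + _); rewrite (bigD1_seq (w a)) ?sub ?mem_head //= eqxx big1 ?addr0 //.
by move=> b nb; rewrite eq_sym (negPf nb).
Qed.

Lemma bezout_idempotents (k : fieldType) (m : nat) (s : seq k) : uniq s -> s != [::] ->
  exists e : k -> {poly k}, \sum_(a <- s) e a = 1 /\
    forall a, a \in s -> \prod_(b <- s) ('X - b%:P) ^+ m %| e a * ('X - a%:P) ^+ m.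
Proof.
elim: s => // b [|c s] IHs /=.
  exists (fun=> 1); rewrite big_seq1; split=> // a; rewrite inE => /eqP ->.
  by rewrite big_seq1 mul1r.
case/andP => nbs us _; have [e [e1 e2]] := IHs us isT.
move: (c :: s) nbs e1 e2 {us IHs} => {c}s nbs e1 e2.
set q := \prod_(b <- s) _ in e2.
have co : coprimep (('X - b%:P) ^+ m) q.
  rewrite /q big_seq; apply: (big_ind (coprimep (('X - b%:P) ^+ m))).
  - exact: coprimep1.
  - by move=> x y cx cy; rewrite coprimepMr cx.
  - move=> a as_; rewrite coprimep_expl // coprimep_expr // coprimep_XsubC root_XsubC.
    by apply: contraNneq nbs => <-.
have [[u v] /= uv] := Bezout_eq1_coprimepP _ _ co.
exists (fun a => if a == b then v * q else u * ('X - b%:P) ^+ m * e a).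
have nab a : a \in s -> (a == b) = false by move=> as_; apply: contraNF nbs => /eqP <-.
split=> [|a]; rewrite ?big_cons ?eqxx -/q.
  rewrite (eq_big_seq (fun a => u * ('X - b%:P) ^+ m * e a)) => [|a /nab -> //].
  by rewrite -mulr_sumr e1 mulr1 addrC.
rewrite inE; case: eqP => [-> _ | _ /= as_].
  have -> : v * q * ('X - b%:P) ^+ m = v * (('X - b%:P) ^+ m * q) by ring.
  exact: dvdp_mulIr.
have -> : u * ('X - b%:P) ^+ m * e a * ('X - a%:P) ^+ m =
    u * (('X - b%:P) ^+ m * (e a * ('X - a%:P) ^+ m)) by ring.
by apply: dvdp_mull; apply: dvdp_mul => //; apply: e2.
Qed.

Lemma prod_XsubC_dvd_undup (k : fieldType) (m : nat) (l : seq k) : (size l <= m)%N ->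
  \prod_(a <- l) ('X - a%:P) %| \prod_(a <- undup l) ('X - a%:P) ^+ m.
Proof.
move=> lem; rewrite -big_undup_iterop_count.
apply: (big_ind2 (fun p q => p %| q)); first exact: dvdpp.
  by move=> x1 x2 y1 y2; apply: dvdp_mul.
move=> a _; rewrite [iterop _ _ _ _](_ : _ = ('X - a%:P) ^+ count_mem a l) //.
by rewrite dvdp_exp2l // (leq_trans (count_size _ _)).
Qed.

Lemma spectral_idempotents (k : fieldType) (n : nat) (A : 'M[k]_n.+1) x :
  [pchar k] =i pred0 -> eigenvalues A x ->
  exists E : 'I_n.+1 -> {poly k}, \sum_i E i = 1 /\
    forall i, horner_mx A (E i * ('X - (x i)%:P) ^+ n.+1) = 0.
Proof.
move=> char0 Ax; pose l := [seq x i | i <- index_enum 'I_n.+1].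
have xl i : x i \in undup l by rewrite mem_undup map_f // mem_index_enum.
have [||e [e1 e2]] := @bezout_idempotents k n.+1 (undup l).
- exact: undup_uniq.
- by apply/eqP => l0; have := xl 0; rewrite l0.
(* Several indices may carry the same eigenvalue; its idempotent is shared equally among them. *)
pose c a : k := (\sum_(i | x i == a) 1)%:R.
have nzc i : c (x i) != 0.
  by rewrite ((pcharf0P _).1 char0) (bigD1 i) //= eqxx.
exists (fun i => (c (x i))^-1 *: e (x i)); split=> [|i].
  rewrite (sum_fibers _ x) -/l -[RHS]e1; apply: eq_big_seq => a.
  rewrite mem_undup => /mapP [i _ ->].
  rewrite (eq_bigr (fun=> (c (x i))^-1 *: e (x i))) => [|j /eqP -> //].
  rewrite -[in LHS]scaler_sumr big_const_seq iter_addr_0 -sum1_count.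
  by rewrite -scaler_nat scalerA mulVf ?scale1r.
have /dvdpP [r rE] : char_poly A %| e (x i) * ('X - (x i)%:P) ^+ n.+1.
  apply: dvdp_trans (e2 _ (xl i)); rewrite Ax.
  rewrite -(big_map x xpredT (fun a => 'X - a%:P)) -/l.
  by apply: prod_XsubC_dvd_undup; rewrite size_map [index_enum _]unlock -enumT size_enum_ord.
rewrite -scalerAl linearZ /= rE rmorphM /= Cayley_Hamilton mulr0 scaler0.
by [].
Qed.

Definition binp (k : fieldType) (l : nat) : {poly k} :=
  l`!%:R^-1 *: \prod_(i < l) ('X - (i%:R)%:P).

Lemma binp_nat (k : fieldType) l m : [pchar k] =i pred0 -> (binp k l).[m%:R] = 'C(m, l)%:R.
Proof.
move=> char0; rewrite /binp hornerZ horner_prod.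
apply: (mulfI (fact_neq0 char0 l)).
rewrite mulrA mulfV ?fact_neq0 // mul1r -natrM mulnC bin_ffact.
under eq_bigr do rewrite hornerXsubC.
have [leml|ltml] := leqP l m.
  rewrite ffact_prod natr_prod; apply: eq_bigr => i _.
  by rewrite natrB // ltnW // (leq_trans (ltn_ord i)).
by rewrite ffact_small // (bigD1 (Ordinal ltml)) //= subrr mul0r.
Qed.

Lemma binp0 (k : fieldType) : binp k 0 = 1.
Proof. by rewrite /binp big_ord0 fact0 invr1 scale1r. Qed.

Lemma binpS_at0 (k : fieldType) l : (binp k l.+1).[0] = 0.
Proof. by rewrite hornerZ big_ord_recl hornerM hornerXsubC subrr mul0r mulr0. Qed.

(** These are the Taylor coefficients of [log (1 + u)], the derivative of [(1 + u) ^ j] at [j = 0];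
    they link exponential polynomials to [local_log]. *)
Lemma deriv_binpS (k : fieldType) l : [pchar k] =i pred0 ->
  (binp k l.+1)^`().[0] = (- 1) ^+ l / l.+1%:R.
Proof.
move=> char0; rewrite derivZ hornerZ big_ord_recl derivM subr0 derivX mul1r.
rewrite hornerD hornerM hornerX.
rewrite mul0r addr0 horner_prod.
under eq_bigr do rewrite hornerXsubC sub0r.
rewrite prodrN card_ord; have -> : \prod_(i < l) (bump 0 i)%:R = l`!%:R :> k.
  rewrite -natr_prod fact_prod big_add1 /= big_mkord.
  by [].
rewrite factS natrM invfM mulrCA; congr (_ * _).
by rewrite -mulrA mulVf ?mulr1 // fact_neq0.
Qed.

Lemma poly_nat_roots_eq0 (k : fieldType) (p : {poly k}) : [pchar k] =i pred0 ->
  (forall j : nat, p.[j%:R] = 0) -> p = 0.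
Proof.
move=> char0 p0; apply/eqP; apply: contraT => nz.
pose rs := [seq (i : nat)%:R : k | i <- iota 0 (size p)].
have := @max_poly_roots _ _ rs nz; rewrite size_map size_iota ltnn => -> //.
  by apply/allP => a /mapP [j _ ->]; rewrite /root p0.
rewrite map_inj_uniq ?iota_uniq // => i j /eqP; rewrite natr_inj_char0 //.
by move/eqP.
Qed.

Lemma shift_poly_eq0 (k : fieldType) (q : {poly k}) : [pchar k] =i pred0 ->
  q \Po ('X + 1) = q -> q = (q.[0])%:P.
Proof.
move=> char0 qs.
have qj j : q.[j%:R] = q.[0].
  elim: j => // j IHj; rewrite -IHj -{2}qs horner_comp hornerD hornerX hornerE natr1.
  by [].
apply/subr0_eq/(poly_nat_roots_eq0 char0) => j.
by rewrite hornerD hornerN hornerC qj subrr.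
Qed.

Lemma size_shift (k : fieldType) (q : {poly k}) : size (q \Po ('X + 1)) = size q.
Proof. by rewrite size_comp_poly2 // size_XaddC. Qed.

Lemma lead_coef_shift (k : fieldType) (q : {poly k}) : lead_coef (q \Po ('X + 1)) = lead_coef q.
Proof.
rewrite lead_coef_comp ?size_XaddC // -[1]/(1%:P) lead_coefXaddC expr1n mulr1.
by [].
Qed.

(* The operator [a_j |-> a_(j+1) - w0 a_j] lowers the degree of the coefficient of
   [w0 ^ j] and preserves the degrees of the others. *)
Lemma exp_poly_indep (k : fieldType) (s : seq k) (q : k -> {poly k}) :
  [pchar k] =i pred0 -> uniq s -> 0 \notin s ->
  (forall j : nat, \sum_(w <- s) (q w).[j%:R] * w ^+ j = 0) ->
  forall w, w \in s -> q w = 0.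
Proof.
move=> char0 us s0.
have [N] := ubnP (\sum_(w <- s) size (q w)); elim: N q => // N IHN q leN z w ws.
apply/eqP; apply: contraT => nzq.
pose q' v := v *: (q v \Po ('X + 1)) - w *: q v.
have z' j : \sum_(v <- s) (q' v).[j%:R] * v ^+ j = 0.
  have -> : \sum_(v <- s) (q' v).[j%:R] * v ^+ j =
      \sum_(v <- s) (q v).[j.+1%:R] * v ^+ j.+1 - w * \sum_(v <- s) (q v).[j%:R] * v ^+ j.
    rewrite mulr_sumr -sumrB; apply: eq_bigr => v _.
    rewrite /q' hornerD hornerN !hornerZ horner_comp hornerD hornerX hornerC.
    by rewrite natr1 exprS; ring.
  by rewrite !z mulr0 subr0.
have wn0 : w != 0 by apply: contraNneq s0 => <-.
have le_q' v : (size (q' v) <= size (q v))%N.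
  apply: leq_trans (size_polyD _ _) _; rewrite size_polyN geq_max.
  by rewrite (leq_trans (size_scale_leq _ _)) ?size_shift // size_scale_leq.
have lt_q' : (size (q' w) < size (q w))%N.
  rewrite -[X in (_ < X)%N]prednK ?size_poly_gt0 // ltnS; apply/leq_sizeP => i.
  rewrite leq_eqVlt => /predU1P [<-|lti].
    have := lead_coef_shift (q w); rewrite !lead_coefE size_shift => E.
    by rewrite coefB !coefZ E subrr.
  have lei : (size (q w) <= i)%N by rewrite -[size (q w)]prednK ?size_poly_gt0.
  by rewrite nth_default // (leq_trans (le_q' w)).
have q'0 : forall v, v \in s -> q' v = 0.
  apply: IHN z'; move: leN; rewrite ltnS; apply: leq_trans.
  rewrite (bigD1_seq w) //= [X in (_ < X)%N](bigD1_seq w) //= -addSn.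
  by apply: leq_add => //; apply: leq_sum.
have qv v : v \in s -> v != w -> q v = 0.
  move=> vs nvw; apply/eqP; apply: contraT => nz.
  have /(congr1 lead_coef) := subr0_eq (q'0 v vs).
  rewrite !lead_coefZ lead_coef_shift => /(mulIf _) /eqP; rewrite (negPf nvw) lead_coef_eq0.
  by move=> /(_ nz).
(* Only the term of [w] is left, and [q w] is invariant under the shift, hence constant; its value
   is read off at [j = 0]. *)
have := z 0; rewrite (bigD1_seq w) //= big_seq_cond big1 => [|v /andP [vs nvw]]; last first.
  by rewrite (qv v vs nvw) horner0 mul0r.
rewrite expr0 mulr1 addr0 => q0.
have qs : q w \Po ('X + 1) = q w.
  by apply: (scalerI wn0); apply: subr0_eq; apply: q'0.
by have := shift_poly_eq0 char0 qs; rewrite q0 => qw0; rewrite qw0 eqxx in nzq.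
Qed.

Definition unip (k : fieldType) (a : k) : {poly k} := a^-1 *: ('X - a%:P).

Definition local_log (k : fieldType) (m : nat) (a : k) : {poly k} :=
  \sum_(l < m) ((- 1) ^+ l / l.+1%:R) *: unip a ^+ l.+1.

(* [f (A)] is the derivative at exponent [0] of the exponential polynomial [j |-> A ^ j],
   with [x_i ^ j] differentiated to [mu_i] and [j] to [c]. *)
Lemma exp_poly_powers (k : fieldType) (n : nat) (A : 'M[k]_n.+1) x (mu : 'I_n.+1 -> k) c f :
  [pchar k] =i pred0 -> eigenvalues A x -> (forall i, x i != 0) ->
  (forall i, ('X - (x i)%:P) ^+ n.+1 %| f - (mu i)%:P - c *: local_log n.+1 (x i)) ->
  exists C : 'I_n.+1 -> 'M[{poly k}]_n.+1,
    (forall j, A ^+ j = \sum_i x i ^+ j *: map_mx (horner_eval j%:R) (C i)) /\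
    horner_mx A f = \sum_i (mu i *: map_mx (horner_eval 0) (C i) +
                            c *: map_mx (fun q => q^`().[0]) (C i)).
Proof.
move=> char0 Ax nz hf; have [E [E1 E2]] := spectral_idempotents char0 Ax.
pose Z i l := horner_mx A (E i * unip (x i) ^+ l).
have Zbig i l : (n < l)%N -> Z i l = 0.
  move=> ltnl; rewrite /Z -(subnK ltnl) exprD mulrA [X in X * _]mulrC -mulrA rmorphM /=.
  by rewrite {2}/unip [X in _ * horner_mx A (_ * X)]exprZn -scalerAr linearZ /= E2 scaler0 mulr0.
have E1A p : horner_mx A p = \sum_i horner_mx A (E i * p).
  by rewrite -rmorph_sum /= -mulr_suml E1 mul1r.
exists (fun i => \sum_(l < n.+1) binp k l *: map_mx (@polyC k) (Z i l)); split=> [j|].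
  have -> : A ^+ j = horner_mx A ('X ^+ j) by rewrite rmorphXn /= horner_mx_X.
  rewrite E1A; apply: eq_bigr => i _.
  have -> : 'X ^+ j = x i ^+ j *: \sum_(l < j.+1) unip (x i) ^+ l *+ 'C(j, l).
    have -> : 'X = x i *: (1 + unip (x i)) :> {poly k}.
      by rewrite scalerDr scalerA mulfV // scale1r alg_polyC addrC subrK.
    rewrite exprZn exprDn; congr (_ *: _); apply: eq_bigr => l _.
    by rewrite expr1n mul1r.
  rewrite -scalerAr linearZ /= mulr_sumr rmorph_sum /=; congr (_ *: _).
  pose F l := 'C(j, l)%:R *: Z i l.
  rewrite (eq_bigr (fun l : 'I_j.+1 => F l)); last first.
    by move=> l _; rewrite mulrnAr raddfMn /= -scaler_nat.
  rewrite raddf_sum /= (eq_bigr (fun l : 'I_n.+1 => F l)); last first.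
    move=> l _; apply/matrixP => a b; rewrite !mxE /horner_eval hornerM hornerC.
    by rewrite binp_nat.
  rewrite -!(big_mkord xpredT F).
  (* The binomial sum stops at [j] and the definition of [C] at [n]; they agree because ['C(j, l)]
     vanishes beyond [j] and [Z i l] beyond [n]. *)
  have tail M N : (M <= N)%N -> (forall l, (M <= l)%N -> F l = 0) ->
      \sum_(0 <= l < N) F l = \sum_(0 <= l < M) F l.
    move=> leMN F0; rewrite (big_cat_nat (leq0n _) leMN) /=.
    rewrite [X in _ + X]big_nat [X in _ + X]big1 ?addr0 //.
    by move=> l /andP [leMl _]; apply: F0.
  have F1 l : (j < l)%N -> F l = 0 by move=> ltjl; rewrite /F bin_small // scale0r.
  have F2 l : (n < l)%N -> F l = 0 by move=> ltnl; rewrite /F Zbig // scaler0.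
  by case: (leqP j n) => [lejn | /ltnW lenj]; [rewrite [RHS](tail j.+1) | rewrite (tail n.+1)].
rewrite E1A; apply: eq_bigr => i _.
have /dvdpP [r rE] := hf i.
have -> : f = (mu i)%:P + c *: local_log n.+1 (x i) + r * ('X - (x i)%:P) ^+ n.+1.
  by rewrite -rE; ring.
rewrite mulrDr rmorphD /= [_ * (r * _)]mulrCA [horner_mx A (r * _)]rmorphM /= E2 mulr0 addr0.
rewrite mulrDr rmorphD /=; congr (_ + _).
  rewrite mulrC mul_polyC linearZ /=; congr (_ *: _).
  rewrite raddf_sum big_ord_recl big1 ?addr0 => [|l _].
    apply/matrixP => a b; rewrite binp0 scale1r [RHS]mxE [map_mx (@polyC k) _ a b]mxE /=.
    rewrite /horner_eval hornerC.
    by rewrite /Z expr0 mulr1.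
  apply/matrixP => a b; rewrite !mxE /horner_eval /= /horner_eval hornerM binpS_at0 mul0r.
  by [].
rewrite -scalerAr linearZ /=; congr (_ *: _).
rewrite mulr_sumr rmorph_sum /= big_ord_recr /= -scalerAr linearZ /= -/(Z i n.+1).
rewrite Zbig // scaler0 addr0.
apply/matrixP => a b; rewrite summxE [RHS]mxE summxE raddf_sum /= horner_sum big_ord_recl.
rewrite [X in X^`()]mxE binp0 mul1r [map_mx (@polyC k) _ a b]mxE derivC hornerC add0r.
apply: eq_bigr => l _.
rewrite -scalerAr linearZ /= -/(Z i l.+1) mxE [X in X^`()]mxE [map_mx (@polyC k) _ a b]mxE.
rewrite derivM derivC mulr0 addr0.
by rewrite hornerM hornerC deriv_binpS.
Qed.

Definition linear_sub (k : fieldType) (n : nat) (C : 'I_n -> 'M[{poly k}]_n)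
    (l : 'I_(n * n)) : {mpoly {poly k}[n]} :=
  \sum_i (mxvec (C i) 0 l) *: 'X_i.

(** [p] applied to the combination of the [C i] with the variables ['X_i] as coefficients. Setting
    ['X_i] to [x i ^ j] and the inner variable to [j] gives [p (A ^ j)]; another substitution gives
    a curve through the identity. *)
Definition exp_sub (k : fieldType) (n : nat) (C : 'I_n -> 'M[{poly k}]_n)
    (p : {mpoly k[n * n]}) : {mpoly {poly k}[n]} :=
  mmap (@mpolyC n {poly k} \o @polyC k) (linear_sub C) p.

(** This bound leaves only finitely many coincidences among monomials in the eigenvalues to be
    controlled for a given [p]. *)
Lemma msupp_exp_sub (k : fieldType) (n : nat) (C : 'I_n -> 'M[{poly k}]_n)
    (p : {mpoly k[n * n]}) m :
  m \in msupp (exp_sub C p) -> (mdeg m < msize p)%N.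
Proof.
rewrite /exp_sub /mmap => /msupp_sum_le /flattenP [s /mapP [a]].
rewrite mem_filter /= => ap -> {s}; rewrite mul_mpolyC => /msuppZ_le => ms.
suff /dhomogP /(_ m ms) -> : mmap1 (linear_sub C) a \is (mdeg a).-homog by apply: msize_mdeg_lt.
rewrite /mmap1 mdegE; apply: (big_ind2 (fun (P : {mpoly {poly k}[n]}) d => P \is d.-homog)).
- exact: dhomog1.
- by move=> P d P' d'; apply: dhomogM.
move=> i _; rewrite -{2}[a i]mul1n; apply: dhomogMn; apply: rpred_sum => j _.
by apply: dhomogZ; rewrite dhomogX /= mdeg1.
Qed.

Lemma mmap_exp_sub (k : fieldType) (n : nat) (C : 'I_n -> 'M[{poly k}]_n)
    (p : {mpoly k[n * n]}) (S : comNzRingType) (h : {rmorphism {poly k} -> S}) (v : 'I_n -> S) :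
  mmap h v (exp_sub C p) =
  mxmap (h \o @polyC k) (\sum_i v i *: map_mx h (C i)) p.
Proof.
pose hv : {rmorphism {mpoly {poly k}[n]} -> S} := mmap h v.
rewrite /exp_sub (rmorph_mmap _ _ hv) /=.
transitivity (mmap (h \o @polyC k) (hv \o linear_sub C) p).
  by apply: eq_bigr => m _; congr (_ * _); rewrite /= /hv mmapC.
apply: eq_mmap => l; rewrite /= /hv /linear_sub rmorph_sum /=.
case/mxvec_indexP: l => a b; rewrite mxvecE summxE; apply: eq_bigr => i _.
by rewrite mmapZ mmapX mmap1U mxvecE !mxE mulrC.
Qed.

Lemma deriv_monomial_at0 (k : comNzRingType) (n : nat) (mu : 'I_n -> k) (a : 'X_{1..n}) :
  let v i : {poly k} := 1 + mu i *: 'X in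
  (mmap1 v a).[0] = 1 /\ (mmap1 v a)^`().[0] = mdot a mu.
Proof.
move=> v; have v0 i : (v i).[0] = 1 by rewrite hornerD hornerZ hornerX mulr0 addr0 hornerC.
have mon0 b : (mmap (@polyC k) v 'X_[b]).[0] = 1.
  by rewrite horner_mmap mevalX big1 // => i _; rewrite v0 expr1n.
rewrite -!(mmapX v (@polyC k)) mon0; split=> //.
rewrite deriv_mmap horner_sum; apply: eq_bigr => i _; rewrite mderivX mmapZ !hornerM hornerC mon0.
by rewrite mulr1 derivD derivC add0r derivZ derivX hornerZ hornerC mulr1.
Qed.

(** The curve [B] replaces [x i ^ j] by [1 + mu i * t] and [j] by [c * t]; it starts at the identity
    with velocity [f (A)]. With the monomials grouped by their value at [x], independence makes each
    group sum [q b] zero. The derivative of a group is [c] times that of [q b] plus the value of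
    [q b] times the common [mdot a mu], hence zero. *)
Lemma mxdiff_interpolation (k : fieldType) (n : nat) (A : 'M[k]_n.+1) x mu c f
    (p : {mpoly k[n.+1 * n.+1]}) :
  [pchar k] =i pred0 -> eigenvalues A x -> (forall i, x i != 0) ->
  (forall i, ('X - (x i)%:P) ^+ n.+1 %| f - (mu i)%:P - c *: local_log n.+1 (x i)) ->
  (forall a b : 'X_{1..n.+1}, (mdeg a < msize p)%N -> (mdeg b < msize p)%N ->
    'X_[a].@[x] = 'X_[b].@[x] -> mdot a mu = mdot b mu) ->
  (forall j, mxeval p (A ^+ j) = 0) ->
  mxdiff p 1%:M (horner_mx A f) = 0.
Proof.
move=> char0 Ax nz hf coin pA; have [C [CA Cf]] := exp_poly_powers char0 Ax nz hf.
pose P := exp_sub C p; pose S := msupp P; pose w (a : 'X_{1..n.+1}) : k := 'X_[a].@[x].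
have wE a j : mmap1 (fun i => x i ^+ j) a = w a ^+ j.
  rewrite /w mevalX -prodrXl; apply: eq_bigr => i _.
  by rewrite -!exprM mulnC.
pose q b := \sum_(a <- S | w a == b) P@_a.
have q0 b : b \in undup (map w S) -> q b = 0.
  apply: (exp_poly_indep char0) => [||j]; first exact: undup_uniq.
    rewrite mem_undup; apply/mapP => -[a _ /esym/eqP]; rewrite /w mevalX => /prodf_eq0 [i _].
    by rewrite expf_eq0 (negPf (nz i)) andbF.
  rewrite -[RHS](pA j) CA.
  have -> : \sum_(b <- undup (map w S)) (q b).[j%:R] * b ^+ j =
      mmap (horner_eval j%:R) (fun i => x i ^+ j) P.
    rewrite /mmap (sum_fibers _ w); apply: eq_bigr => d _.
    rewrite /q horner_sum mulr_suml; apply: eq_bigr => a /eqP <-.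
    by rewrite wE.
  rewrite /P mmap_exp_sub mxevalE /mmap; apply: eq_bigr => m _.
  by rewrite /= /horner_eval hornerC.
pose v i : {poly k} := 1 + mu i *: 'X.
pose h : {rmorphism {poly k} -> {poly k}} := comp_poly (c *: 'X).
have h0 r : (h r).[0] = r.[0] by rewrite /h /= horner_comp hornerZ hornerX mulr0.
have h1 r : (h r)^`().[0] = c * r^`().[0].
  rewrite /h /= deriv_comp derivZ derivX hornerM horner_comp !hornerZ hornerX hornerC.
  by rewrite mulr1 mulr0 mulrC.
have v0 i : (v i).[0] = 1 by rewrite hornerD hornerZ hornerX mulr0 addr0 hornerC.
have v1 i : (v i)^`().[0] = mu i.
  by rewrite derivD derivC add0r derivZ derivX hornerZ hornerC mulr1.
pose B := \sum_i v i *: map_mx h (C i).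
have B0 : map_mx (horner_eval 0) B = 1%:M.
  have -> : 1%:M = A ^+ 0 by [].
  rewrite CA raddf_sum; apply: eq_bigr => i _.
  apply/matrixP => a b; rewrite !mxE /= /horner_eval hornerM v0 h0 expr0.
  by [].
have B1 : map_mx (fun b => b^`().[0]) B = horner_mx A f.
  rewrite Cf; apply/matrixP => a b; rewrite mxE !summxE raddf_sum horner_sum.
  apply: eq_bigr => i _; rewrite !mxE /= derivM hornerD !hornerM v0 v1 h0 h1 mul1r.
  by [].
have := mxdiff_curve p B; rewrite B0 B1 => <-.
have -> : mxmap (@polyC k) B p = mmap h v P.
  rewrite /P mmap_exp_sub -/B /mmap; apply: eq_bigr => m _.
  by rewrite /= comp_polyC.
rewrite /mmap raddf_sum horner_sum -/S (sum_fibers _ w) big1_seq // => b /andP [_ bS].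
have [a0 a0S wa0] : exists2 a0, a0 \in S & b = w a0 by apply/mapP; rewrite -mem_undup.
rewrite big_seq_cond (eq_bigr (fun a => c * (P@_a)^`().[0] + (P@_a).[0] * mdot a0 mu)).
  have /(congr1 (fun r => c * r^`().[0] + r.[0] * mdot a0 mu)) := q0 b bS.
  rewrite derivC !hornerC mulr0 mul0r addr0 -big_seq_cond /q => E; rewrite -[RHS]E.
  by rewrite raddf_sum !horner_sum mulr_sumr mulr_suml -big_split.
move=> a /andP [aS /eqP wa]; have [m0 m1] := deriv_monomial_at0 mu a.
rewrite /= derivM hornerD !hornerM h0 h1 m0 m1 mulr1; congr (_ + _ * _).
apply: coin; rewrite ?(msupp_exp_sub aS) ?(msupp_exp_sub a0S) //.
by rewrite -/(w a) -/(w a0) wa.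
Qed.

(** * The covariant takes values in the Lie algebra *)

Lemma sym_poly_mx (k : comNzRingType) (n : nat) (F : {poly {mpoly k[n.+1]}}) :
  (forall m, F`_m \is symmetric) ->
  exists Phi : 'M[{mpoly k[n.+1 * n.+1]}]_n.+1,
    forall (S : idomainType) (h : {rmorphism k -> S}) (A : 'M[S]_n.+1) x, eigenvalues A x ->
      map_mx (mxmap h A) Phi = horner_mx A (map_poly (mmap h x) F).
Proof.
move=> symF; pose P m := sval (constructive_indefinite_description _ (sym_mxpoly (symF m))).
have PE m (S : idomainType) (h : {rmorphism k -> S}) (A : 'M[S]_n.+1) x :
    eigenvalues A x -> mxmap h A (P m) = mmap h x F`_m.
  exact: (svalP (constructive_indefinite_description _ (sym_mxpoly (symF m)))).
exists (\sum_(m < size F) P m *: generic_mx k n.+1 ^+ m) => S h A x Ax.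
rewrite /map_poly poly_def !raddf_sum /=; apply: eq_bigr => m _.
rewrite linearZ /= rmorphXn /= horner_mx_X map_mxZ /= (PE _ _ _ _ _ Ax); congr (_ *: _).
by rewrite rmorphXn /= map_generic_mx.
Qed.

Lemma eigenvalues_root (k : fieldType) (n : nat) (A : 'M[k]_n) x i :
  A \in unitmx -> eigenvalues A x -> x i != 0.
Proof.
move=> uA Ax; apply: contraTneq uA => xi0.
have := char_poly_det A.
rewrite Ax -horner_coef0 horner_prod (bigD1 i) //= hornerXsubC xi0 subr0 mul0r.
move/esym/eqP; rewrite mulf_eq0 signr_eq0 /= => /eqP d0.
by rewrite unitmxE d0 unitr0.
Qed.

Lemma lag_unitmx (k : fieldType) (n : nat) (G : 'M[k]_n -> Prop) A :
  linear_algebraic_group G -> G A -> A \in unitmx.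
Proof. by case=> [[Z _ GZ] _ _ _] /GZ []. Qed.

Lemma group_expmx (k : fieldType) (n : nat) (G : 'M[k]_n.+1 -> Prop) A j :
  linear_algebraic_group G -> G A -> G (A ^+ j).
Proof.
move=> [_ G1 GM _] GA; elim: j => [|j IHj]; first by rewrite expr0.
by rewrite exprS -mulmxE; apply: GM.
Qed.

Lemma meval_spec_log (k : fieldType) (n : nat) (x : 'I_n -> k) i : (forall j, x j != 0) ->
  map_poly (meval x) (spec_log k i) = (spec_det k n).@[x] ^+ n *: local_log n (x i).
Proof.
move=> nz; rewrite raddf_sum /local_log scaler_sumr; apply: eq_bigr => l _ /=.
rewrite map_polyZ /= !mevalM mevalC !rmorphXn /= rmorphB /= map_polyX map_polyC /= mevalXU.
rewrite /unip exprZn !scalerA; congr (_ *: _).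
have detE : (spec_det k n).@[x] = x i * (spec_codet k i).@[x].
  by rewrite (spec_detE k i) mevalM mevalXU.
have -> : (spec_det k n).@[x] ^+ n =
    (spec_det k n).@[x] ^+ (n - l.+1) * (x i * (spec_codet k i).@[x]) ^+ l.+1.
  by rewrite -detE -exprD subnK.
rewrite exprMn exprVn; have nzl : x i ^+ l.+1 != 0 by rewrite expf_neq0.
set d := _ ^+ (n - _); set e := _ ^+ l.+1 in nzl *; set y := _ ^+ l.+1; set c := (- 1) ^+ l / _.
by rewrite -[LHS]mul1r -(mulfV nzl); ring.
Qed.

Definition spec_mu (k : comNzRingType) (n : nat) (M : 'M[k]_n) (x : 'I_n -> k) (i : 'I_n) : k :=
  \sum_j M i j * (x j - 1).

Lemma meval_spec_weight (k : fieldType) (n : nat) (M : 'M[k]_n) (x : 'I_n -> k) i :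
  (spec_weight M i).@[x] = spec_mu M x i.
Proof.
rewrite raddf_sum; apply: eq_bigr => j _.
by rewrite /= mevalM mevalC mevalB mevalXU meval1.
Qed.

Lemma mdot_spec_mu (k : fieldType) (n : nat) (M : 'M[k]_n) (x : 'I_n -> k) (a b : 'X_{1..n}) c :
  (forall j, mdot a (M^~ j) = mdot b (M^~ j)) ->
  mdot a (fun i => c * spec_mu M x i) = mdot b (fun i => c * spec_mu M x i).
Proof.
move=> Mab; have E d : mdot d (fun i => c * spec_mu M x i) =
    c * \sum_j mdot d (M^~ j) * (x j - 1).
  rewrite /mdot mulr_sumr; under [RHS]eq_bigr do rewrite mulr_suml mulr_sumr.
  rewrite [RHS]exchange_big; apply: eq_bigr => i _ /=.
  by rewrite /spec_mu !mulr_sumr; apply: eq_bigr => j _; ring.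
by rewrite !E; congr (_ * _); apply: eq_bigr => j _; rewrite Mab.
Qed.

Section GenericPoints.
Variables (k : closedFieldType) (n : nat) (G : 'M[k]_n.+1 -> Prop).
Variable Q : {mpoly k[n.+1]} -> Prop.
Hypotheses (char0 : [pchar k] =i pred0) (algG : linear_algebraic_group G).
Hypothesis spQ : spectral_prime G Q.
Let G1 : G 1%:M := lag_one algG.

Lemma sym_eval_eigenvalues (s : {mpoly k[n.+1]}) (A : 'M[k]_n.+1) x y :
  s \is symmetric -> eigenvalues A x -> eigenvalues A y -> s.@[x] = s.@[y].
Proof. by move=> /sym_mxpoly_eval [p pE] Ax Ay; rewrite -(pE _ _ Ax) (pE _ _ Ay). Qed.

Lemma spectral_prime_open u : ~ Q u ->
  exists s, [/\ s \is symmetric, ~ spectral_vanish G s &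
    forall x, (forall q, Q q -> q.@[x] = 0) -> s.@[x] != 0 -> u.@[x] != 0].
Proof.
move=> /(sp_sep spQ) [s [q [r [sym_s nvs Qq sE]]]]; exists s; split=> // x Qx.
by rewrite sE mevalD (Qx _ Qq) add0r mevalM mulf_eq0 negb_or => /andP [].
Qed.

Lemma spectral_generic_point u : ~ Q u ->
  exists A x, [/\ G A, eigenvalues A x, forall q, Q q -> q.@[x] = 0 & u.@[x] != 0].
Proof.
move=> /spectral_prime_open [s [sym_s nvs sP]].
have [A [x [GA Ax sx]]] : exists A x, [/\ G A, eigenvalues A x & s.@[x] != 0].
  apply: NNPP => no; apply: nvs => A x GA Ax; apply/eqP.
  by apply: contra_notT no => sx; exists A, x.
have [y Ay Qy] := spectral_point char0 spQ GA.
exists A, y; split=> //; apply: sP => //.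
by rewrite (sym_eval_eigenvalues sym_s Ay Ax).
Qed.

Definition unrelated (b : nat) : {mpoly k[n.+1]} :=
  \prod_(ac : 'X_{1..n.+1 < b} * 'X_{1..n.+1 < b} | ~~ propb (mrel Q ac.1 ac.2))
    ('X_[ac.1] - 'X_[ac.2]).

Lemma unrelated_notin b : ~ Q (unrelated b).
Proof. by apply: (spectral_prime_prod char0 G1 spQ) => ac /propbP. Qed.

Lemma unrelated_coincidence b x (a c : 'X_{1..n.+1}) : (unrelated b).@[x] != 0 ->
  (mdeg a < b)%N -> (mdeg c < b)%N -> 'X_[a].@[x] = 'X_[c].@[x] -> mrel Q a c.
Proof.
move=> ux lta ltc ac; apply/propbP; apply: contraTT ux => nac.
rewrite negbK rmorph_prod /= (bigD1 (BMultinom lta, BMultinom ltc)) //=.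
by rewrite mevalB ac subrr mul0r.
Qed.

End GenericPoints.

Lemma meval_spec_target (k : fieldType) (n : nat) (M : 'M[k]_n) (x : 'I_n -> k) i :
  (forall j, x j != 0) ->
  map_poly (meval x) (spec_target M i) =
    ((spec_det k n).@[x] ^+ n * spec_mu M x i)%:P + (spec_det k n).@[x] ^+ n *: local_log n (x i).
Proof.
move=> nz; rewrite rmorphD /= map_polyC /= mevalM rmorphXn /= meval_spec_weight.
by rewrite meval_spec_log.
Qed.

Lemma near_eval (k : closedFieldType) (n : nat) (Q : {mpoly k[n]} -> Prop) (x : 'I_n -> k) i p :
  (forall q, Q q -> q.@[x] = 0) -> near Q i p ->
  ('X - (x i)%:P) ^+ n %| map_poly (meval x) p.
Proof.
move=> Qx [r rP]; apply/dvdpP; exists (map_poly (meval x) r).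
have : map_poly (meval x) (p - ('X - ('X_i)%:P) ^+ n * r) = 0.
  by apply/polyP => m; rewrite coef_map coef0 /= Qx.
rewrite rmorphB rmorphM rmorphXn rmorphB /= map_polyX map_polyC /= mevalXU => /subr0_eq ->.
by rewrite mulrC.
Qed.

Definition lin_form (k : fieldType) (n : nat) (p : {mpoly k[n * n]})
    (Phi : 'M[{mpoly k[n * n]}]_n) : {mpoly k[n * n]} :=
  \sum_i \sum_j (mxeval (mderiv (mxvec_index i j) p) 1%:M)%:MP * Phi i j.

Lemma mmap_lin_form (k : fieldType) (n : nat) (S : comNzRingType) (h : {rmorphism k -> S})
    (A : 'M[S]_n) p Phi :
  mxmap h A (lin_form p Phi) =
  \sum_i \sum_j h (mxeval (mderiv (mxvec_index i j) p) 1%:M) * (map_mx (mxmap h A) Phi) i j.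
Proof.
rewrite rmorph_sum; apply: eq_bigr => i _; rewrite /= rmorph_sum; apply: eq_bigr => j _ /=.
by rewrite rmorphM /= mmapC mxE.
Qed.

(** The conclusion is a polynomial identity on [G] instead of membership in the Lie algebra, so that
    it can also be evaluated along formal exponentials. The factor [ps] in the proof is zero
    wherever two unrelated monomials of degree below [msize p] coincide. *)
Lemma covariant_in_lie (k : closedFieldType) (n : nat) (G : 'M[k]_n.+1 -> Prop)
    Q F c (M : 'M[k]_n.+1) (Phi : 'M[{mpoly k[n.+1 * n.+1]}]_n.+1) :
  [pchar k] =i pred0 -> linear_algebraic_group G -> irreducible_set G -> spectral_prime G Q ->
  (forall a b, mrel Q a b -> forall l, mdot a (M^~ l) = mdot b (M^~ l)) ->
  (forall i, near Q i (F - c *: spec_target M i)) ->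
  (forall (A : 'M[k]_n.+1) x, eigenvalues A x ->
     map_mx (fun p => mxeval p A) Phi = horner_mx A (map_poly (meval x) F)) ->
  forall p, vanishes_on G p -> vanishes_on G (lin_form p Phi).
Proof.
move=> char0 algG irrG spQ relM nearF PhiE p Gp.
have nu := @unrelated_notin _ _ _ _ char0 algG spQ (msize p).
have [s [sym_s nvs sP]] := spectral_prime_open spQ nu.
have [ps psE] := sym_mxpoly_eval sym_s.
have [|ps0|//] := irrG ps (lin_form p Phi).
  move=> A GA; rewrite mxevalM.
  have [-> | nzs] := eqVneq (mxeval ps A) 0; first by rewrite mul0r.
  have [x Ax Qx] := spectral_point char0 spQ GA.
  have ux : (unrelated Q (msize p)).@[x] != 0 by apply: sP; rewrite -?(psE _ _ Ax).
  have uA := lag_unitmx algG GA.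
  have nz i : x i != 0 by apply: eigenvalues_root Ax.
  suff -> : mxeval (lin_form p Phi) A = 0 by rewrite mulr0.
  pose d := (spec_det k n.+1).@[x] ^+ n.+1.
  pose mu i := c.@[x] * d * spec_mu M x i.
  have <- : mxdiff p 1%:M (horner_mx A (map_poly (meval x) F)) = mxeval (lin_form p Phi) A.
    by rewrite mxevalE mmap_lin_form -(PhiE _ _ Ax).
  apply: (mxdiff_interpolation (mu := mu) (c := c.@[x] * d) char0 Ax nz).
  - move=> i; have := near_eval Qx (nearF i).
    rewrite rmorphB /= map_polyZ /= meval_spec_target // scalerDr opprD addrA.
    by rewrite -/d scalerA -[c.@[x] *: _%:P]mul_polyC -polyCM mulrA.
  - move=> a b lta ltb ab; apply: mdot_spec_mu; apply: relM.
    exact: (unrelated_coincidence ux).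
  - by move=> j; apply: Gp; apply: group_expmx.
by case: nvs => A x GA Ax; rewrite -(psE _ _ Ax) ps0.
Qed.

(** * Elements of the Lie algebra with prescribed spectrum *)

Lemma hermite_constants (k : fieldType) (m : nat) (s : seq k) (c : k -> k) :
  uniq s -> s != [::] ->
  exists f : {poly k}, forall a, a \in s -> ('X - a%:P) ^+ m %| f - (c a)%:P.
Proof.
move=> us ns; have [e [e1 e2]] := bezout_idempotents m us ns.
exists (\sum_(b <- s) c b *: e b) => a as_.
have -> : (c a)%:P = \sum_(b <- s) c a *: e b.
  by rewrite -scaler_sumr e1 alg_polyC.
rewrite -sumrB big_seq; apply: (big_ind (fun p => ('X - a%:P) ^+ m %| p)); first exact: dvdp0.
  by move=> p q; apply: dvdp_add.
move=> b bs; rewrite -scalerBl.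
have [-> | nba] := eqVneq b a; first by rewrite subrr scale0r dvdp0.
rewrite -mul_polyC; apply: dvdp_mull.
have co : coprimep (('X - a%:P) ^+ m) (('X - b%:P) ^+ m).
  by rewrite coprimep_expl // coprimep_expr // coprimep_XsubC root_XsubC.
rewrite -(Gauss_dvdpl _ co); apply: dvdp_trans (e2 _ bs).
by rewrite (bigD1_seq a) //= dvdp_mulIl.
Qed.

Section GoodPoint.
Variables (k : closedFieldType) (n : nat) (G : 'M[k]_n.+1 -> Prop).
Variable Q : {mpoly k[n.+1]} -> Prop.
Hypotheses (char0 : [pchar k] =i pred0) (algG : linear_algebraic_group G).
Hypothesis spQ : spectral_prime G Q.
Let G1 : G 1%:M := lag_one algG.

(** Finitely many equations have a common degree bound, so one generic element of [G] can serve for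
    all of them. *)
Lemma lie_algebra_finite : exists ps : seq {mpoly k[n.+1 * n.+1]},
  (forall p, p \in ps -> vanishes_on G p) /\
  forall X, (forall p, p \in ps -> mxdiff p 1%:M X = 0) -> lie_algebra G X.
Proof.
pose grad (p : {mpoly k[n.+1 * n.+1]}) : 'rV[k]_(n.+1 * n.+1) :=
  \row_l mxeval (mderiv l p) 1%:M.
have gradE p X : mxdiff p 1%:M X = (grad p *m (mxvec X)^T) 0 0.
  rewrite mxE big_mxvec; apply: eq_bigr => i _; apply: eq_bigr => j _.
  by rewrite !mxE mxvecE.
have [m [V [PV spanV]]] := finite_span (fun u => exists p, vanishes_on G p /\ u = grad p).
pose P i := sval (constructive_indefinite_description _ (PV i)).
have PP i : vanishes_on G (P i) /\ row i V = grad (P i).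
  exact: (svalP (constructive_indefinite_description _ (PV i))).
exists [seq P i | i <- enum 'I_m]; split=> [p /mapP [i _ ->]|X PX p Gp]; first by case: (PP i).
have /submxP [C pE] : (grad p <= V)%MS by apply: spanV; exists p.
have VX : V *m (mxvec X)^T = 0.
  apply/row_matrixP => i; rewrite row_mul (PP i).2 row0; apply/matrixP => a b.
  by rewrite !ord1 -gradE mxE; apply: PX; apply/mapP; exists i; rewrite ?mem_enum.
by rewrite gradE pE -mulmxA VX mulmx0 mxE.
Qed.

(** A dual vector [x 0] separating the unrelated monomials of [s] is realized as the spectrum of
    [f (A)] for a generic [A] in [G], where [f] interpolates constants. [mxdiff_interpolation] with
    [c = 0] puts [f (A)] in the Lie algebra. *)
Lemma spectral_good_point (s : {mpoly k[n.+1]}) : ~ Q s ->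
  exists X x N, [/\ lie_algebra G X, eigenvalues X x & ~~ ('X^N %| mmap (@polyC k) (vexp N x) s)].
Proof.
move=> nQs; have [x dx sepx] := mrel_dual_separates char0 G1 spQ (msupp s).
have [N sN] := spectral_exp_nonzero char0 spQ nQs sepx.
have [ps [psG psP]] := lie_algebra_finite.
(* The summand 2 includes the monomials of degree one, so that [y i = y j] forces equality of the
   corresponding entries of [x 0]. *)
pose b := (\max_(p <- ps) msize p + 2)%N.
have nu := @unrelated_notin _ _ _ _ char0 algG spQ b.
have [A [y [GA Ay Qy uy]]] := spectral_generic_point char0 spQ nu.
have uA := lag_unitmx algG GA.
have nz i : y i != 0 by apply: eigenvalues_root Ay.
pose l := undup [seq y i | i <- enum 'I_n.+1].
have yl i : y i \in l by rewrite mem_undup map_f // mem_enum.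
pose c a := if [pick i | y i == a] is Some i then x 0 i else 0.
have cE i : c (y i) = x 0 i.
  rewrite /c; case: pickP => [j /eqP yji | /(_ i)]; last by rewrite eqxx.
  rewrite -(mdotU i (x 0)) -(mdotU j (x 0)); apply: dx.
  by apply: (unrelated_coincidence uy); rewrite ?mdeg1 ?mevalXU // /b addn2.
have [||f fP] := @hermite_constants k n.+1 l c.
- exact: undup_uniq.
- by apply/eqP => l0; have := yl 0; rewrite l0.
pose X := horner_mx A f.
have fy i : f.[y i] = x 0 i.
  have /(dvdp_trans (dvdp_exp2l _ (ltn0Sn n))) := fP _ (yl i).
  rewrite expr1 dvdp_XsubCl /root hornerD hornerN hornerC cE subr_eq0.
  by move/eqP.
exists X, (x 0), N; split=> //.
  apply: psP => p pps.
  have leb : (msize p <= b)%N.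
    by apply: leq_trans (leq_addr _ _); apply: (@leq_bigmax_seq _ ps xpredT (fun p => msize p)).
  apply: (mxdiff_interpolation (mu := x 0) (c := 0) char0 Ay nz).
  - by move=> i; rewrite scale0r subr0 -cE; apply: fP.
  - move=> a d lta ltd ad; apply: dx; apply: (unrelated_coincidence uy) ad.
      exact: leq_trans lta leb.
    exact: leq_trans ltd leb.
  - by move=> j; apply: psG => //; apply: group_expmx.
have := eigenvalues_horner (idfun : {rmorphism k -> k}) f Ay.
rewrite map_mx_id // /eigenvalues => ->.
by apply: eq_bigr => i _; rewrite /= fy.
Qed.

End GoodPoint.

(** * Value of the covariant on formal exponentials *)

Definition mxO (k : fieldType) (n m : nat) (A : 'M[{poly k}]_n) : Prop :=
  exists K, A = 'X^m *: K.

Section MatrixOrder.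
Variables (k : fieldType) (n m : nat).
Implicit Types A B : 'M[{poly k}]_n.

Lemma mxO_intro A : (forall i j, 'X^m %| A i j) -> mxO m A.
Proof.
move=> dA; exists (\matrix_(i, j) (A i j %/ 'X^m)); apply/matrixP => i j.
by rewrite !mxE mulrC divpK.
Qed.

Lemma mxO_add A B : mxO m A -> mxO m B -> mxO m (A + B).
Proof. by case=> K -> [L ->]; exists (K + L); rewrite scalerDr. Qed.

Lemma mxO_sum (I : Type) (r : seq I) (P : pred I) (F : I -> 'M[{poly k}]_n) :
  (forall i, P i -> mxO m (F i)) -> mxO m (\sum_(i <- r | P i) F i).
Proof.
move=> PF; apply: (big_ind (@mxO k n m)) => //; last exact: mxO_add.
by exists 0; rewrite scaler0.
Qed.

Lemma mxO_scale a A : mxO m A -> mxO m (a *: A).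
Proof. by case=> K ->; exists (a *: K); rewrite !scalerA mulrC. Qed.

Lemma mxO_mull A B : mxO m B -> mxO m (A *m B).
Proof. by case=> K ->; exists (A *m K); rewrite scalemxAr. Qed.

Lemma mxO_X A : mxO m ('X^m *: A).
Proof. by exists A. Qed.

End MatrixOrder.

Section FormalValue.
Variables (k : closedFieldType) (n : nat) (X : 'M[k]_n.+1) (x : 'I_n.+1 -> k) (N : nat).
Hypotheses (char0 : [pchar k] =i pred0) (Xx : eigenvalues X x).
Hypothesis N2 : (1 < N)%N.
Let E := mxexp N X.
Let v := vexp N x.
Local Notation hv := (mmap (@polyC k) v).
Local Notation Xp := (map_mx (@polyC k) X).
Local Notation Theta := (horner_mx Xp).

Lemma vexp_order2 i : 'X^2 %| v i - 1 - 'X * (x i)%:P.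
Proof.
apply/Xn_dvdP => m ltm; rewrite !coefB coef_vexp coef1 coefXM coefC (leq_trans ltm N2).
case: m ltm => [|[|m]] // _; first by rewrite fact0 invr1 mulr1 !subrr.
by rewrite expr1 /= invr1 mul1r subr0 subrr.
Qed.

Lemma vexp_order1 i : 'X %| v i - 1.
Proof.
apply: (dvdp_congr (b := 'X * (x i)%:P)); first exact: dvdp_mulIl.
by apply: dvdp_trans (vexp_order2 i); rewrite exprS dvdp_mulIl.
Qed.

Lemma prod_order1 (I : finType) (P : pred I) (F : I -> {poly k}) :
  (forall i, 'X %| F i - 1) -> 'X %| \prod_(i | P i) F i - 1.
Proof.
move=> F1; apply: (big_ind (fun p => 'X %| p - 1)) => // [|p q p1 q1].
  by rewrite subrr dvdp0.
by rewrite -[1 in X in _ %| X]mulr1; apply: dvdp_congrM.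
Qed.

Lemma exp_order1 (p : {poly k}) m : 'X %| p - 1 -> 'X %| p ^+ m - 1.
Proof.
move=> p1; have -> : p ^+ m - 1 = p ^+ m - 1 ^+ m by rewrite expr1n.
by rewrite subrXX dvdp_mulr.
Qed.

Lemma spec_det_order1 : 'X %| hv (spec_det k n.+1) - 1.
Proof.
rewrite rmorph_prod /=; apply: prod_order1 => i.
by rewrite mmapX mmap1U; apply: vexp_order1.
Qed.

Lemma spec_codet_order1 i : 'X %| hv (spec_codet k i) - 1.
Proof.
rewrite rmorph_prod /=; apply: prod_order1 => j.
by rewrite mmapX mmap1U; apply: vexp_order1.
Qed.

Lemma spec_weight_order2 (M : 'M[k]_n.+1) i : (forall i, \sum_j M i j * x j = x i) ->
  'X^2 %| hv (spec_det k n.+1 ^+ n.+1 * spec_weight M i) - 'X * (x i)%:P.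
Proof.
move=> Mx; have w2 : 'X^2 %| hv (spec_weight M i) - 'X * (x i)%:P.
  have -> : 'X * (x i)%:P = \sum_j (M i j)%:P * ('X * (x j)%:P) :> {poly k}.
    rewrite -(Mx i) rmorph_sum mulr_sumr; apply: eq_bigr => j _ /=.
    by rewrite polyCM mulrCA.
  rewrite rmorph_sum -sumrB; apply: dvdp_sum => j /=.
  rewrite rmorphM rmorphB /= mmapC rmorph1 mmapX mmap1U -mulrBr; apply: dvdp_mull.
  exact: vexp_order2.
have d1 : 'X %| hv (spec_det k n.+1 ^+ n.+1) - 1.
  by rewrite rmorphXn; apply: exp_order1; apply: spec_det_order1.
rewrite rmorphM /=; set d := hv _ in d1 *; set w := hv _ in w2 *.
have -> : d * w - 'X * (x i)%:P = d * (w - 'X * (x i)%:P) + (d - 1) * ('X * (x i)%:P) by ring.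
apply: dvdp_add; first exact: dvdp_mull.
by rewrite mulrA dvdp_mulr // expr2 dvdp_mul.
Qed.

Lemma mxexp_order i : exists B, E - (v i)%:M = 'X *: B /\ mxO 1 (B - (Xp - (x i)%:P%:M)).
Proof.
have [K KE] : mxO 2 (E - (v i)%:M - 'X *: (Xp - (x i)%:P%:M)).
  apply: mxO_intro => a b; apply/Xn_dvdP => m ltm; rewrite !mxE mulrBr !coefB !coefXM.
  rewrite mxexp_entry !coefMn coef_vexp (leq_trans ltm N2).
  case: m ltm => [|[|m]] // _.
    by rewrite /= fact0 invr1 !mulr1 expr0 mul1r mxE !subr0 subrr.
  by rewrite /= ?invr1 ?mul1r ?expr1 !coefC /= subrr.
exists (Xp - (x i)%:P%:M + 'X *: K); split; last by rewrite addrAC subrr add0r; exists K.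
by rewrite scalerDr scalerA -expr2 -KE [RHS]addrC subrK.
Qed.

(** To first order the weight contributes [t * x i] and the linear term of the logarithm contributes
    [t * (X - x i)]; together they make [tX]. The other terms of the logarithm have order at least
    two. *)
Lemma horner_spec_target (M : 'M[k]_n.+1) i : (forall i, \sum_j M i j * x j = x i) ->
  mxO 2 (horner_mx E (map_poly hv (spec_target M i)) - 'X *: Xp).
Proof.
move=> Mx; have [B [EB [K BK]]] := mxexp_order i.
have hE : horner_mx E ('X - (v i)%:P) = 'X *: B by rewrite rmorphB /= horner_mx_X horner_mx_C EB.
have logE : horner_mx E (map_poly hv (spec_log k i)) = \sum_(l < n.+1)
    hv (((- 1) ^+ l / l.+1%:R)%:MP * spec_det k n.+1 ^+ (n.+1 - l.+1) * spec_codet k i ^+ l.+1)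
      *: ('X *: B) ^+ l.+1.
  rewrite /spec_log !rmorph_sum; apply: eq_bigr => l _ /=.
  rewrite map_polyZ linearZ /= !rmorphXn /= -hE; congr (_ *: horner_mx E _ ^+ _).
  by rewrite rmorphB /= map_polyX map_polyC /= mmapX mmap1U.
have -> : horner_mx E (map_poly hv (spec_target M i)) =
    (hv (spec_det k n.+1 ^+ n.+1 * spec_weight M i))%:M +
      horner_mx E (map_poly hv (spec_log k i)).
  by rewrite /spec_target rmorphD /= map_polyC rmorphD /= horner_mx_C.
rewrite {}logE big_ord_recl; set w := hv _; set coef0 := hv _; set R := \sum_(l < n) _.
have w2 : mxO 2 ((w - 'X * (x i)%:P)%:M : 'M_n.+1).
  apply: mxO_intro => a b; rewrite mxE; case: (a == b); rewrite ?mulr1n ?mulr0n ?dvdp0 //.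
  exact: spec_weight_order2.
have R2 : mxO 2 R.
  apply: mxO_sum => l _; apply: mxO_scale; rewrite exprZn lift0.
  by exists ('X ^+ l *: B ^+ l.+2); rewrite scalerA -exprD.
have c1 : 'X %| coef0 - 1.
  rewrite /coef0 /= expr0 divr1 mpolyC1 mul1r expr1 rmorphM rmorphXn /=.
  rewrite -[1 in X in _ %| X]mulr1; apply: dvdp_congrM; last exact: spec_codet_order1.
  by apply: exp_order1; apply: spec_det_order1.
have {c1} [c cE] : exists c, coef0 = 1 + 'X * c.
  by case/dvdpP: c1 => c cE; exists c; rewrite mulrC -cE addrC subrK.
have BE : B = Xp - (x i)%:P%:M + 'X^1 *: K by rewrite -BK addrC subrK.
have -> : w%:M + (coef0 *: ('X *: B) ^+ 1 + R) - 'X *: Xp =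
    (w - 'X * (x i)%:P)%:M + ('X^2 *: (K + c *: B) + R).
  move: R {R2} => R; rewrite expr1 cE; apply/matrixP => a b.
  have := congr1 (fun A : 'M_n.+1 => A a b) BE; rewrite !mxE => ->.
  by case: (a == b); rewrite ?mulr1n ?mulr0n; ring.
by apply: mxO_add => //; apply: mxO_add => //; apply: mxO_X.
Qed.

Lemma horner_mx_dvd (d : {poly k}) m (p : {poly {poly k}}) : d = 'X^m ->
  (forall l, d %| p`_l) -> mxO m (horner_mx E p).
Proof.
move=> -> dp; have -> : p = ('X^m)%:P * map_poly (fun q => q %/ 'X^m) p.
  by apply/polyP => l; rewrite coefCM coef_map_id0 ?div0p // mulrC divpK.
by rewrite rmorphM /= horner_mx_C -mulmxE mul_scalar_mx; apply: mxO_X.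
Qed.

(** In the outer variable, [exp (tX) - exp (t x_i)] is divisible by [X - x_i], so its power of
    exponent [n.+1] vanishes on the generalized eigenspace of [x i]. *)
Lemma idempotent_kills (e : {poly k}) i (r : {poly {poly k}}) :
  horner_mx X (e * ('X - (x i)%:P) ^+ n.+1) = 0 ->
  map_mx (@polyC k) (horner_mx X e) *m horner_mx E (('X - (v i)%:P) ^+ n.+1 * r) = 0.
Proof.
move=> eX.
have ThetaC (p : {poly k}) : Theta (map_poly (@polyC k) p) = map_mx (@polyC k) (horner_mx X p).
  by rewrite map_horner_mx.
have [H HE] : exists H, expP k N - (v i)%:P = H * ('X - ((x i)%:P)%:P).
  by apply/factor_theorem; rewrite /root hornerD hornerN hornerC subrr.
have hE : horner_mx E ('X - (v i)%:P) = Theta (H * ('X - ((x i)%:P)%:P)).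
  by rewrite -HE !rmorphB /= horner_mx_X !horner_mx_C.
rewrite rmorphM rmorphXn /= hE -rmorphXn /= -ThetaC mulmxE mulrA -rmorphM /=.
have -> : map_poly (@polyC k) e * (H * ('X - ((x i)%:P)%:P)) ^+ n.+1 =
    map_poly (@polyC k) (e * ('X - (x i)%:P) ^+ n.+1) * H ^+ n.+1.
  rewrite rmorphM rmorphXn rmorphB /= map_polyX map_polyC /= exprMn; ring.
by rewrite rmorphM /= ThetaC eX map_mx0 mul0r mul0r.
Qed.

(** [nearF] is local at an eigenvalue; the idempotents of [X], which are constant in [t], glue the
    local values. Elements of [Q] contribute only to order [N]. *)
Lemma formal_value (Q : {mpoly k[n.+1]} -> Prop) F c (M : 'M[k]_n.+1) :
  (forall q, Q q -> 'X^N %| hv q) ->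
  (forall i, near Q i (F - c *: spec_target M i)) ->
  (forall i, \sum_j M i j * x j = x i) ->
  exists Y, mxO N (horner_mx E (map_poly hv F) - hv c *: ('X *: Xp + 'X^2 *: Y)).
Proof.
move=> Qv nearF Mx; have [e [e1 e2]] := spectral_idempotents char0 Xx.
pose ee i := map_mx (@polyC k) (horner_mx X (e i)).
have ee1 : \sum_i ee i = 1%:M.
  by rewrite -raddf_sum -rmorph_sum e1 rmorph1 /= (map_mx1 (@polyC k)).
have dec (A : 'M[{poly k}]_n.+1) : A = \sum_i ee i *m A by rewrite -mulmx_suml ee1 mul1mx.
have YP i : {Y | horner_mx E (map_poly hv (spec_target M i)) = 'X *: Xp + 'X^2 *: Y}.
  apply: constructive_indefinite_description.
  have [Y YE] := horner_spec_target i Mx.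
  by exists Y; rewrite -YE [RHS]addrC subrK.
pose Y i := sval (YP i); exists (\sum_i ee i *m Y i).
have -> : 'X *: Xp + 'X^2 *: (\sum_i ee i *m Y i) =
    \sum_i ee i *m horner_mx E (map_poly hv (spec_target M i)).
  rewrite {1}[Xp]dec !scaler_sumr -big_split; apply: eq_bigr => i _ /=.
  by rewrite (svalP (YP i)) mulmxDr -!scalemxAr.
rewrite {1}[horner_mx _ _]dec scaler_sumr -sumrB; apply: mxO_sum => i _.
rewrite scalemxAr -mulmxBr; have [r rP] := nearF i.
set K := F - _ - _ in rP.
have -> : horner_mx E (map_poly hv F) - hv c *: horner_mx E (map_poly hv (spec_target M i)) =
    horner_mx E (('X - (v i)%:P) ^+ n.+1 * map_poly hv r) + horner_mx E (map_poly hv K).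
  rewrite -linearZ /= -rmorphB -rmorphD /=; congr (horner_mx E _).
  rewrite /K !rmorphB /= rmorphM rmorphXn rmorphB /= map_polyZ map_polyX map_polyC /=.
  rewrite mmapX mmap1U.
  by rewrite [RHS]addrC subrK.
rewrite mulmxDr idempotent_kills // add0r; apply: mxO_mull.
by apply: (horner_mx_dvd erefl) => l; rewrite coef_map; apply: Qv; apply: rP.
Qed.

End FormalValue.

Lemma Xn_ndvd_order (k : fieldType) (N : nat) (p : {poly k}) : ~~ ('X^N %| p) ->
  exists e u, [/\ (e < N)%N, p = 'X^e * u & u.[0] != 0].
Proof.
elim: N p => [|N IHN] p; first by rewrite expr0 dvd1p.
have [p0 | np0] := eqVneq p.[0] 0; last by exists 0%N, p; rewrite expr0 mul1r.
have /factor_theorem [r ->] : root p 0 by rewrite /root p0.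
rewrite subr0 exprSr dvdp_mul2r ?polyX_eq0 // => /IHN [e [u [lte -> u0]]].
by exists e.+1, u; rewrite exprSr mulrAC.
Qed.

(** * Dominance *)

(** Its coefficient of degree [j] is the value at [X] of the homogeneous part of degree [j] of
    [q]. *)
Definition ray (k : comNzRingType) (n : nat) (q : {mpoly k[n * n]}) (X : 'M[k]_n) : {poly k} :=
  mxmap (@polyC k) ('X *: map_mx (@polyC k) X) q.

Lemma mmap_family (k : comNzRingType) (n : nat) (B : 'M[{poly {poly k}}]_n)
    (q : {mpoly k[n * n]}) a :
  map_poly (horner_eval a) (mxmap (@polyC {poly k} \o @polyC k) B q) =
  mxmap (@polyC k) (map_mx (map_poly (horner_eval a)) B) q.
Proof.
have := rmorph_mmap (@polyC {poly k} \o @polyC k) (fun l => mxvec B 0 l)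
  (map_poly (horner_eval a)) q; rewrite /= => ->.
transitivity (mmap (@polyC k) (map_poly (horner_eval a) \o (fun l => mxvec B 0 l)) q).
  by apply: eq_bigr => m _; congr (_ * _); rewrite /= map_polyC /= /horner_eval hornerC.
by apply: eq_mmap => l /=; rewrite -map_mxvec [RHS]mxE.
Qed.

Lemma ray_family (k : comNzRingType) (n : nat) (q : {mpoly k[n * n]}) (W : 'M[{poly k}]_n) a :
  map_poly (horner_eval a)
    (mxmap (@polyC {poly k} \o @polyC k) ('X *: map_mx (@polyC {poly k}) W) q) =
  ray q (map_mx (horner_eval a) W).
Proof.
rewrite mmap_family /ray.
have -> // : map_mx (map_poly (horner_eval a)) ('X *: map_mx (@polyC {poly k}) W) =
  'X *: map_mx (@polyC k) (map_mx (horner_eval a) W).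
by apply/matrixP => i j; rewrite !mxE rmorphM /= map_polyX map_polyC.
Qed.

Lemma coef_ray_scale (k : comNzRingType) (n : nat) (q : {mpoly k[n * n]}) (X : 'M[k]_n) u d :
  (ray q (u *: X))`_d = u ^+ d * (ray q X)`_d.
Proof.
have -> : ray q (u *: X) = ray q X \Po (u *: 'X).
  have := rmorph_mmap (@polyC k) (fun l => mxvec ('X *: map_mx (@polyC k) X) 0 l)
    (comp_poly (u *: 'X)) q; rewrite /= => ->.
  rewrite /ray; transitivity (mmap (@polyC k)
      (comp_poly (u *: 'X) \o (fun l => mxvec ('X *: map_mx (@polyC k) X) 0 l)) q).
    apply: eq_mmap => l; case/mxvec_indexP: l => i j; rewrite /= !mxvecE !mxE.
    by rewrite comp_polyM comp_polyX comp_polyC polyCM -mul_polyC; ring.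
  by apply: eq_bigr => m _; congr (_ * _); rewrite /= comp_polyC.
rewrite comp_polyE coef_sum; under eq_bigr do rewrite exprZn !coefZ coefXn.
have [ltd | led] := ltnP d (size (ray q X)).
  rewrite (bigD1 (Ordinal ltd)) //= eqxx mulr1 big1 ?addr0 1?mulrC // => i ni.
  by rewrite -val_eqE /= eq_sym in ni; rewrite (negPf ni) !mulr0.
rewrite nth_default // mulr0 big1 // => i _.
by rewrite (gtn_eqF (leq_trans (ltn_ord i) led)) !mulr0.
Qed.

(* Along [t ^ m * W (t)] with [W] in [g], the homogeneous part of degree [d] of [q]
   contributes the coefficient of [t ^ (m * d)], and the higher ones do not. *)
Lemma lowest_part_vanishes (k : fieldType) (n : nat) (g : 'M[k]_n -> Prop)
    (q : {mpoly k[n * n]}) (d m N : nat) (W : 'M[{poly k}]_n) :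
  [pchar k] =i pred0 -> (forall X, g X -> forall j, (j < d)%N -> (ray q X)`_j = 0) ->
  (forall a, g (map_mx (horner_eval a) W)) -> (0 < m)%N -> (m * d < N)%N ->
  'X^N %| mxmap (@polyC k) ('X^m *: W) q ->
  (ray q (map_mx (horner_eval 0) W))`_d = 0.
Proof.
move=> char0 low gW m0 ltN dvd.
pose H := mxmap (@polyC {poly k} \o @polyC k) ('X *: map_mx (@polyC {poly k}) W) q.
have HE a j : (H`_j).[a] = (ray q (map_mx (horner_eval a) W))`_j.
  by rewrite -ray_family coef_map.
have H0 j : (j < d)%N -> H`_j = 0.
  move=> ltj; apply: (poly_nat_roots_eq0 char0) => a; rewrite HE.
  by apply: low ltj; apply: gW.
have HX : H.['X^m] = mxmap (@polyC k) ('X^m *: W) q.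
  have := rmorph_mmap (@polyC {poly k} \o @polyC k)
    (fun l => mxvec ('X *: map_mx (@polyC {poly k}) W) 0 l) (horner_eval 'X^m) q.
  rewrite /= {1}/horner_eval -/H => ->.
  transitivity (mmap (@polyC k)
    (horner_eval 'X^m \o (fun l => mxvec ('X *: map_mx (@polyC {poly k}) W) 0 l)) q).
    by apply: eq_bigr => b _; congr (_ * _); rewrite /= /horner_eval hornerC.
  apply: eq_mmap => l; case/mxvec_indexP: l => i j.
  by rewrite /= /horner_eval !mxvecE !mxE hornerM hornerX hornerC.
rewrite -HE horner_coef0; move/Xn_dvdP/(_ _ ltN): dvd; rewrite -HX horner_coef coef_sum => E.
have [ltd | led] := ltnP d (size H); last by rewrite [H`_d]nth_default ?coef0.
rewrite -[RHS]E (bigD1 (Ordinal ltd)) //= big1 => [|j nj].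
  by rewrite -exprM coefMXn ltnn subnn addr0.
rewrite -exprM coefMXn ltn_mul2l m0 /=; case: ltnP => // lejd.
rewrite H0 ?coef0 // ltn_neqAle lejd andbT.
by rewrite -val_eqE in nj.
Qed.

Section Dominance.
Variables (k : closedFieldType) (n : nat) (G : 'M[k]_n.+1 -> Prop).
Variable Q : {mpoly k[n.+1]} -> Prop.
Hypotheses (char0 : [pchar k] =i pred0) (algG : linear_algebraic_group G).
Hypotheses (irrG : irreducible_set G) (spQ : spectral_prime G Q).
Variables (F : {poly {mpoly k[n.+1]}}) (c : {mpoly k[n.+1]}) (M : 'M[k]_n.+1).
Variable Phi : 'M[{mpoly k[n.+1 * n.+1]}]_n.+1.
Hypotheses (symc : c \is symmetric) (nQc : ~ Q c).
Hypothesis relM : forall a b, mrel Q a b -> forall l, mdot a (M^~ l) = mdot b (M^~ l).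
Hypothesis dualM : forall x, mrel_dual Q x -> forall i, \sum_j M i j * x 0 j = x 0 i.
Hypothesis nearF : forall i, near Q i (F - c *: spec_target M i).
Hypothesis PhiE : forall (S : idomainType) (h : {rmorphism k -> S}) (A : 'M[S]_n.+1) x,
  eigenvalues A x -> map_mx (mxmap h A) Phi = horner_mx A (map_poly (mmap h x) F).

Lemma mxdiff_linear (p : {mpoly k[n.+1 * n.+1]}) (A : 'M[k]_n.+1) a X Y :
  mxdiff p A (a *: X + Y) = a * mxdiff p A X + mxdiff p A Y.
Proof.
rewrite /mxdiff mulr_sumr -big_split; apply: eq_bigr => i _ /=.
rewrite mulr_sumr -big_split; apply: eq_bigr => j _ /=.
by rewrite !mxE; ring.
Qed.

Lemma lie_algebra_subspace : is_subspace (lie_algebra G).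
Proof.
split=> [p Gp|a X Y gX gY p Gp]; last by rewrite mxdiff_linear gX // gY // mulr0 addr0.
by rewrite /mxdiff big1 // => i _; rewrite big1 // => j _; rewrite mxE mulr0.
Qed.

Lemma spectral_point_dual x :
  (forall q, Q q -> forall N, 'X^N %| mmap (@polyC k) (vexp N x) q) ->
  mrel_dual Q (\row_i x i).
Proof.
move=> Qx a b ab; have E d : mdot d ((\row_i x i) 0) = mdot d x.
  by apply: eq_bigr => i _; rewrite mxE.
have /Xn_dvdP /(_ 1%N isT) := Qx _ ab 2; rewrite mmapB coefB !E.
have mon d : (mmap (@polyC k) (vexp 2 x) 'X_[d])`_1 = mdot d x.
  have /Xn_dvdP /(_ 1%N isT) := @mmap_vexp_monomial k 2 char0 _ x d.
  rewrite coefB => /eqP; rewrite subr_eq0 => /eqP ->.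
  by rewrite coef_expP_eval /= invr1 mul1r.
by rewrite !mon => /eqP; rewrite subr_eq0 => /eqP.
Qed.

Lemma phi_formal X : lie_algebra G X ->
  exists2 x, eigenvalues X x & forall N, (1 < N)%N -> exists Y K,
    map_mx (mxmap (@polyC k) (mxexp N X)) Phi =
      mmap (@polyC k) (vexp N x) c *: ('X *: map_mx (@polyC k) X + 'X^2 *: Y) + 'X^N *: K.
Proof.
move=> gX; have [x Xx Qx] := spectral_formal_point char0 algG spQ gX.
exists x => // N N2.
have Mx i : \sum_j M i j * x j = x i.
  have := dualM (spectral_point_dual Qx) i; rewrite mxE => <-.
  by apply: eq_bigr => j _; rewrite mxE.
have [Y [K KE]] := formal_value char0 Xx N2 (fun q Qq => Qx q Qq N) nearF Mx.
by exists Y, K; rewrite (PhiE _ (eigenvalues_mxexp N Xx)) -KE [RHS]addrC subrK.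
Qed.

(** If [c] has order [e] along [exp (tX)], the morphism takes there the value [t ^ (e + 1) * W],
    with [W] starting at a nonzero multiple of [X], and [lowest_part_vanishes] applies. *)
Lemma low_part_good (q : {mpoly k[n.+1 * n.+1]}) d X N0 :
  vanishes_on G (mxcomp q Phi) ->
  (forall X, lie_algebra G X -> forall j, (j < d)%N -> (ray q X)`_j = 0) ->
  lie_algebra G X ->
  (forall x, eigenvalues X x -> ~~ ('X^N0 %| mmap (@polyC k) (vexp N0 x) c)) ->
  (ray q X)`_d = 0.
Proof.
move=> Gq low gX good; have [x Xx xP] := phi_formal gX.
(* [N] must exceed [(e + 1) * d], the degree in [t] at which the part of degree [d] is read, and is
   fixed when only [e < N0] can be expected of [e]. The other summands ensure [e + 1 < N] and
   [1 < N]. *)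
pose N := (N0 * d + N0 + 2)%N.
have N2 : (1 < N)%N by rewrite /N addn2.
have leN0N : (N0 <= N)%N by rewrite /N -addnA addnCA leq_addr.
have [Y [K WE]] := xP N N2.
have nd : ~~ ('X^N0 %| mmap (@polyC k) (vexp N x) c).
  apply: contra (good x Xx) => dN; apply: dvdp_congr dN _; apply: mmap_congr => i.
  by rewrite -opprB dvdpNr; apply: vexp_congr.
have [e [u [lte cE u0]]] := Xn_ndvd_order nd.
pose r := (N - e.+1)%N.
have leeN : (e.+1 <= N)%N by apply: leq_trans lte leN0N.
have r0 : (0 < r)%N.
  by rewrite /r subn_gt0; apply: leq_ltn_trans lte _; rewrite /N addn2 ltnS leqW // leq_addl.
pose W := u *: (map_mx (@polyC k) X + 'X *: Y) + 'X^r *: K.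
have WE' : map_mx (mxmap (@polyC k) (mxexp N X)) Phi = 'X^(e.+1) *: W.
  rewrite WE cE /W [RHS]scalerDr [X in _ = _ + X]scalerA -exprD subnKC //; congr (_ + _).
  apply/matrixP => i j; rewrite !mxE (exprS 'X e); ring.
(* The linear equations of the Lie algebra hold for [W] only modulo [t ^ r]. Truncation makes them
   exact, so that [W2] takes values in the Lie algebra at every [a]. *)
pose W2 := map_mx (take_poly r) W.
have W20 : map_mx (horner_eval 0) W2 = u.[0] *: X.
  apply/matrixP => i j; rewrite !mxE /horner_eval horner_coef0 coef_take_poly r0 coefD.
  by rewrite coefXnM r0 addr0 coef0M coefD coefC coefXM addr0 horner_coef0.
have gW2 a : lie_algebra G (map_mx (horner_eval a) W2).
  move=> p Gp; have Glin : vanishes_on G (lin_form p Phi).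
    apply: (covariant_in_lie char0 algG irrG spQ relM nearF _ Gp) => A y Ay.
    exact: (PhiE idfun).
  have := vanish_mxexp N char0 algG gX Glin; rewrite mmap_lin_form WE'.
  pose S := \sum_i \sum_j (mxeval (mderiv (mxvec_index i j) p) 1%:M)%:P * W i j.
  have -> : \sum_i \sum_j (mxeval (mderiv (mxvec_index i j) p) 1%:M)%:P * ('X^(e.+1) *: W) i j =
      'X^(e.+1) * S.
    rewrite mulr_sumr; apply: eq_bigr => i _; rewrite mulr_sumr; apply: eq_bigr => j _.
    by rewrite mxE mulrCA.
  rewrite -(subnKC leeN) exprD dvdp_mul2l ?expf_neq0 ?polyX_eq0 // -/r => /Xn_dvdP Sr.
  have S0 : take_poly r S = 0.
    by apply/polyP => i; rewrite coef_take_poly coef0; case: ltnP => // /Sr.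
  rewrite -[RHS](horner0 a) -S0 /S !raddf_sum horner_sum; apply: eq_bigr => i _ /=.
  rewrite raddf_sum horner_sum; apply: eq_bigr => j _ /=.
  by rewrite mul_polyC linearZ /= hornerZ !mxE.
have m0 : (0 < e.+1)%N by [].
have ltN : (e.+1 * d < N)%N.
  rewrite /N -addnA; apply: leq_ltn_trans (leq_mul lte (leqnn d)) _.
  by rewrite -addn1 leq_add2l addn2.
have dvd : 'X^N %| mxmap (@polyC k) ('X^(e.+1) *: W2) q.
  have := vanish_mxexp N char0 algG gX Gq; rewrite mmap_mxcomp WE' => dW.
  apply: dvdp_congr dW _; apply: mmap_congr => l; case/mxvec_indexP: l => i j.
  rewrite !mxvecE [(_ *: W) i j]mxE [(_ *: W2) i j]mxE [W2 i j]mxE -mulrBr.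
  rewrite -(subnKC leeN) exprD; apply: dvdp_mul => //.
  by rewrite -/r -{2}(poly_take_drop r (W i j)) opprD addrA subrr sub0r dvdpNr dvdp_mulIr.
have := lowest_part_vanishes char0 low gW2 m0 ltN dvd.
rewrite W20 coef_ray_scale => /eqP; rewrite mulf_eq0 expf_eq0 (negPf u0) andbF.
by move/eqP.
Qed.

(** Let [d] be the least degree in which [q] has a nonzero homogeneous part on the Lie algebra, say
    at [X1]. On the line from a good element [X0] to [X1], the polynomial [al] giving this part
    vanishes wherever [be], which detects goodness, does not. As [be] is nonzero at [X0], [al] is
    zero, a contradiction at [X1]. *)
Lemma vanishing_on_lie (q : {mpoly k[n.+1 * n.+1]}) :
  vanishes_on G (mxcomp q Phi) -> forall X, lie_algebra G X -> mxeval q X = 0.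
Proof.
move=> Gq X gX; apply/eqP; apply: contraT => qX.
have ray1 (Y : 'M[k]_n.+1) : (ray q Y).[1] = mxeval q Y.
  rewrite horner_mmap /mxeval; apply: meval_eq => l; case/mxvec_indexP: l => i j.
  by rewrite !mxvecE !mxE hornerM hornerX hornerC mul1r.
pose D d := propb (exists2 X, lie_algebra G X & (ray q X)`_d != 0).
have exD : exists d, D d.
  have nz : ray q X != 0 by apply: contraNneq qX => r0; rewrite -ray1 r0 horner0.
  exists (size (ray q X)).-1; apply/propbP; exists X => //.
  by rewrite -lead_coefE lead_coef_eq0.
have [d /propbP [X1 gX1 nzX1] dmin] := ex_minnP exD.
have low Y : lie_algebra G Y -> forall j, (j < d)%N -> (ray q Y)`_j = 0.
  move=> gY j ltj; apply/eqP; apply: contraLR ltj => nz; rewrite -leqNgt; apply: dmin.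
  by apply/propbP; exists Y.
have [X0 [x0 [N0 [gX0 Xx0 good0]]]] := spectral_good_point char0 algG spQ nQc.
have [cm cmE] := sym_mxpoly symc.
have good (Y : 'M[k]_n.+1) : lie_algebra G Y -> ~~ ('X^N0 %| mxmap (@polyC k) (mxexp N0 Y) cm) ->
    (ray q Y)`_d = 0.
  move=> gY nd; apply: (low_part_good Gq low gY (N0 := N0)) => x Yx.
  by rewrite -(cmE _ _ _ _ (eigenvalues_mxexp N0 Yx)).
have [m ltm cm0] : exists2 m, (m < N0)%N & (mxmap (@polyC k) (mxexp N0 X0) cm)`_m != 0.
  apply: NNPP => no; move/negP: good0; apply.
  rewrite -(cmE _ _ _ _ (eigenvalues_mxexp N0 Xx0)); apply/Xn_dvdP => m ltm.
  by apply/eqP; apply: contra_notT no => nz; exists m.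
pose XX : 'M[{poly k}]_n.+1 := map_mx (@polyC k) X0 + 'X *: map_mx (@polyC k) (X1 - X0).
have XXa a : map_mx (horner_eval a) XX = a *: (X1 - X0) + X0.
  apply/matrixP => i j; rewrite [LHS]mxE /horner_eval.
  rewrite ![(_ + _ : 'M_n.+1) _ _]mxE ![(_ *: _ : 'M_n.+1) _ _]mxE ![map_mx _ _ _ _]mxE.
  by rewrite hornerD hornerM hornerX !hornerC addrC.
have gXX a : lie_algebra G (map_mx (horner_eval a) XX).
  have [g0 gL] := lie_algebra_subspace; rewrite XXa; apply: (gL) => //.
  by rewrite addrC -scaleN1r; apply: gL.
pose al := (mxmap (@polyC {poly k} \o @polyC k) ('X *: map_mx (@polyC {poly k}) XX) q)`_d.
have alE a : al.[a] = (ray q (map_mx (horner_eval a) XX))`_d.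
  by rewrite -ray_family coef_map.
(* The truncated exponential of the whole line at once: the outer variable is [t], the inner one is
   the parameter of the line. *)
pose B : 'M[{poly {poly k}}]_n.+1 :=
  \matrix_(i, j) \poly_(l < N0) (l`!%:R^-1 *: (XX ^+ l) i j).
have BE a : map_mx (map_poly (horner_eval a)) B = mxexp N0 (map_mx (horner_eval a) XX).
  apply/matrixP => i j; rewrite !mxE; apply/polyP => l.
  rewrite coef_map coef_poly mxexp_entry; case: ifP => _; last by rewrite /= /horner_eval horner0.
  have <- : map_mx (horner_eval a) (XX ^+ l) = map_mx (horner_eval a) XX ^+ l by rewrite rmorphXn.
  by rewrite [map_mx _ _ i j]mxE /= /horner_eval hornerZ.
pose be := (mxmap (@polyC {poly k} \o @polyC k) B cm)`_m.
have beE a : be.[a] = (mxmap (@polyC k) (mxexp N0 (map_mx (horner_eval a) XX)) cm)`_m.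
  by rewrite -BE -mmap_family coef_map.
have be0 : be != 0.
  apply: contraNneq cm0 => be0; have := beE 0; rewrite be0 horner0 XXa scale0r add0r => <-.
  by [].
have ab : al * be = 0.
  apply: (poly_nat_roots_eq0 char0) => i; move: (i%:R) => a; rewrite hornerM.
  have [-> | nz] := eqVneq be.[a] 0; first by rewrite mulr0.
  rewrite alE good ?mul0r //; apply: contra nz => /Xn_dvdP /(_ m ltm) z.
  by rewrite beE z.
move/eqP: ab; rewrite mulf_eq0 (negPf be0) orbF => /eqP al0.
move/eqP: nzX1; case; have := alE 1.
by rewrite al0 horner0 XXa scale1r subrK => <-.
Qed.

End Dominance.

(** * Assembly of the morphism *)

Theorem theorem10p2 (k : closedFieldType) (char0 : [pchar k] =i pred0)
    (n : nat) (G : 'M[k]_n -> Prop)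
    (algG : linear_algebraic_group G) (connG : zariski_connected G) :
  exists phi : 'M[k]_n -> 'M[k]_n, generalized_Cayley_morphism G phi.
Proof.
case: n G algG connG => [|n] G algG connG.
  (* Size 0 is treated apart, since [horner_mx] works in the ring of matrices of positive size. Here
     the Lie algebra is a point. *)
  exists (fun=> 0); split.
  - by split=> [A GA p Gp | []//]; rewrite /mxdiff big_ord0.
  - move=> Z _ GZ X _; have <- : 0 = X by apply/matrixP => -[].
    exact: GZ (lag_one algG).
  - by move=> g X _ _; apply/matrixP => -[].
have irrG := connected_irreducible algG connG.
have [Q spQ] := spectral_prime_exists irrG.
have [F [c [M [symF [symc nQc] relM dualM nearF]]]] :=
  spectral_interpolation char0 (lag_one algG) spQ.
have [Phi PhiE] := sym_poly_mx symF.
have PhiE' (A : 'M[k]_n.+1) x : eigenvalues A x ->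
    map_mx (fun p => mxeval p A) Phi = horner_mx A (map_poly (meval x) F).
  exact: (PhiE _ idfun).
have Gphi := covariant_in_lie char0 algG irrG spQ relM nearF PhiE'.
exists (fun A => map_mx (fun p => mxeval p A) Phi); split.
- split=> [A GA p Gp | i j].
    by have := Gphi p Gp A GA; rewrite mxevalE mmap_lin_form.
  by exists (Phi i j), 0%N => A GA; rewrite expr0 divr1 mxE.
- move=> Z [S ZS] GZ X gX; apply/ZS => q Sq.
  apply: (vanishing_on_lie char0 algG irrG spQ symc nQc relM dualM nearF PhiE) gX => A GA.
  rewrite mxevalE mmap_mxcomp.
  by have /ZS /(_ q Sq) := GZ A GA.
- move=> g X Gg GX; have [x Xx] := eigenvalues_exist X.
  have ug := lag_unitmx algG Gg; have gX : g *m X = mxconj g X *m g by rewrite /mxconj mulmxKV.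
  have gx : eigenvalues (mxconj g X) x by rewrite /eigenvalues -(char_poly_similar ug gX).
  by rewrite (PhiE' _ _ gx) (PhiE' _ _ Xx) /Ad (horner_mx_similar _ gX) mulmxK.
Qed.
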